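(* Let $\overline q\in(0,1)$ and $\underline\rho>1$. Then there is $\widehat q\in(0,1)$ depending solely on $\overline q$ and $\underline\rho$ such that the following holds. Let $d\in\mathbb{N}$, $L\in\mathbb{N}$, $m\in\mathbb{N}_0$, $\kappa\ge0$, $\gamma>0$. Let $B_\ell^x=[\boldsymbol a_\ell^x,\boldsymbol b_\ell^x]\subset\mathbb{R}^d$, $\ell=0,\dots,L$, be boxes with $B_L^x\subset B_{L-1}^x\subset\cdots\subset B_0^x$ satisfying $$b_{\ell+1,i}^x-a_{\ell+1,i}^x\le\overline q\,(b_{\ell,i}^x-a_{\ell,i}^x)\qquad\text{for all }i=1,\dots,d,\ \ell=0,\dots,L-1.$$ Let $B^y=[\boldsymbol a^y,\boldsymbol b^y]\subset\mathbb{R}^d$ be a box. Let $\Phi$ be analytic and bounded on an open set $\Omega\subset\mathbb{C}^{2d}$ with $\mathcal{E}_\rho^{[\boldsymbol a_0^x,\boldsymbol b_0^x]}\times\mathcal{E}_\rho^{[\boldsymbol a^y,\boldsymbol b^y]}\subset\Omega$ for some $\rho\ge\underline\rho$, and real-valued on $B_0^x\times B^y$. Set $$d_\Omega:=\sup\{\varepsilon>0 \mid B_\varepsilon(x)\times B_\varepsilon(y)\subset\Omega\ \text{ for all }(x,y)\in\mathcal{E}_\rho^{[\boldsymbol a_0^x,\boldsymbol b_0^x]}\times\mathcal{E}_\rho^{[\boldsymbol a^y,\boldsymbol b^y]}\}$$ and suppose $d_\Omega>0$. Let $y_0,y_{-1},\dots,y_{-L}\in B^y$ and assume $$\kappa\,\operatorname{diam}B_\ell^x\,\|y_{-\ell-1}-y_{-\ell}\|\,\frac{\|\Phi\|_{L^\infty(\Omega)}}{d_\Omega^2}\le\gamma\qquad\text{for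 all }\ell=0,\dots,L-1.$$ Set $\mathfrak{I}_\ell:=\widehat{\mathfrak{I}}^{B_\ell^x}_{y_{-\ell}}$ for $\ell=0,\dots,L$ and $$C_1:=\frac{2d}{\rho-1}(1+\Lambda_m)^d\exp\Big(\gamma\Big(\frac{\rho+1/\rho}{2}+1\Big)\Big).$$ Then for $\ell=1,\dots,L$: $$\|(\mathrm{I}-\mathfrak{I}_\ell\circ\cdots\circ\mathfrak{I}_1)(E_{y_0}\pi)\|_{L^\infty(B_\ell^x)}\le\big((1+C_1\widehat q^{\,m})^\ell-1\big)\|\pi\|_{L^\infty(B_0^x)}\quad\text{for all }\pi\in\mathcal{Q}_m,$$ $$\|(\mathfrak{I}_\ell\circ\cdots\circ\mathfrak{I}_1)(E_{y_0}\pi)\|_{L^\infty(B_\ell^x)}\le(1+C_1\widehat q^{\,m})^\ell\|\pi\|_{L^\infty(B_0^x)}\quad\text{for all }\pi\in\mathcal{Q}_m,$$ $$\|\mathfrak{I}_\ell\circ\cdots\circ\mathfrak{I}_0\|_{C(B_\ell^x)\leftarrow C(B_0^x)}\le\Lambda_m^d(1+C_1\widehat q^{\,m})^\ell.$$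
   Context: A box is a product $[\boldsymbol a,\boldsymbol b]=\prod_{i=1}^d[a_i,b_i]$ of compact intervals with $a_i<b_i$; $\|\cdot\|$ and $\operatorname{diam}$ are Euclidean; $B_\varepsilon(z)$ is the Euclidean ball in $\mathbb{C}^d$ of radius $\varepsilon$ about $z$; $\mathrm{I}$ is the identity. Bernstein elliptic discs: for $\rho>1$, $\mathcal{E}_\rho:=\{z\in\mathbb{C}:|z-1|+|z+1|<\rho+1/\rho\}$, $\mathcal{E}_\rho^{[a,b]}:=\frac{a+b}{2}+\frac{b-a}{2}\mathcal{E}_\rho$, $\mathcal{E}_\rho^{[\boldsymbol a,\boldsymbol b]}:=\prod_{i=1}^d\mathcal{E}_\rho^{[a_i,b_i]}$. $I_m:C([-1,1])\to\mathcal{P}_m$ is a polynomial interpolation operator at $m+1$ distinct points of $[-1,1]$ (e.g. Chebyshev), with Lebesgue constant (operator norm) $\Lambda_m$; $\mathcal{P}_m$ is the space of univariate polynomials of degree at most $m$ (complex coefficients). $I_m^B:C(B)\to\mathcal{Q}_m$ is the corresponding tensor product interpolation operator, affinely transformed to the box $B$, with $\mathcal{Q}_m$ the $d$-variate polynomials of degree at most $m$ in each variable. For $z\in\mathbb{R}^d$, $E_z(x):=\exp(\mathbf{i}\kappa\Phi(x,z))$ and $\widehat{\mathfrak{I}}^B_zf:=E_z\,I_m^B\big(\tfrac1{E_z}f\big)$. In compositions $\mathfrak{I}_{\ell+1}\circ\mathfrak{I}_\ell$, the output of $\mathfrak{I}_\ell$ is restricted to $B_{\ell+1}^x$. *)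

(* Defs.v *)
From HB Require Import structures.
From mathcomp Require Import all_boot all_order all_algebra finmap.
From mathcomp Require Import complex.
From mathcomp Require Import all_classical all_reals all_analysis.
From mathcomp.analysis.showcase Require Import summability.

Set Implicit Arguments.
Unset Strict Implicit.
Unset Printing Implicit Defensive.

Import Order.TTheory GRing.Theory Num.Theory.
Import numFieldNormedType.Exports.
Local Open Scope classical_set_scope.
Local Open Scope ring_scope.
Local Open Scope complex_scope.

(* The regular-module alias is what carries the topology of R[i]. *)
Notation Cx R := (R[i]^o).
Notation normc := ComplexField.Normc.normc.

Definition cexp (R : realType) (z : R[i]) : R[i] :=
  (expR (complex.Re z))%:C * (cos (complex.Im z) +i* sin (complex.Im z)).

Definition enorm (R : realType) (n : nat) (x : 'rV[R]_n) : R :=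
  Num.sqrt (\sum_(i < n) x 0 i ^+ 2).

Definition cenorm (R : realType) (n : nat) (z : 'rV[Cx R]_n) : R :=
  Num.sqrt (\sum_(i < n) normc (z 0 i) ^+ 2).

Definition cball (R : realType) (n : nat) (e : R) (z : 'rV[Cx R]_n) :
    set 'rV[Cx R]_n :=
  [set w | cenorm (w - z) < e].

Definition diam (R : realType) (n : nat) (A : set 'rV[R]_n) : R :=
  sup [set enorm (x - y) | x in A & y in A].

(* Only applied to functions that are continuous on A, with A a box, an
   interval or an open set, for which the essential supremum is the supremum. *)
Definition supnorm (R : realType) (X : Type) (A : set X) (f : X -> Cx R) :
    \bar R :=
  ereal_sup [set (normc (f x))%:E | x in A].

(* Norm of T as an operator from C(A) to C(B). *)
Definition opnorm (R : realType) (X Y : topologicalType) (A : set X)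
    (B : set Y) (T : (X -> Cx R) -> (Y -> Cx R)) : \bar R :=
  ereal_sup [set supnorm B (T f) |
    f in [set f | {within A, continuous f} /\ (supnorm A f <= 1)%E]].

Record box (R : realType) (d : nat) := Box {
  lo : 'rV[R]_d;
  hi : 'rV[R]_d;
  lo_lt_hi : forall i, lo 0 i < hi 0 i }.

Definition boxset (R : realType) (d : nat) (B : box R d) : set 'rV[R]_d :=
  [set x | forall i, lo B 0 i <= x 0 i <= hi B 0 i].

Definition bernstein (R : realType) (rho : R) : set (Cx R) :=
  [set z | normc (z - 1) + normc (z + 1) < rho + rho^-1].

Definition bernstein_itv (R : realType) (rho a b : R) : set (Cx R) :=
  [set ((a + b) / 2)%:C + ((b - a) / 2)%:C * z | z in bernstein rho].

Definition bernstein_box (R : realType) (d : nat) (rho : R) (B : box R d) :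
    set 'rV[Cx R]_d :=
  [set z | forall i, bernstein_itv rho (lo B 0 i) (hi B 0 i) (z 0 i)].

Definition setprod (T : Type) (n p : nat) (A : set 'rV[T]_n)
    (B : set 'rV[T]_p) : set 'rV[T]_(n + p) :=
  [set row_mx x y | x in A & y in B].

(* +oo when Omega is the whole space, -oo when no admissible radius exists. *)
Definition dOmega (R : realType) (d : nat) (rho : R) (Bx By : box R d)
    (Omega : set 'rV[Cx R]_(d + d)) : \bar R :=
  ereal_sup [set e%:E | e in [set e : R | 0 < e /\
    forall x y, bernstein_box rho Bx x -> bernstein_box rho By y ->
      setprod (cball e x) (cball e y) `<=` Omega]].

(* Analyticity in n complex variables: near every point of Omega, f is the
   unconditional sum of a multivariate power series about that point. *)
Definition analytic_on (R : realType) (n : nat) (Omega : set 'rV[Cx R]_n)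
    (f : 'rV[Cx R]_n -> Cx R) : Prop :=
  forall w, Omega w ->
    exists c : {ffun 'I_n -> nat} -> Cx R,
      nbhs w [set z : 'rV[Cx R]_n |
        partial_sum (fun alpha : {ffun 'I_n -> nat} =>
            c alpha * \prod_(i < n) (z 0 i - w 0 i) ^+ alpha i)
          @ totally --> f z].

Definition lagrange_basis (R : realType) (m : nat) (t : 'I_m.+1 -> R)
    (k : 'I_m.+1) : {poly R} :=
  \prod_(j < m.+1 | j != k) ((t k - t j)^-1 *: ('X - (t j)%:P)).

Definition interp (R : realType) (m : nat) (t : 'I_m.+1 -> R)
    (f : R -> Cx R) : {poly R[i]} :=
  \sum_(k < m.+1) f (t k) *: map_poly (real_complex R) (lagrange_basis t k).

(* The operator norm is finite (it is at most the sum of the sup norms of the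
   Lagrange basis polynomials), so fine loses nothing. *)
Definition lebesgue_const (R : realType) (m : nat) (t : 'I_m.+1 -> R) : R :=
  fine (opnorm `[(-1 : R), 1] `[(-1 : R), 1]
    (fun (f : R -> Cx R) (x : R) => (interp t f).[x%:C] : Cx R)).

Definition tensor_interp (R : realType) (d m : nat) (t : 'I_m.+1 -> R)
    (f : 'rV[R]_d -> Cx R) (x : 'rV[R]_d) : Cx R :=
  \sum_(k : {ffun 'I_d -> 'I_m.+1})
    f (\row_i t (k i)) * \prod_(i < d) ((lagrange_basis t (k i)).[x 0 i])%:C.

(* The affine bijection from [-1, 1]^d to the box, and its inverse. *)
Definition to_box (R : realType) (d : nat) (B : box R d) (x : 'rV[R]_d) :
    'rV[R]_d :=
  \row_i ((lo B 0 i + hi B 0 i) / 2 + (hi B 0 i - lo B 0 i) / 2 * x 0 i).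

Definition of_box (R : realType) (d : nat) (B : box R d) (x : 'rV[R]_d) :
    'rV[R]_d :=
  \row_i ((2 * x 0 i - (lo B 0 i + hi B 0 i)) / (hi B 0 i - lo B 0 i)).

Definition box_interp (R : realType) (d m : nat) (t : 'I_m.+1 -> R)
    (B : box R d) (f : 'rV[R]_d -> Cx R) : 'rV[R]_d -> Cx R :=
  fun x => tensor_interp t (fun u => f (to_box B u)) (of_box B x).

Definition Qpoly (R : realType) (d m : nat) : set ('rV[R]_d -> Cx R) :=
  [set p : 'rV[R]_d -> Cx R | exists c : {ffun 'I_d -> 'I_m.+1} -> R[i],
    forall x : 'rV[R]_d, p x = \sum_(alpha : {ffun 'I_d -> 'I_m.+1})
      c alpha * \prod_(i < d) (x 0 i)%:C ^+ alpha i].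

Definition cpair (R : realType) (d : nat) (x y : 'rV[R]_d) :
    'rV[Cx R]_(d + d) :=
  row_mx (map_mx (real_complex R) x) (map_mx (real_complex R) y).

Definition Efun (R : realType) (d : nat) (kappa : R)
    (Phi : 'rV[Cx R]_(d + d) -> Cx R) (z x : 'rV[R]_d) : Cx R :=
  cexp ('i%C * kappa%:C * Phi (cpair x z)).

Definition dir_interp (R : realType) (d m : nat) (t : 'I_m.+1 -> R)
    (kappa : R) (Phi : 'rV[Cx R]_(d + d) -> Cx R) (B : box R d) (z : 'rV[R]_d)
    (f : 'rV[R]_d -> Cx R) : 'rV[R]_d -> Cx R :=
  fun x => Efun kappa Phi z x
           * box_interp t B (fun u => (Efun kappa Phi z u)^-1 * f u) x.

(* comp_ops J k l is J l \o ... \o J k, for k <= l. With nested boxes the nodes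
   of J l.+1 lie in the box of J l, so restricting intermediate results to
   smaller boxes does not change any value. *)
Definition comp_ops (T : Type) (J : nat -> T -> T) (k l : nat) (f : T) : T :=
  foldl (fun g j => J j g) f (index_iota k l.+1).

(* Main.v *)
(* With pi in Q_m, the error of the l-th step is E_{y_l} (I - I_m)(g), where
   g = exp(i kappa (Phi(., y_{l-1}) - Phi(., y_l))) pi. Along each coordinate g extends
   analytically to the Bernstein ellipse of parameter rho of the box B_l, which lies in the
   ellipse of B_{l-1} of parameter rho' = 1 + sqrt qbar (rho - 1). There Bernstein's
   inequality bounds pi by rho'^m, and two Cauchy estimates, one in x and one in y, bound
   the phase. Truncating the Chebyshev series of g costs 2 rho^-m / (rho - 1), so each step
   contributes (rho' / rho)^m <= qhat^m, with qhat = sqrt qbar + (1 - sqrt qbar) / rhomin.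

   Contour integrals are replaced by means over N-th roots of unity. In the variable
   z = log w, a mean over N points of a vertical segment of length 2 pi changes by O(1/N)
   when the segment is translated horizontally: a horizontal increment is -i times the
   vertical increment up to a quadratic error, and vertical increments telescope to 0. *)

Require Import Defs.
From HB Require Import structures.
From mathcomp Require Import all_boot all_order all_algebra finmap.
From mathcomp Require Import complex.
From mathcomp Require Import all_classical all_reals all_analysis.
From mathcomp.analysis.showcase Require Import summability.
From mathcomp Require Import ring lra.

Set Implicit Arguments.
Unset Strict Implicit.
Unset Printing Implicit Defensive.

Import Order.TTheory GRing.Theory Num.Theory.
Import numFieldNormedType.Exports.
Local Open Scope classical_set_scope.
Local Open Scope ring_scope.
Local Open Scope complex_scope.

(** * The complex norm and exponential *)

Section ComplexNorm.
Variable R : realType.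
Implicit Types (z w : R[i]) (a b : R).

(** The phase condition involves [dOmega], a supremum that need not be attained and may be [+oo],
    whereas the two Cauchy estimates need one admissible radius [eps]. Choosing [eps] close to the
    supremum loses a factor 2 in that condition. The loss is regained exactly: the phase is compared
    with its value at the centre of the box, where it is real, so only half the width of the box
    enters, while the condition is stated with the full diameter.

    Bernstein's inequality is available at every step because the iterates keep the form
    [E_{y_k} p_k] with [p_k] in [Q_m]. As [E_{y_k}] has modulus 1 on the real boxes, each step
    multiplies the norm by at most [1 + c], with [c = C1 * qhat ^+ m], and adds an error of [c]
    times the current norm; the powers of [1 + c] come from this recursion alone.

    Two regularity classes appear. [hol] carries Cauchy's theorem, but the divided difference of a
    [hol] function is only seen to be Lipschitz at the removed singularity, so contours are stopped
    just before that point and a continuity argument bridges the gap. *)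

Lemma normc_ge0 z : 0 <= normc z.
Proof. by case: z => a b /=; rewrite sqrtr_ge0. Qed.

Lemma normr_normc z : `|z| = (normc z)%:C.
Proof. by rewrite normc_def; case: z. Qed.

Lemma normc0 : normc (0 : R[i]) = 0.
Proof. exact: ComplexField.Normc.normc0. Qed.

Lemma normc1 : normc (1 : R[i]) = 1.
Proof. exact: ComplexField.Normc.normc1. Qed.

Lemma normcM z w : normc (z * w) = normc z * normc w.
Proof. exact: ComplexField.Normc.normcM. Qed.

Lemma normcV z : normc z^-1 = (normc z)^-1.
Proof. exact: ComplexField.Normc.normcV. Qed.

Lemma normcf_div z w : normc (z / w) = normc z / normc w.
Proof. by rewrite normcM normcV. Qed.

Lemma normcX z n : normc (z ^+ n) = normc z ^+ n.
Proof. by elim: n => [|n IH]; rewrite ?normc1 // !exprS normcM IH. Qed.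

Lemma normc_opp z : normc (- z) = normc z.
Proof. exact: normcN. Qed.

Lemma normc_distC z w : normc (z - w) = normc (w - z).
Proof. by rewrite -normc_opp opprB. Qed.

Lemma ler_normcD z w : normc (z + w) <= normc z + normc w.
Proof. exact: le_normcD. Qed.

Lemma ler_normcB z w : normc (z - w) <= normc z + normc w.
Proof. by rewrite (le_trans (ler_normcD _ _)) ?normc_opp. Qed.

Lemma ler_normc_dist u z w : normc (z - w) <= normc (z - u) + normc (u - w).
Proof. by apply: le_trans (ler_normcD _ _); rewrite addrA subrK. Qed.

Lemma ler_subc_normc z w : normc z - normc w <= normc (z - w).
Proof.
have := ler_normcD (z - w) w; rewrite subrK => h.
by rewrite lerBlDr.
Qed.

Lemma normc_real a : normc a%:C = `|a|.
Proof. by rewrite /= expr0n /= addr0 sqrtr_sqr. Qed.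

Lemma normc_eq0 z : (normc z == 0) = (z == 0).
Proof.
apply/eqP/eqP => [/ComplexField.Normc.eq0_normc //|->]; exact: normc0.
Qed.

Lemma normc_gt0 z : (0 < normc z) = (z != 0).
Proof. by rewrite lt_def normc_ge0 andbT normc_eq0. Qed.

Lemma normc_nat n : normc (n%:R : R[i]) = n%:R.
Proof. by rewrite -(rmorph_nat (real_complex R)) normc_real normr_nat. Qed.

Lemma ler_normc_sum (I : Type) (r : seq I) (P : pred I) (F : I -> R[i]) :
  normc (\sum_(i <- r | P i) F i) <= \sum_(i <- r | P i) normc (F i).
Proof.
elim/big_ind2: _ => // [|x1 x2 y1 y2 h1 h2]; first by rewrite normc0.
exact: le_trans (ler_normcD _ _) (lerD h1 h2).
Qed.

Lemma ler_Re_normc z : `|complex.Re z| <= normc z.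
Proof.
by case: z => a b /=; rewrite -sqrtr_sqr ler_wsqrtr // lerDl sqr_ge0.
Qed.

Lemma ler_Im_normc z : `|complex.Im z| <= normc z.
Proof.
by case: z => a b /=; rewrite -sqrtr_sqr ler_wsqrtr // lerDr sqr_ge0.
Qed.

Lemma ler_normc_ReIm z : normc z <= `|complex.Re z| + `|complex.Im z|.
Proof.
case: z => a b /=.
rewrite -[leRHS]ger0_norm ?addr_ge0 // -sqrtr_sqr ler_wsqrtr //.
rewrite -(real_normK (num_real a)) -(real_normK (num_real b)).
by have := mulr_ge0 (normr_ge0 a) (normr_ge0 b); nra.
Qed.

End ComplexNorm.

Section ComplexExponential.
Variable R : realType.
Implicit Types (z w : R[i]) (a b : R).

Lemma cexpD z w : cexp (z + w) = cexp z * cexp w.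
Proof.
case: z w => [a b] [c d]; rewrite /cexp /= expRD cosD sinD.
by simpc; congr (_ +i* _); ring.
Qed.

Lemma cexp0 : cexp (0 : R[i]) = 1.
Proof. by rewrite /cexp /= expR0 cos0 sin0; simpc. Qed.

Lemma cexpM_N z : cexp z * cexp (- z) = 1.
Proof. by rewrite -cexpD subrr cexp0. Qed.

Lemma cexp_neq0 z : cexp z != 0.
Proof.
by apply/eqP => h; have := cexpM_N z; rewrite h mul0r => /esym/eqP; rewrite oner_eq0.
Qed.

Lemma cexpN z : cexp (- z) = (cexp z)^-1.
Proof.
by apply: (mulfI (cexp_neq0 z)); rewrite cexpM_N mulfV // cexp_neq0.
Qed.

Lemma normc_cexp z : normc (cexp z) = expR (complex.Re z).
Proof.
rewrite /cexp normcM normc_real ger0_norm ?expR_ge0 //.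
by rewrite /= cos2Dsin2 sqrtr1 mulr1.
Qed.

Lemma cexp_natM n z : cexp (n%:R * z) = cexp z ^+ n.
Proof.
elim: n => [|n IH]; first by rewrite mul0r cexp0.
by rewrite exprS -IH -cexpD -natr1 mulrDl mul1r addrC.
Qed.

Lemma abs_sin_le b : `|sin b| <= `|b|.
Proof.
wlog b0 : b / 0 <= b.
  move=> h; case: (leP 0 b) => hb; first exact: h.
  by rewrite -normrN -sinN -(normrN b); apply: h; rewrite oppr_ge0 ltW.
have [c _] := @MVT_segment R sin cos 0 b b0
  (fun x _ => is_derive_sin x)
  (continuous_subspaceT (@continuous_sin R)).
rewrite sin0 !subr0 => ->; rewrite normrM ler_piMl //.
by rewrite ler_norml cos_geN1 cos_le1.
Qed.

Lemma abs_cos_sub1_le b : `|cos b - 1| <= b ^+ 2.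
Proof.
have -> : cos b - 1 = - (2 * sin (b / 2) ^+ 2).
  have -> : cos b = cos ((b / 2) *+ 2) by congr cos; rewrite mulr2n; lra.
  by rewrite cos_mulr2n; have := cos2Dsin2 (b / 2); move=> h; rewrite mulr2n; lra.
have h := abs_sin_le (b / 2); rewrite normrN normrM normrX normr_nat.
have : `|sin (b / 2)| ^+ 2 <= `|b / 2| ^+ 2 by rewrite lerXn2r ?nnegrE.
rewrite (real_normK (num_real (b / 2))) => h2.
by have := sqr_ge0 b; nra.
Qed.

Lemma abs_sin_sub_le b : `|b| <= 1 -> `|sin b - b| <= b ^+ 2.
Proof.
wlog b0 : b / 0 <= b.
  move=> h; case: (leP 0 b) => hb; first exact: h.
  move=> b1; have := h (- b); rewrite sinN opprK normrN sqrrN oppr_ge0 => /(_ (ltW hb) b1).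
  by rewrite -normrN opprD !opprK.
move=> b1.
have hd (x : R) : x \in `]0, b[ -> is_derive x (1:R) (fun x => sin x - x) (cos x - 1).
  by move=> _; apply: is_deriveB.
have hc : {within `[0, b], continuous (fun x => sin x - x)}.
  apply: continuous_subspaceT => x.
  by apply: cvgB; [exact: continuous_sin|exact: cvg_id].
have [c] := MVT_segment b0 hd hc.
rewrite sin0 !subr0 => /itvP cb ->; rewrite normrM expr2 (ger0_norm b0).
apply: ler_wpM2r => //; apply: le_trans (abs_cos_sub1_le c) _.
rewrite (ger0_norm b0) in b1.
have c0 : 0 <= c by rewrite cb.
have cb' : c <= b by rewrite cb.
nra.
Qed.

(** Only [1 + a <= expR a] is used: at [- a] it gives [expR a <= (1 - a)^-1], and the rest is
    algebra. *)
Lemma abs_expR_sub1_le a : `|a| <= 1/2 -> `|expR a - 1 - a| <= 2 * a ^+ 2.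
Proof.
move=> ha; have := expR_ge1Dx a; have := expR_ge1Dx (- a).
rewrite expRN => h1 h2; rewrite ger0_norm; last by lra.
move: ha; rewrite ler_norml => /andP[a1 a2].
have ia : 0 < 1 - a by lra.
have : expR a <= (1 - a)^-1.
  by rewrite -[expR a]invrK lef_pV2 ?posrE ?invr_gt0 ?expR_gt0.
move=> h3; suff : (1 - a)^-1 <= 1 + a + 2 * a ^+ 2 by lra.
rewrite -[X in X <= _]mul1r ler_pdivrMr //.
have := sqr_ge0 a; nra.
Qed.

Lemma normc_cexp_sub1_le z : normc z <= 1/2 ->
  normc (cexp z - 1 - z) <= 12 * normc z ^+ 2.
Proof.
move=> hz; have hr := le_trans (ler_Re_normc z) hz.
have hi := le_trans (ler_Im_normc z) hz.
apply: le_trans (ler_normc_ReIm _) _.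
have : `|complex.Re z| ^+ 2 <= normc z ^+ 2.
  by rewrite lerXn2r ?nnegrE ?normc_ge0 ?ler_Re_normc.
have : `|complex.Im z| ^+ 2 <= normc z ^+ 2.
  by rewrite lerXn2r ?nnegrE ?normc_ge0 ?ler_Im_normc.
move: (normc z ^+ 2) => m2.
case: z hz hr hi => a b /= _ hr hi.
rewrite !mul0r !subr0 addr0 ?(real_normK (num_real _)) => hb ha.
have e1 := abs_expR_sub1_le hr.
have e2 := abs_cos_sub1_le b.
have e3 := abs_sin_le b.
have e4 : `|sin b - b| <= b ^+ 2 by apply: abs_sin_sub_le; lra.
have ecos : `|cos b| <= 1 by rewrite ler_norml cos_geN1 cos_le1.
have -> : expR a * cos b - 1 - a = (expR a - 1 - a) * cos b + (1 + a) * (cos b - 1) by ring.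
have -> : expR a * sin b - b = (expR a - 1 - a) * sin b + a * sin b + (sin b - b) by ring.
(* Each of the two parts costs at most [4 * m2], within the 12 of the statement. *)
have n1 : `|(expR a - 1 - a) * cos b + (1 + a) * (cos b - 1)| <= 2 * m2 + 2 * m2.
  apply: le_trans (ler_normD _ _) _; rewrite !normrM.
  apply: lerD.
    apply: le_trans (ler_piMr _ ecos) _ => //; lra.
  have : `|1 + a| <= 2 by apply: le_trans (ler_normD _ _) _; rewrite normr1; lra.
  move=> h; apply: le_trans (ler_pM _ _ h e2) _ => //; lra.
have n2 : `|(expR a - 1 - a) * sin b + a * sin b + (sin b - b)| <= 2 * m2 + m2 + m2.
  apply: le_trans (ler_normD _ _) _.
  apply: lerD; last by lra.
  apply: le_trans (ler_normD _ _) _; rewrite !normrM.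
  apply: lerD.
    have : `|sin b| <= 1 by lra.
    move=> h; apply: le_trans (ler_piMr _ h) _ => //; lra.
  apply: le_trans (ler_wpM2l (normr_ge0 a) e3) _.
  have := real_normK (num_real a); have := real_normK (num_real b).
  have := normr_ge0 a; have := normr_ge0 b; have := sqr_ge0 (`|a| - `|b|).
  nra.
have m20 : 0 <= m2 by apply: le_trans ha; exact: sqr_ge0.
by move: n1 n2; rewrite ?subr0 ?oppr0 ?addr0; lra.
Qed.

End ComplexExponential.

(** * Holomorphy with a uniform remainder *)

(* Complex differentiability near z0 with a locally uniform quadratic remainder:
   this uniformity is what replaces Goursat's argument. *)
Definition hol (R : realType) (f : R[i] -> R[i]) (z0 : R[i]) : Prop :=
  exists (D : R[i] -> R[i]) (K e : R), 0 < e /\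
    forall z w, normc (z - z0) < e -> normc (w - z0) < e ->
      normc (D z) <= K /\
      normc (f w - f z - D z * (w - z)) <= K * normc (w - z) ^+ 2.

Section Hol.
Variable R : realType.
Implicit Types (f g : R[i] -> R[i]) (z w : R[i]).

(** Bounds for values and increments follow from those for the derivative and the remainder, since
    [w - z] has modulus at most [2 * e]. A single constant for all four makes the closure properties
    below short. *)
Lemma hol_bounds f z0 : hol f z0 ->
  exists (D : R[i] -> R[i]) (K e : R), [/\ 0 < e, 0 <= K &
    forall z w, normc (z - z0) < e -> normc (w - z0) < e ->
      [/\ normc (f z) <= K, normc (D z) <= K,
          normc (f w - f z) <= K * normc (w - z) &
          normc (f w - f z - D z * (w - z)) <= K * normc (w - z) ^+ 2]].
Proof.
move=> [D [K [e [e0 h]]]].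
have z00 : normc (z0 - z0) < e by rewrite subrr normc0.
have K0 : 0 <= K by have [+ _] := h z0 z0 z00 z00; apply: le_trans (normc_ge0 _).
have lip z w : normc (z - z0) < e -> normc (w - z0) < e ->
    normc (f w - f z) <= K * (1 + 2 * e) * normc (w - z).
  move=> hz hw; have [h1 h2] := h z w hz hw.
  have hzw : normc (w - z) <= 2 * e.
    by have := ler_normc_dist z0 w z; rewrite (normc_distC z0 z); lra.
  rewrite -[f w - f z](subrK (D z * (w - z))).
  apply: le_trans (ler_normcD _ _) _; rewrite normcM.
  have n0 := normc_ge0 (w - z).
  have := ler_wpM2r n0 h1.
  have : K * normc (w - z) ^+ 2 <= K * ((2 * e) * normc (w - z)).
    by rewrite expr2 ler_wpM2l // ler_wpM2r.
  nra.
pose K' := normc (f z0) + K * (1 + 2 * e) * (1 + e).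
have KK' : K * (1 + 2 * e) <= K'.
  have : 0 <= K * (1 + 2 * e) by apply: mulr_ge0 => //; lra.
  have := normc_ge0 (f z0); rewrite /K'; nra.
have KK1 : K <= K * (1 + 2 * e) by nra.
exists D, K', e; split => //; first by lra.
move=> z w hz hw; have [h1 h2] := h z w hz hw; split.
- rewrite -[f z](subrK (f z0)); apply: le_trans (ler_normcD _ _) _.
  have := lip z0 z z00 hz; rewrite /K' => h3; rewrite addrC lerD2l.
  apply: le_trans h3 _; apply: ler_wpM2l; last by lra.
  by apply: mulr_ge0 => //; lra.
- by lra.
- by apply: le_trans (lip z w hz hw) _; rewrite ler_wpM2r // normc_ge0.
- by apply: le_trans h2 _; rewrite ler_wpM2r ?sqr_ge0 //; lra.
Qed.

Lemma eq_hol f g z0 : f =1 g -> hol f z0 -> hol g z0.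
Proof. by move=> /funext ->. Qed.

Lemma hol_cst (c : R[i]) z0 : hol (fun=> c) z0.
Proof.
exists (fun=> 0), 0, 1; split => // z w _ _.
by rewrite normc0 mul0r subrr subr0 normc0 mul0r.
Qed.

Lemma hol_id z0 : hol (fun z => z) z0.
Proof.
exists (fun=> 1), 1, 1; split => // z w _ _.
by rewrite normc1 !mul1r subrr normc0 sqr_ge0.
Qed.

Lemma hol_add f g z0 : hol f z0 -> hol g z0 -> hol (fun z => f z + g z) z0.
Proof.
move=> /hol_bounds[D [K [e [e0 K0 h]]]] /hol_bounds[D' [K' [e' [e'0 K'0 h']]]].
exists (fun z => D z + D' z), (K + K'), (Num.min e e'); split.
  by rewrite lt_min e0.
move=> z w; rewrite !lt_min => /andP[z1 z2] /andP[w1 w2].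
have [_ a2 _ a4] := h z w z1 w1; have [_ b2 _ b4] := h' z w z2 w2; split.
  by apply: le_trans (ler_normcD _ _) _; exact: lerD.
rewrite [X in normc X <= _](_ : _ = (f w - f z - D z * (w - z)) + (g w - g z - D' z * (w - z)));
  last by ring.
by apply: le_trans (ler_normcD _ _) _; rewrite mulrDl; exact: lerD.
Qed.

Lemma hol_mul f g z0 : hol f z0 -> hol g z0 -> hol (fun z => f z * g z) z0.
Proof.
move=> /hol_bounds[D [K [e [e0 K0 h]]]] /hol_bounds[D' [K' [e' [e'0 K'0 h']]]].
exists (fun z => D z * g z + f z * D' z), (3 * K * K'), (Num.min e e'); split.
  by rewrite lt_min e0.
move=> z w; rewrite !lt_min => /andP[z1 z2] /andP[w1 w2].
have [a1 a2 a3 a4] := h z w z1 w1; have [b1 b2 b3 b4] := h' z w z2 w2.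
have KK0 := mulr_ge0 K0 K'0; split.
  apply: le_trans (ler_normcD _ _) _; rewrite !normcM.
  have := ler_pM (normc_ge0 _) (normc_ge0 _) a2 b1.
  have := ler_pM (normc_ge0 _) (normc_ge0 _) a1 b2; lra.
(* Three terms, each at most [K * K' * normc (w - z) ^+ 2]: this is the 3 in the witness. *)
rewrite [X in normc X <= _](_ : _ = (f w - f z - D z * (w - z)) * g z +
   f z * (g w - g z - D' z * (w - z)) + (f w - f z) * (g w - g z)); last by ring.
apply: le_trans (ler_normcD _ _) _.
apply: le_trans (lerD (ler_normcD _ _) (lexx _)) _; rewrite !normcM.
have := ler_pM (normc_ge0 _) (normc_ge0 _) a4 b1.
have := ler_pM (normc_ge0 _) (normc_ge0 _) a1 b4.
have := ler_pM (normc_ge0 _) (normc_ge0 _) a3 b3.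
by move: (normc (w - z)) => n; nra.
Qed.

Lemma hol_opp f z0 : hol f z0 -> hol (fun z => - f z) z0.
Proof.
move=> hf; have := hol_mul (hol_cst (-1) z0) hf.
by congr hol; apply/funext => z; rewrite mulN1r.
Qed.

Lemma hol_sub f g z0 : hol f z0 -> hol g z0 -> hol (fun z => f z - g z) z0.
Proof. by move=> hf /hol_opp; exact: hol_add. Qed.

Lemma hol_exp f n z0 : hol f z0 -> hol (fun z => f z ^+ n) z0.
Proof.
move=> hf; elim: n => [|n IH]; first exact: hol_cst.
have := hol_mul hf IH.
by congr hol; apply/funext => z; rewrite exprS.
Qed.

Lemma hol_sum (I : Type) (r : seq I) (P : pred I) (F : I -> R[i] -> R[i]) z0 :
  (forall i, P i -> hol (F i) z0) -> hol (fun z => \sum_(i <- r | P i) F i z) z0.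
Proof.
move=> h; elim: r => [|i r IH].
  by apply: eq_hol (hol_cst _ _) => z; rewrite big_nil.
case Pi: (P i); last by apply: eq_hol IH => z; rewrite big_cons Pi.
apply: (@eq_hol (fun z => F i z + \sum_(j <- r | P j) F j z)) => [z|]; first by rewrite big_cons Pi.
 apply: hol_add => //; exact: h.
Qed.

Lemma hol_comp f g z0 : hol g z0 -> hol f (g z0) -> hol (fun z => f (g z)) z0.
Proof.
move=> /hol_bounds[D' [K' [e' [e'0 K'0 h']]]] /hol_bounds[D [K [e [e0 K0 h]]]].
exists (fun z => D (g z) * D' z), (K * K' ^+ 2 + K * K'), (Num.min e' (e / (K' + 1))).
have K'1 : 0 < K' + 1 by lra.
split; first by rewrite lt_min e'0 divr_gt0.
have z00 : normc (z0 - z0) < e' by rewrite subrr normc0.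
have gnear z : normc (z - z0) < e' -> normc (z - z0) < e / (K' + 1) ->
    normc (g z - g z0) < e.
  move=> z1; rewrite ltr_pdivlMr // => z2.
  have [_ _ + _] := h' z0 z z00 z1; move=> h3.
  by have := normc_ge0 (z - z0); nra.
move=> z w; rewrite !lt_min => /andP[z1 z2] /andP[w1 w2].
have [_ a2 _ a4] := h _ _ (gnear z z1 z2) (gnear w w1 w2).
have [_ b2 b3 b4] := h' z w z1 w1.
have KK := mulr_ge0 K0 K'0; split.
  rewrite normcM; apply: le_trans (ler_pM (normc_ge0 _) (normc_ge0 _) a2 b2) _.
  by rewrite lerDr mulr_ge0 // sqr_ge0.
rewrite [X in normc X <= _](_ : _ = (f (g w) - f (g z) - D (g z) * (g w - g z)) +
   D (g z) * (g w - g z - D' z * (w - z))); last by ring.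
apply: le_trans (ler_normcD _ _) _; rewrite normcM mulrDl.
apply: lerD.
  apply: le_trans a4 _; rewrite -mulrA ler_wpM2l // -exprMn.
  by rewrite lerXn2r ?nnegrE ?mulr_ge0 ?normc_ge0.
by rewrite -mulrA; apply: ler_pM; rewrite ?normc_ge0.
Qed.

Lemma hol_inv z0 : z0 != 0 -> hol (fun z => z^-1) z0.
Proof.
rewrite -normc_gt0 => n0; set c := normc z0 / 2.
have c0 : 0 < c by rewrite /c; lra.
exists (fun z => - z^-1 ^+ 2), (c ^- 2 + c ^- 3), c; split => //.
have ge z : normc (z - z0) < c -> [/\ z != 0 & (normc z)^-1 <= c^-1].
  move=> hz; have := ler_subc_normc z0 z; rewrite normc_distC => h.
  have cz : c < normc z by rewrite /c in hz *; lra.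
  split; first by rewrite -normc_gt0; exact: lt_trans cz.
  by rewrite lef_pV2 ?posrE ?ltW //; apply: lt_trans cz.
move=> z w /ge[z0' z1] /ge[w0 w1].
have ic0 : 0 <= c^-1 by rewrite invr_ge0 ltW.
have h2 : (normc z)^-1 ^+ 2 <= c ^- 2.
  by rewrite -exprVn lerXn2r ?nnegrE ?invr_ge0 ?normc_ge0 ?(ltW c0).
split.
  rewrite normc_opp normcX normcV; apply: le_trans h2 _.
  by rewrite lerDl -exprVn exprn_ge0.
(* The remainder is an exact product. On the disc of radius [normc z0 / 2] its second factor is at
   most [c ^- 3]. *)
rewrite [X in normc X <= _](_ : _ = (w - z) ^+ 2 * (w^-1 * z^-1 ^+ 2)); last by field; rewrite z0' w0.
rewrite normcM normcX (normcM w^-1) normcX !normcV mulrC ler_wpM2r ?sqr_ge0 //.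
apply: le_trans (_ : c ^- 3 <= _); last by rewrite lerDr -exprVn exprn_ge0.
have -> : c ^- 3 = c^-1 * c ^- 2 by rewrite -!exprVn -exprS.
apply: ler_pM => //; rewrite ?exprn_ge0 ?invr_ge0 ?normc_ge0 ?(ltW c0) //.
Qed.

Lemma hol_cexp z0 : hol (@cexp R) z0.
Proof.
set K := expR (complex.Re z0 + 1).
exists (fun z => cexp z), (12 * K), (1/4); split; first by lra.
have K0 : 0 < K by exact: expR_gt0.
have bd z : normc (z - z0) < 1/4 -> normc (cexp z) <= K.
  move=> hz; rewrite normc_cexp ler_expR.
  have -> : complex.Re z = complex.Re (z - z0) + complex.Re z0.
    by case: (z) (z0) => a b [c d] /=; rewrite subrK.
  have := ler_Re_normc (z - z0); rewrite ler_norml => /andP[_]; lra.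
move=> z w hz hw; split; first by have := bd z hz; lra.
have hzw : normc (w - z) <= 1/2.
  by have := ler_normc_dist z0 w z; rewrite (normc_distC z0 z); lra.
have -> : cexp w - cexp z - cexp z * (w - z) = cexp z * (cexp (w - z) - 1 - (w - z)).
  have -> : cexp w = cexp z * cexp (w - z) by rewrite -cexpD addrC subrK.
  by ring.
rewrite normcM; apply: le_trans (_ : K * (12 * normc (w - z) ^+ 2) <= _); last by lra.
by apply: ler_pM; rewrite ?normc_ge0 ?bd ?normc_cexp_sub1_le.
Qed.

Lemma hol_poly (p : {poly R[i]}) z0 : hol (fun z => p.[z]) z0.
Proof.
apply: (@eq_hol (fun z => \sum_(i < size p) p`_i * z ^+ i)) => [z|].
  by rewrite horner_coef.
by apply: hol_sum => i _; apply: hol_mul; [exact: hol_cst|apply: hol_exp; exact: hol_id].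
Qed.

End Hol.

(** * Discrete Cauchy theorem and Cauchy estimates *)

(** Compactness in near-covering form, applied to the filter of small positive reals: thresholds
    valid near each point shrink to a common one. *)
Lemma compact_uniform (R : realType) (X : topologicalType) (K : set X)
    (P : R -> X -> Prop) :
  compact K ->
  (forall e e' x, 0 < e' <= e -> P e x -> P e' x) ->
  (forall x, K x -> exists2 e, 0 < e & nbhs x [set x' | K x' -> P e x']) ->
  exists2 e, 0 < e & forall x, K x -> P e x.
Proof.
move=> /compact_near_coveringP/near_covering_withinP cK mono loc.
have := cK R (0^'+) P _.
move=> /(_ _)[|e0 /= e0pos h].
  move=> x /loc[e e0 hx].
  exists ([set x' | K x' -> P e x'], [set y | 0 < y] `&` [set y | y < e]) => /=.
    by split => //; apply: filterI; [exact: nbhs_right_gt|exact: nbhs_right_lt].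
  move=> [x' e'] /= [h1] [e'0 e'e] Kx'.
  by apply: mono (h1 Kx'); rewrite e'0 ltW.
exists (e0 / 2); first by rewrite divr_gt0.
apply: h => /=; last by rewrite divr_gt0.
by rewrite sub0r normrN ger0_norm ?divr_ge0 ?ltW // gtr_pMr // invf_lt1 // ltr1n.
Qed.

Section DiscreteCauchy.
Variable R : realType.
Implicit Types (H : R[i] -> R[i]) (a b s : R).

Definition circle_mean H (N : nat) a : R[i] :=
  N%:R^-1 * \sum_(j < N) H (a +i* (2 * pi * j%:R / N%:R)).

(* Eliminating the derivative between a horizontal and a vertical increment. *)
Lemma hol_cross_increments H s0 s t :
  (forall a b, s0 <= a <= s -> 0 <= b <= t -> hol H (a +i* b)) ->
  exists2 e, 0 < e & forall a b, s0 <= a <= s -> 0 <= b <= t ->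
    forall h k, 0 < h < e -> 0 < k < e ->
    normc ('i%C * k%:C * (H ((a + h) +i* b) - H (a +i* b))
            - h%:C * (H (a +i* (b + k)) - H (a +i* b)))
      <= e^-1 * (h ^+ 2 * k + h * k ^+ 2).
Proof.
move=> hol_H.
(* One parameter serves twice: [e] limits the steps and [e^-1] is the constant. Decreasing [e]
   weakens both, which is the monotonicity that [compact_uniform] needs. *)
pose P (e : R) (x : R * R) := forall h k, 0 < h < e -> 0 < k < e ->
    normc ('i%C * k%:C * (H ((x.1 + h) +i* x.2) - H (x.1 +i* x.2))
            - h%:C * (H (x.1 +i* (x.2 + k)) - H (x.1 +i* x.2)))
      <= e^-1 * (h ^+ 2 * k + h * k ^+ 2).
suff [e e0 he] : exists2 e, 0 < e &
    forall x, (`[s0, s]%classic `*` `[0, t]%classic) x -> P e x.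
  by exists e => // a b ha hb; apply: (he (a, b)); split; rewrite /= in_itv.
apply: compact_uniform.
- by apply: compact_setX; exact: segment_compact.
- move=> e e' x /andP[e'0 e'e] h1 h k /andP[h0 he] /andP[k0 ke].
  apply: le_trans (h1 h k _ _) _; rewrite ?h0 ?k0 ?(lt_le_trans he) ?(lt_le_trans ke) //.
  apply: ler_wpM2r; last by rewrite lef_pV2 ?posrE //; exact: lt_le_trans e'e.
  by rewrite addr_ge0 // mulr_ge0 ?exprn_ge0 ?ltW.
move=> [a0 b0] [/=]; rewrite !in_itv /= => ha hb.
have [D [K [e [e0 hD]]]] := hol_H a0 b0 ha hb.
have K0 : 0 <= K.
  have z00 : normc (a0 +i* b0 - a0 +i* b0) < e by rewrite subrr normc0.
  by have [h _] := hD _ _ z00 z00; apply: le_trans h; exact: normc_ge0.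
(* The first bound keeps the three points in the disc of radius [e]; the second gives
   [K <= r^-1]. *)
pose r := Num.min (e / 4) (K + 1)^-1.
have K1 : 0 < K + 1 by lra.
have r0 : 0 < r by rewrite lt_min divr_gt0 //= invr_gt0.
exists r => //.
exists (ball a0 r, ball b0 r); first by split; apply: nbhsx_ballx.
move=> [a b] [/= ra rb] _ h k /= /andP[h0 hr] /andP[k0 kr].
move: ra rb; rewrite /ball /= => ra rb.
have re : r <= e / 4 by rewrite ge_min lexx.
have close (x y : R) : `|x| < e / 2 -> `|y| < e / 2 -> normc (x +i* y) < e.
  by move=> hx hy; have := ler_normc_ReIm (x +i* y); rewrite /=; lra.
rewrite ltr_norml in ra; rewrite ltr_norml in rb.
case/andP: ra => ra1 ra2; case/andP: rb => rb1 rb2.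
have z1 : normc (a +i* b - a0 +i* b0) < e.
  by simpc; apply: close; rewrite ltr_norml; lra.
have z2 : normc ((a + h) +i* b - a0 +i* b0) < e.
  by simpc; apply: close; rewrite ltr_norml; lra.
have z3 : normc (a +i* (b + k) - a0 +i* b0) < e.
  by simpc; apply: close; rewrite ltr_norml; lra.
have [_ d1] := hD _ _ z1 z2; have [_ d2] := hD _ _ z1 z3.
move: d1 d2.
have -> : (a + h) +i* b - a +i* b = h%:C by simpc; congr (_ +i* _); ring.
have -> : a +i* (b + k) - a +i* b = 'i%C * k%:C by simpc; congr (_ +i* _); ring.
set Hz := H (a +i* b); set H1 := H (_ +i* b); set H2 := H (a +i* _); set Dz := D _.
have ni : normc ('i%C : R[i]) = 1 by rewrite /= expr0n expr1n add0r sqrtr1.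
rewrite !normcM ni mul1r !normc_real !gtr0_norm // => d1 d2.
(* The two occurrences of the derivative cancel, so only quadratic remainders are left. *)
have -> : 'i%C * k%:C * (H1 - Hz) - h%:C * (H2 - Hz) =
  'i%C * k%:C * (H1 - Hz - Dz * h%:C) - h%:C * (H2 - Hz - Dz * ('i%C * k%:C)) by ring.
apply: le_trans (ler_normcB _ _) _.
rewrite !normcM ni mul1r !normc_real !gtr0_norm //.
have Kr : K <= r^-1.
  have : r <= (K + 1)^-1 by rewrite ge_min lexx orbT.
  move=> h1; have : K + 1 <= r^-1 by rewrite -[K + 1]invrK lef_pV2 ?posrE ?invr_gt0.
  lra.
have p0 : 0 <= h ^+ 2 * k + h * k ^+ 2.
  by rewrite addr_ge0 // mulr_ge0 ?exprn_ge0 ?ltW.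
apply: le_trans (_ : K * (h ^+ 2 * k + h * k ^+ 2) <= _); last by rewrite ler_wpM2r.
have := ler_wpM2l (ltW k0) d1; have := ler_wpM2l (ltW h0) d2.
by move: p0; lra.
Qed.

Theorem discrete_cauchy H s0 s :
  s0 < s ->
  (forall a b, s0 <= a <= s -> 0 <= b <= 2 * pi -> hol H (a +i* b)) ->
  (forall a, H (a +i* (2 * pi)) = H (a +i* 0)) ->
  forall eps, 0 < eps -> \forall N \near \oo,
    normc (circle_mean H N s - circle_mean H N s0) <= eps.
Proof.
move=> s0s hol_H per eps eps0.
have [e e0 he] := hol_cross_increments hol_H.
set t := s - s0; have t0 : 0 < t by rewrite /t; lra.
have pi0 := pi_gt0 R.
(* With [h = t / N] and [k = 2 * pi / N], the [N] translations cost [C / N] in total. *)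
pose C := e^-1 * (t ^+ 2 + t * (2 * pi)).
have C0 : 0 <= C by rewrite /C mulr_ge0 ?invr_ge0 ?addr_ge0 ?mulr_ge0 ?exprn_ge0 // ltW // mulr_gt0.
have ev (A : R) : \forall N \near \oo, A <= N%:R by exact: nbhs_infty_ger.
near=> N.
have N0 : 0 < (N%:R : R).
  by apply: lt_le_trans (_ : 1 <= _) => //; near: N; exact: ev.
have NtC : C / eps <= N%:R by near: N; exact: ev.
have Nt : (t + 1) / e <= N%:R by near: N; exact: ev.
have Np : (2 * pi + 1) / e <= N%:R by near: N; exact: ev.
pose h := t / N%:R; pose k : R := 2 * pi / N%:R.
have h0 : 0 < h < e.
  rewrite divr_gt0 //= ltr_pdivrMr //.
  by move: Nt; rewrite ler_pdivrMr //; lra.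
have k0 : 0 < k < e.
  rewrite divr_gt0 ?mulr_gt0 //= ltr_pdivrMr //.
  by move: Np; rewrite ler_pdivrMr //; lra.
have NK : N%:R * k = 2 * pi by rewrite /k mulrC divfK // gt_eqF.
have Nh : N%:R * h = t by rewrite /h mulrC divfK // gt_eqF.
have NC : (N%:R : R[i]) != 0 by rewrite pnatr_eq0 -(pnatr_eq0 R) gt_eqF.
pose b (j : nat) : R := 2 * pi * j%:R / N%:R.
have bS j : b j.+1 = b j + k by rewrite /b /k -natr1; field; rewrite gt_eqF.
have step a : s0 <= a <= s ->
    normc (circle_mean H N (a + h) - circle_mean H N a) <= e^-1 * (h ^+ 2 + h * k).
  move=> ha.
  have tele : \sum_(j < N) (H (a +i* (b j + k)) - H (a +i* b j)) = 0.
    rewrite (eq_bigr (fun j : 'I_N => H (a +i* b j.+1) - H (a +i* b j))); last first.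
      by move=> j _; rewrite bS.
    rewrite -(big_mkord xpredT (fun j => H (a +i* b j.+1) - H (a +i* b j))).
    rewrite telescope_sumr //.
    have -> : b N = 2 * pi by rewrite /b mulfK // gt_eqF.
    have -> : b 0%N = 0 by rewrite /b mulr0 mul0r.
    by rewrite per subrr.
  have k0' : 0 < k by case/andP: k0.
  rewrite -(ler_pM2l k0').
  (* The vertical increments may be inserted freely, since they telescope to 0 by periodicity; this
     brings the difference of means into the form bounded by [he]. *)
  have -> : k * normc (circle_mean H N (a + h) - circle_mean H N a) =
     normc (N%:R^-1 * \sum_(j < N) ('i%C * k%:C * (H ((a + h) +i* b j) - H (a +i* b j))
            - h%:C * (H (a +i* (b j + k)) - H (a +i* b j)))).
    rewrite sumrB -!mulr_sumr tele mulr0 subr0 sumrB /circle_mean -mulrBr.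
    have ni : normc ('i%C : R[i]) = 1 by rewrite /= expr0n expr1n add0r sqrtr1.
    by rewrite !normcM ni mul1r (normc_real k) gtr0_norm // mulrCA.
  rewrite normcM normcV normc_nat ler_pdivrMl //.
  apply: le_trans (ler_normc_sum _ _ _) _.
  apply: le_trans (_ : \sum_(j < N) e^-1 * (h ^+ 2 * k + h * k ^+ 2) <= _).
    apply: ler_sum => j _; apply: he => //.
    have j1 : (j%:R : R) <= N%:R by rewrite ler_nat ltnW.
    rewrite /b ?divr_ge0 ?mulr_ge0 ?ler0n ?(ltW pi0) ?(ltW N0) //=.
    by rewrite ler_pdivrMr // ler_pM2l // mulr_gt0.
  rewrite sumr_const card_ord -[X in X <= _]mulr_natl ler_pM2l //.
  by move: (h) (k) (e^-1) => x y w; nra.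
have tot (i : nat) : (i <= N)%N ->
   normc (circle_mean H N (s0 + i%:R * h) - circle_mean H N s0)
     <= i%:R * (e^-1 * (h ^+ 2 + h * k)).
  elim: i => [|i IH] iN; first by rewrite !mul0r addr0 subrr normc0.
  apply: le_trans (ler_normc_dist (circle_mean H N (s0 + i%:R * h)) _ _) _.
  rewrite -natr1 !mulrDl !mul1r addrA [leRHS]addrC.
  apply: lerD; last exact: IH (ltnW iN).
  apply: step; case/andP: h0 => h0 _.
  have : i%:R * h <= N%:R * h by rewrite ler_pM2r // ler_nat ltnW.
  have : 0 <= i%:R * h by rewrite mulr_ge0 ?ler0n // ltW.
  by rewrite Nh /t; lra.
have := tot N (leqnn N); rewrite Nh.
have -> : s0 + t = s by rewrite /t; ring.
move=> h1; apply: le_trans h1 _.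
rewrite -(ler_pM2l N0).
have -> : N%:R * (N%:R * (e^-1 * (h ^+ 2 + h * k))) = C.
  rewrite /C -Nh -NK; ring.
by rewrite ler_pdivrMr // in NtC.
Unshelve. all: by end_near. Qed.

End DiscreteCauchy.

Section CauchyEstimate.
Variable R : realType.
Implicit Types (f : R[i] -> R[i]) (u v z w : R[i]).

Definition root_of_unity (N : nat) : R[i] := cexp (0 +i* (2 * pi / N%:R)).

Lemma root_of_unityX N : (0 < N)%N -> root_of_unity N ^+ N = 1.
Proof.
move=> N0; rewrite /root_of_unity -cexp_natM.
have -> : N%:R * (0 +i* (2 * pi / N%:R)) = 0 +i* (pi *+ 2) :> R[i].
  rewrite -(rmorph_nat (real_complex R) N); simpc; congr (_ +i* _).
  by rewrite mulr2n; field; rewrite pnatr_eq0 -lt0n.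
by rewrite /cexp /= expR0 cos2pi sin2pi; simpc.
Qed.

Lemma root_of_unityX_neq1 N k : (0 < k < N)%N -> root_of_unity N ^+ k != 1.
Proof.
move=> /andP[k0 kN]; have N0 : (0 < N)%N by exact: leq_trans kN.
have N0' : 0 < (N%:R : R) by rewrite ltr0n.
have k0' : 0 < (k%:R : R) by rewrite ltr0n.
have pi0 := pi_gt0 R.
rewrite /root_of_unity -cexp_natM.
have -> : k%:R * (0 +i* (2 * pi / N%:R)) = 0 +i* ((pi * (k%:R / N%:R)) *+ 2) :> R[i].
  rewrite -(rmorph_nat (real_complex R) k); simpc; congr (_ +i* _).
  by rewrite mulr2n; field; rewrite gt_eqF.
rewrite /cexp /= expR0; simpc; apply/eqP => -[+ _].
rewrite cos_mulr2n; set x := pi * _.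
have : 0 < sin x.
  apply: sin_gt0_pi; rewrite /x mulr_gt0 ?divr_gt0 //=.
  by rewrite gtr_pMr // ltr_pdivrMr // mul1r ltr_nat.
by have := cos2Dsin2 x; rewrite mulr2n; nra.
Qed.

Lemma sum_unity_root_exp (x : R[i]) N : x ^+ N = 1 -> x != 1 -> \sum_(j < N) x ^+ j = 0.
Proof.
move=> xN x1; apply/eqP; move: (subrX1 x N); rewrite xN subrr => /esym/eqP.
by rewrite mulf_eq0 subr_eq0 (negbTE x1).
Qed.

Lemma cexp_node (a : R) (N j : nat) :
  cexp (a +i* (2 * pi * j%:R / N%:R)) = (expR a)%:C * root_of_unity N ^+ j.
Proof.
rewrite /root_of_unity -cexp_natM.
have -> : a +i* (2 * pi * j%:R / N%:R) = a%:C + j%:R * (0 +i* (2 * pi / N%:R)) :> R[i].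
  rewrite -(rmorph_nat (real_complex R) j); simpc; congr (_ +i* _); by ring.
rewrite cexpD; congr (_ * _).
by rewrite /cexp /= cos0 sin0; simpc.
Qed.

Lemma cexp_2pi (a : R) : cexp (a +i* (2 * pi)) = cexp (a +i* 0).
Proof.
rewrite /cexp /=.
have -> : 2 * pi = pi *+ 2 :> R by rewrite mulr2n; ring.
by rewrite cos2pi sin2pi cos0 sin0.
Qed.

(** The function [f (u + exp z) * exp (- z)] has means at most [M / r'] on the circle of radius
    [r'], and means close to [D] on a tiny circle: there [f] is affine up to a quadratic error, and
    the constant term averages to 0 against the inverse roots of unity. [discrete_cauchy] equates
    the two means up to [eps / 2]. *)
Lemma cauchy_estimate f u (D : R[i]) (r M K e : R) :
  0 < r -> 0 < e ->
  (forall z, normc (z - u) < r -> hol f z /\ normc (f z) <= M) ->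
  (forall w, normc (w - u) < e -> normc (f w - f u - D * (w - u)) <= K * normc (w - u) ^+ 2) ->
  normc D <= M / r.
Proof.
move=> r0 e0 hf hD.
have M0 : 0 <= M.
  have u0 : normc (u - u) < r by rewrite subrr normc0.
  exact: le_trans (normc_ge0 _) (hf u u0).2.
rewrite ler_pdivlMr // mulrC.
suff main r' : 0 < r' < r -> normc D <= M / r'.
  rewrite leNgt; apply/negP => h.
  have D0 : 0 < normc D.
    rewrite lt_neqAle normc_ge0 andbT; apply/eqP => D0.
    by move: h; rewrite -D0 mulr0; lra.
  have h2 : M / normc D < r by rewrite ltr_pdivrMr.
  have h3 : 0 <= M / normc D by rewrite divr_ge0 // ltW.
  (* If the bound failed at [r], then [M / normc D < r], and any radius strictly between these two
     contradicts [main]. *)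
  have := main ((M / normc D + r) / 2) _.
  rewrite ler_pdivlMr; last by lra.
  move=> /(_ ltac:(lra)).
  have : normc D * (M / normc D) = M by rewrite mulrC divfK // gt_eqF.
  have := mulr_gt0 D0 r0.
  nra.
move=> /andP[r'0 r'r]; apply/ler_addgt0Pr => eps eps0.
have K0 : 0 <= `|K| by [].
pose d := Num.min (r' / 2) (Num.min (e / 2) (eps / 2 / (`|K| + 1))).
have d0 : 0 < d.
  by rewrite !lt_min !divr_gt0 //; lra.
have dr : d < r' by rewrite /d gt_min; apply/orP; left; lra.
have de : d < e by rewrite /d !gt_min; apply/orP; right; apply/orP; left; lra.
have dK : `|K| * d <= eps / 2.
  have : d <= eps / 2 / (`|K| + 1) by rewrite /d !ge_min lexx !orbT.
  rewrite ler_pdivlMr; last by lra.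
  by rewrite mulrDr mulr1 mulrC; lra.
pose H z := f (u + cexp z) * cexp (- z).
have hH a b : ln d <= a <= ln r' -> 0 <= b <= 2 * pi -> hol H (a +i* b).
  move=> /andP[a1 a2] _; apply: hol_mul.
    apply: hol_comp; first by apply: hol_add; [exact: hol_cst|exact: hol_cexp].
    have [|//] := hf (u + cexp (a +i* b)) _.
    rewrite [X in normc X]addrC addKr normc_cexp /=; apply: le_lt_trans r'r.
    by rewrite -[leRHS]lnK ?posrE // ler_expR.
  by apply: (@hol_comp _ (@cexp R)); [apply: hol_opp; exact: hol_id|exact: hol_cexp].
have per a : H (a +i* (2 * pi)) = H (a +i* 0).
  by rewrite /H !cexpN cexp_2pi.
have ldr : ln d < ln r' by rewrite ltr_ln ?posrE.
have eps2 : 0 < eps / 2 by lra.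
have evDC := discrete_cauchy ldr hH per eps2.
near \oo => N.
have N2 : (1 < N)%N by near: N; exact: nbhs_infty_gt.
have hDC : normc (circle_mean H N (ln r') - circle_mean H N (ln d)) <= eps / 2.
  by near: N; exact: evDC.
have N0 : 0 < (N%:R : R) by rewrite ltr0n ltnW.
have NC : (N%:R : R[i]) != 0 by rewrite pnatr_eq0 -lt0n ltnW.
pose x := root_of_unity N.
have xN : x ^+ N = 1 by apply: root_of_unityX; exact: ltnW.
have x1 : x != 1 by have := @root_of_unityX_neq1 N 1 N2; rewrite expr1.
have nx : normc x = 1.
  apply/eqP; rewrite -(@pexpr_eq1 _ _ N) ?normc_ge0 ?(ltnW N2) //.
  by rewrite -normcX xN normc1.
have mean1 : normc (circle_mean H N (ln r')) <= M / r'.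
  rewrite /circle_mean normcM normcV normc_nat ler_pdivrMl //.
  apply: le_trans (ler_normc_sum _ _ _) _.
  apply: le_trans (_ : \sum_(j < N) M / r' <= _); last by rewrite sumr_const card_ord mulr_natl.
  apply: ler_sum => j _; rewrite /H cexpN cexp_node lnK ?posrE // normcM normcV normcM normc_real normcX nx expr1n mulr1 gtr0_norm //.
  rewrite ler_wpM2r ?invr_ge0 ?(ltW r'0) //.
  have [|//] := hf (u + r'%:C * x ^+ j) _.
  by rewrite [X in normc X]addrC addKr normcM normcX nx expr1n mulr1 normc_real gtr0_norm.
have mean2 : normc (circle_mean H N (ln d) - D) <= eps / 2.
  have -> : circle_mean H N (ln d) - D = N%:R^-1 * \sum_(j < N)
      ((f (u + d%:C * x ^+ j) - f u - D * (d%:C * x ^+ j)) / (d%:C * x ^+ j)).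
    have -> : \sum_(j < N) ((f (u + d%:C * x ^+ j) - f u - D * (d%:C * x ^+ j)) / (d%:C * x ^+ j))
      = \sum_(j < N) (f (u + d%:C * x ^+ j) / (d%:C * x ^+ j)) - f u / d%:C * \sum_(j < N) x^-1 ^+ j
        - \sum_(j < N) D.
      rewrite mulr_sumr -!sumrB; apply: eq_bigr => j _.
      have xj : x ^+ j != 0 by rewrite expf_neq0 // -normc_gt0 nx.
      have dC : d%:C != 0 :> R[i] by rewrite -normc_gt0 normc_real normr_gt0 gt_eqF.
      by rewrite exprVn; field; rewrite xj dC.
    rewrite sum_unity_root_exp ?mulr0 ?subr0; last 2 first.
    - by rewrite exprVn xN invr1.
    - by rewrite invr_eq1.
    rewrite sumr_const card_ord mulrBr -(mulr_natl D) mulKf //.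
    rewrite /circle_mean; congr (_ * _ - _); apply: eq_bigr => j _.
    by rewrite /H cexpN cexp_node lnK ?posrE.
  rewrite normcM normcV normc_nat ler_pdivrMl //.
  apply: le_trans (ler_normc_sum _ _ _) _.
  apply: le_trans (_ : \sum_(j < N) eps / 2 <= _); last by rewrite sumr_const card_ord mulr_natl.
  apply: ler_sum => j _.
  have nd : normc (d%:C * x ^+ j) = d.
    by rewrite normcM normcX nx expr1n mulr1 normc_real gtr0_norm.
  rewrite normcf_div nd ler_pdivrMr //.
  have := hD (u + d%:C * x ^+ j); rewrite [X in normc X < _]addrC addKr nd => /(_ de).
  rewrite [X in D * X]addrC [X in K * normc X ^+ 2]addrC !addKr nd.
  move=> h; apply: le_trans h _; rewrite expr2 mulrA ler_wpM2r ?(ltW d0) //.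
  apply: le_trans dK; rewrite ler_wpM2r ?(ltW d0) //; exact: ler_norm.
have -> : D = circle_mean H N (ln r') - (circle_mean H N (ln r') - circle_mean H N (ln d))
   - (circle_mean H N (ln d) - D) by ring.
apply: le_trans (ler_normcB _ _) _.
apply: le_trans (lerD (ler_normcB _ _) (lexx _)) _; lra.
Unshelve. all: by end_near. Qed.

(** A mean value inequality without integrals. The Cauchy estimate bounds the derivative by [M / r]
    at every point of the segment, compactness makes the quadratic remainder uniform, and over [N]
    equal pieces the remainders add up to [O(1 / N)]. *)
Lemma hol_lipschitz_segment f u v (r M : R) :
  0 < r ->
  (forall t : R, 0 <= t <= 1 -> forall z, normc (z - (u + t%:C * (v - u))) < r ->
     hol f z /\ normc (f z) <= M) ->
  normc (f v - f u) <= M / r * normc (v - u).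
Proof.
move=> r0 hf; pose p t := u + t%:C * (v - u).
set L := M / r.
have ppE (t t' : R) : p t' - p t = (t' - t)%:C * (v - u).
  by rewrite /p rmorphB; ring.
pose P (e t : R) := forall t', `|t' - t| < e ->
   normc (f (p t') - f (p t)) <= L * normc (v - u) * `|t' - t| + e^-1 * `|t' - t| ^+ 2.
have [e e0 he] : exists2 e, 0 < e & forall t, `[0:R, 1]%classic t -> P e t.
  apply: compact_uniform.
  - exact: segment_compact.
  - move=> e e' t /andP[e'0 e'e] h t' ht'; apply: le_trans (h t' _) _.
      exact: lt_le_trans e'e.
    rewrite lerD2l ler_wpM2r ?sqr_ge0 // lef_pV2 ?posrE //; exact: lt_le_trans e'e.
  move=> t0; rewrite /= in_itv /= => ht0.
  have [D [K [e [e0 hD]]]] : hol f (p t0).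
    by have [] // := hf t0 ht0 (p t0); rewrite subrr normc0.
  have K0 : 0 <= K.
    have z00 : normc (p t0 - p t0) < e by rewrite subrr normc0.
    by have [h _] := hD _ _ z00 z00; apply: le_trans h; exact: normc_ge0.
  set n := normc (v - u); have n0 : 0 <= n by exact: normc_ge0.
  pose C := K * n ^+ 2 + 1.
  have C0 : 0 < C by rewrite ltr_wpDl // mulr_ge0 // sqr_ge0.
  pose d := Num.min (e / 2 / (n + 1)) C^-1.
  have n1 : 0 < n + 1 by lra.
  have d0 : 0 < d by rewrite lt_min divr_gt0 ?invr_gt0 //; lra.
  exists d => //.
  near=> t; rewrite /= in_itv /= => ht t' ht'.
  have dn : d * n <= e / 2.
    have : d <= e / 2 / (n + 1) by rewrite ge_min lexx.
    by rewrite ler_pdivlMr //; nra.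
  have tt0 : `|t - t0| < d.
    by rewrite distrC; near: t; exact: nbhsx_ballx.
  have nlt : normc (p t - p t0) < e.
    rewrite ppE normcM normc_real -/n.
    by have := ler_wpM2r n0 (ltW tt0); lra.
  have nlt' : normc (p t' - p t) <= e / 2.
    rewrite ppE normcM normc_real -/n.
    by have := ler_wpM2r n0 (ltW ht'); lra.
  have nlt2 : normc (p t - p t0) <= e / 2.
    rewrite ppE normcM normc_real -/n.
    by have := ler_wpM2r n0 (ltW tt0); lra.
  have D1 : normc (D (p t)) <= L.
    apply: (@cauchy_estimate f (p t) (D (p t)) r M K (e / 2)) => //; first by lra.
      by move=> z hz; apply: (hf t).
    move=> w hw; apply: (hD _ _ _ _).2 => //.
    by have := ler_normc_dist (p t) w (p t0); lra.
  have nlt3 : normc (p t' - p t0) < e \/ normc (p t' - p t0) = e.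
    have := ler_normc_dist (p t) (p t') (p t0); rewrite le_eqVlt => h.
    have : normc (p t' - p t0) <= e by lra.
    by rewrite le_eqVlt => /orP[/eqP|]; [right|left].
  have nlt4 : normc (p t' - p t0) < e.
    have : normc (p t' - p t) + normc (p t - p t0) < e \/ n = 0.
      have [->|nn] := eqVneq n 0; first by right.
      left; rewrite !ppE !normcM !normc_real -/n.
      have np : 0 < n by rewrite lt_neqAle eq_sym nn.
      have := ltr_pM2r np `|t - t0| d; have := ltr_pM2r np `|t' - t| d.
      by rewrite tt0 ht'; lra.
    case=> [h|h0]; first by apply: le_lt_trans h; exact: ler_normc_dist.
    by rewrite ppE normcM -/n h0 mulr0.
  have [_ h] := hD _ _ nlt nlt4.
  rewrite -[f (p t') - f (p t)](subrK (D (p t) * (p t' - p t))).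
  apply: le_trans (ler_normcD _ _) _; rewrite addrC; apply: lerD.
    by rewrite ppE !normcM normc_real -/n [leRHS]mulrAC -[leRHS]mulrA ler_wpM2r // mulr_ge0.
  apply: le_trans h _; rewrite ppE normcM normc_real -/n exprMn mulrCA mulrC.
  rewrite ler_wpM2r ?sqr_ge0 //.
  have : d <= C^-1 by rewrite ge_min lexx orbT.
  move=> h1; have : C <= d^-1 by rewrite -[C]invrK lef_pV2 ?posrE ?invr_gt0.
  by rewrite /C; lra.
have p0 : p 0 = u by rewrite /p mul0r addr0.
have p1 : p 1 = v by rewrite /p mul1r addrC subrK.
rewrite -p1 -{1}p0 {1}p1.
apply/ler_addgt0Pr => eps eps0.
near \oo => N.
have N1 : (0 < N)%N by near: N; exact: nbhs_infty_gt.
have N0 : 0 < (N%:R : R) by rewrite ltr0n.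
have Ne : 2 / e <= N%:R by near: N; exact: nbhs_infty_ger.
have Neps : e^-1 / eps <= N%:R by near: N; exact: nbhs_infty_ger.
pose h : R := N%:R^-1.
have h0 : 0 < h by rewrite invr_gt0.
have he' : h < e.
  rewrite /h -[e]invrK ltf_pV2 ?posrE ?invr_gt0 //.
  apply: lt_le_trans Ne; rewrite mulrC ltr_pMr ?invr_gt0 //; lra.
have tot (i : nat) : (i <= N)%N ->
   normc (f (p (i%:R * h)) - f (p 0)) <= i%:R * (L * normc (v - u) * h + e^-1 * h ^+ 2).
  elim: i => [|i IH] iN; first by rewrite !mul0r subrr normc0.
  apply: le_trans (ler_normc_dist (f (p (i%:R * h))) _ _) _.
  rewrite -natr1 !(mulrDl (i%:R) 1) !mul1r [leRHS]addrC.
  apply: lerD; last exact: IH (ltnW iN).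
  have := he (i%:R * h) _ (i%:R * h + h).
  rewrite addrC addKr gtr0_norm // addrC; apply => //=.
  rewrite in_itv /= mulr_ge0 ?ler0n ?(ltW h0) //=.
  by rewrite ler_pdivrMr // mul1r ler_nat ltnW.
have := tot N (leqnn N).
have Nh : N%:R * h = 1 by rewrite /h mulfV // gt_eqF.
rewrite Nh p0 p1 => h1; apply: le_trans h1 _.
have -> : N%:R * (L * normc (v - u) * h + e^-1 * h ^+ 2) =
    (N%:R * h) * (L * normc (v - u)) + (N%:R * h) * (e^-1 * h) by ring.
rewrite Nh !mul1r lerD2l.
by rewrite ler_pdivrMr //; rewrite ler_pdivrMr // mulrC in Neps.
Unshelve. all: by end_near. Qed.

End CauchyEstimate.

(** * Bernstein's inequality *)

Section PolynomialsOnEllipses.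
Variable R : realType.
Implicit Types (w u z : R[i]) (p q : {poly R[i]}).

(** A constant independent of [n] disappears on taking [n]-th roots; Bernoulli's inequality for
    [x / M] says this without roots. *)
Lemma ler_of_geometric (x M C : R) : 0 <= x -> 0 <= M ->
  (forall n, x ^+ n <= C * M ^+ n) -> x <= M.
Proof.
move=> x0 M0 h; rewrite leNgt; apply/negP => Mx.
have [M00|] := eqVneq M 0.
  by have := h 1%N; rewrite !expr1 M00 mulr0; lra.
move=> Mn; have {Mn} Mp : 0 < M by rewrite lt_neqAle eq_sym Mn.
pose d := x / M - 1.
have d0 : 0 < d by rewrite subr_gt0 ltr_pdivlMr // mul1r.
have bern n : 1 + n%:R * d <= (1 + d) ^+ n.
  elim: n => [|n IH]; first by rewrite mul0r addr0 expr0.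
  have d1 : 0 <= 1 + d by lra.
  rewrite exprS; apply: le_trans (ler_wpM2l d1 IH).
  rewrite -natr1; have : 0 <= n%:R * d * d by rewrite !mulr_ge0 ?ler0n // ltW.
  lra.
have hC n : (1 + d) ^+ n <= C.
  rewrite /d [1 + _]addrC subrK expr_div_n ler_pdivrMr ?exprn_gt0 //.
near \oo => n.
have : C / d < n%:R by near: n; exact: nbhs_infty_gtr.
rewrite ltr_pdivrMr // => h1.
by have := bern n; have := hC n; lra.
Unshelve. all: by end_near. Qed.

Lemma root_of_unity_primitive N : (0 < N)%N -> N.-primitive_root (root_of_unity R N).
Proof.
move=> N0; rewrite /primitive_root_of_unity N0 /=; apply/forallP => i.
rewrite unity_rootE; apply/eqP.
have := ltn_ord i; rewrite leq_eqVlt => /orP[/eqP iN|iN].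
  by rewrite iN root_of_unityX // !eqxx.
by rewrite (ltn_eqF iN); apply/negbTE; apply: root_of_unityX_neq1.
Qed.

Lemma normc_unity_root (x : R[i]) N : (0 < N)%N -> x ^+ N = 1 -> normc x = 1.
Proof.
move=> N0 xN; apply/eqP.
by rewrite -(@pexpr_eq1 _ _ N) ?normc_ge0 // -normcX xN normc1.
Qed.

(** A discrete Cauchy formula: the finite geometric sum stands for the kernel [1 / (1 - a / w)]. It
    is exact because the degree of [q] is below [N], so orthogonality of the characters of [Z/N]
    isolates each coefficient without aliasing. *)
Lemma horner_unity_mean q (a : R[i]) N : (size q <= N)%N -> (0 < N)%N ->
  let x := root_of_unity R N in
  q.[a] = N%:R^-1 * \sum_(j < N) (q.[x ^+ j] * \sum_(k < N) (a / x ^+ j) ^+ k).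
Proof.
move=> qN N0 x.
have NC : (N%:R : R[i]) != 0 by rewrite pnatr_eq0 -lt0n.
have px := root_of_unity_primitive N0; rewrite -/x in px.
have xN : x ^+ N = 1 by exact: root_of_unityX.
have x0 : x != 0 by rewrite -normc_gt0 (normc_unity_root N0 xN).
apply: (mulfI NC); rewrite mulVKf //.
under eq_bigr => j _.
  rewrite (horner_coef_wide _ qN) mulr_suml.
  under eq_bigr => i _ do rewrite mulr_sumr.
  over.
rewrite exchange_big /=.
under eq_bigr do rewrite exchange_big /=.
rewrite (horner_coef_wide _ qN) mulr_sumr; apply: eq_bigr => i _.
rewrite (bigD1 i) //= [X in _ + X]big1 ?addr0 => [|k ki].
  rewrite (eq_bigr (fun=> q`_i * a ^+ i)) ?sumr_const ?card_ord ?mulr_natl // => j _.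
  by rewrite expr_div_n -!exprM mulnC; field; rewrite expf_neq0.
have -> : \sum_(j < N) (q`_i * (x ^+ j) ^+ i * (a / x ^+ j) ^+ k) =
    q`_i * a ^+ k * \sum_(j < N) (x ^+ i / x ^+ k) ^+ j.
  rewrite mulr_sumr; apply: eq_bigr => j _.
  rewrite !expr_div_n -!exprM [(i * j)%N]mulnC [(k * j)%N]mulnC.
  by field; rewrite expf_neq0.
rewrite sum_unity_root_exp ?mulr0 //.
  by rewrite expr_div_n -!exprM mulnC [(k * N)%N]mulnC !exprM xN !expr1n divr1.
rewrite -(inj_eq (mulIf (expf_neq0 k x0))) divfK ?expf_neq0 // mul1r.
rewrite (eq_prim_root_expr px) !modn_small //.
by apply: contraNneq ki => ik; apply/eqP/val_inj.
Qed.

(* The mean formula costs a factor 1 / (1 - |a|), removed by applying it to the powers of q. *)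
Lemma poly_max_disc q (a : R[i]) (M : R) :
  (forall w, normc w = 1 -> normc q.[w] <= M) -> normc a < 1 -> normc q.[a] <= M.
Proof.
move=> hq a1; have M0 : 0 <= M by apply: le_trans (hq 1 (@normc1 R)); exact: normc_ge0.
apply: (@ler_of_geometric _ _ (1 - normc a)^-1); rewrite ?normc_ge0 // => n.
have qn w : normc w = 1 -> normc (q ^+ n).[w] <= M ^+ n.
  by move=> /hq h; rewrite horner_exp normcX lerXn2r ?nnegrE ?normc_ge0.
rewrite -normcX -horner_exp; set N := (size (q ^+ n)).+1.
have N0 : 0 < (N%:R : R) by rewrite ltr0n.
have xN : root_of_unity R N ^+ N = 1 by exact: root_of_unityX.
have x1 := normc_unity_root (ltn0Sn _ : (0 < N)%N) xN.
rewrite (@horner_unity_mean _ a N) ?leqnSn //.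
rewrite normcM normcV normc_nat ler_pdivrMl //.
apply: le_trans (ler_normc_sum _ _ _) _.
have -> : N%:R * ((1 - normc a)^-1 * M ^+ n) = \sum_(j < N) (M ^+ n * (1 - normc a)^-1).
  by rewrite sumr_const card_ord -[RHS]mulr_natl [M ^+ n * _]mulrC.
apply: ler_sum => j _; rewrite normcM; apply: ler_pM; rewrite ?normc_ge0 //.
  by apply: qn; rewrite normcX x1 expr1n.
apply: le_trans (ler_normc_sum _ _ _) _.
rewrite -[leRHS]mul1r ler_pdivlMr; last by lra.
rewrite (eq_bigr (fun k : 'I_N => normc a ^+ k)); last first.
  by move=> k _; rewrite normcX normcf_div normcX x1 expr1n divr1.
have -> : (\sum_(i < N) normc a ^+ i) * (1 - normc a) = 1 - normc a ^+ N.
  by apply: oppr_inj; rewrite -mulrN !opprB mulrC -subrX1.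
by rewrite lerBlDr lerDl exprn_ge0 ?normc_ge0.
Qed.

(** The focal distances are [|w - 1|^2 / (2|w|)] and [|w + 1|^2 / (2|w|)], and the parallelogram law
    adds them. Hence circles of radius [r > 1] map to the boundary of the ellipse of parameter
    [r]. *)
Lemma joukowski_foci w : w != 0 ->
  normc ((w + w^-1) / 2 - 1) + normc ((w + w^-1) / 2 + 1) = normc w + (normc w)^-1.
Proof.
move=> w0.
have -> : (w + w^-1) / 2 - 1 = (w - 1) ^+ 2 / (2 * w) by field.
have -> : (w + w^-1) / 2 + 1 = (w + 1) ^+ 2 / (2 * w) by field.
have n0 : 0 < normc w by rewrite normc_gt0.
rewrite !normcf_div !normcX normcM normc_nat -mulrDl.
have -> : normc (w - 1) ^+ 2 + normc (w + 1) ^+ 2 = 2 * (normc w ^+ 2 + 1).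
  case: w {w0 n0} => a b.
  rewrite /= !sqr_sqrtr ?addr_ge0 ?sqr_ge0 // oppr0 !addr0; ring.
by field; rewrite gt_eqF.
Qed.

(** The two preimages [u + s] and [u - s], with [s] a square root of [u ^+ 2 - 1], have product 1.
    The one in the closed unit disc is kept because the maximum principle is applied there. *)
Lemma joukowski_surj u : exists w, [/\ w != 0, normc w <= 1 & u = (w + w^-1) / 2].
Proof.
pose s := sqrtC (u ^+ 2 - 1).
have sE : s ^+ 2 = u ^+ 2 - 1 by exact: sqrtCK.
have prod1 : (u + s) * (u - s) = 1 by rewrite mulrC -subr_sqr sE; ring.
have p0 : u + s != 0.
  by apply/eqP => h; move: prod1; rewrite h mul0r => /esym/eqP; rewrite oner_eq0.
have m0 : u - s != 0.
  by apply/eqP => h; move: prod1; rewrite h mulr0 => /esym/eqP; rewrite oner_eq0.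
have iE : (u + s)^-1 = u - s by apply: (mulfI p0); rewrite mulfV.
have jE : (u - s)^-1 = u + s by apply: (mulfI m0); rewrite mulfV // mulrC.
have [h|h] := leP (normc (u + s)) 1.
  by exists (u + s); split => //; rewrite iE; field.
exists (u - s); split => //; last by rewrite jE; field.
have := congr1 (@normc R) prod1; rewrite normcM normc1 => h1.
by have := normc_ge0 (u - s); nra.
Qed.

Lemma ler_joukowski (s t : R) : 1 <= s -> 1 <= t -> s + s^-1 < t + t^-1 -> s < t.
Proof.
move=> s1 t1; rewrite -subr_gt0 => h; rewrite ltNge; apply/negP => ts.
have s0 : 0 < s by lra. have t0 : 0 < t by lra.
have : t + t^-1 - (s + s^-1) = (t - s) * (1 - (s * t)^-1) by field; rewrite !gt_eqF.
have st1 : (s * t)^-1 <= 1.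
  by rewrite invf_le1 ?mulr_gt0 //; nra.
by nra.
Qed.

(** On the unit circle [(w + w^-1) / 2] is the real part of [w], so [w ^+ m * p ((w + w^-1) / 2)], a
    polynomial in [w], is bounded by [M] there and hence in the disc. Dividing by [w ^+ m] costs at
    most [rho ^+ m]. *)
Theorem bernstein_inequality p (m : nat) (rho M : R) u :
  1 < rho -> (size p <= m.+1)%N ->
  (forall x : R, -1 <= x <= 1 -> normc p.[x%:C] <= M) ->
  bernstein rho u -> normc p.[u] <= rho ^+ m * M.
Proof.
move=> rho1 szp hp hu.
have M0 : 0 <= M by apply: le_trans (hp 0 _); rewrite ?normc_ge0 //; lra.
(* The summand is [w ^+ m * ((w + w^-1) / 2) ^+ k] with denominators cleared, which is possible
   because [k <= m]. *)
pose q : {poly R[i]} := \sum_(k < m.+1) (p`_k * 2^-1 ^+ k) *: ('X^(m - k) * ('X^2 + 1) ^+ k).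
have qE w : w != 0 -> q.[w] = w ^+ m * p.[(w + w^-1) / 2].
  move=> w0; rewrite (horner_coef_wide _ szp) /q horner_sum mulr_sumr.
  apply: eq_bigr => k _; rewrite !hornerE.
  have km : (k <= m)%N by rewrite -ltnS.
  rewrite -[in w ^+ m](subnK km) exprD.
  have -> : w ^+ 2 + 1 = w * (w + w^-1) by field.
  by rewrite !exprMn /=; ring.
have circ w : normc w = 1 -> normc p.[(w + w^-1) / 2] <= M.
  case: w => a b w1.
  have ab : a ^+ 2 + b ^+ 2 = 1.
    have : normc (a +i* b) ^+ 2 = 1 by rewrite w1 expr1n.
    by rewrite /= sqr_sqrtr // addr_ge0 ?sqr_ge0.
  have w0 : a +i* b != 0 by rewrite -normc_gt0 w1.
  have -> : (a +i* b)^-1 = a -i* b.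
    apply: (mulfI w0); rewrite mulfV //; simpc.
    by congr (_ +i* _); [rewrite -ab; ring|ring].
  have -> : ((a +i* b) + (a -i* b)) / 2 = a%:C.
    apply: (mulIf (x := 2)); first by rewrite pnatr_eq0.
    rewrite divfK ?pnatr_eq0 // mulr_natr mulr2n; simpc.
    by congr (_ +i* _); ring.
  by apply: hp; have := sqr_ge0 b; nra.
have qcirc w : normc w = 1 -> normc q.[w] <= M.
  move=> w1; have w0 : w != 0 by rewrite -normc_gt0 w1.
  by rewrite qE // normcM normcX w1 expr1n mul1r; exact: circ.
have [w [w0 w1 uE]] := joukowski_surj u.
have wp : 0 < normc w by rewrite normc_gt0.
have iw : 1 <= (normc w)^-1 by rewrite invf_ge1.
have wrho : (normc w)^-1 < rho.
  apply: ler_joukowski => //; first exact: ltW.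
  by rewrite invrK addrC -joukowski_foci // -uE.
have qw : normc q.[w] <= M.
  move: w1; rewrite le_eqVlt => /orP[/eqP|] w1; first exact: qcirc.
  exact: poly_max_disc.
have -> : p.[u] = q.[w] / w ^+ m by rewrite qE // -uE mulrC mulKf // expf_neq0.
rewrite normcf_div normcX mulrC -exprVn; apply: ler_pM; rewrite ?exprn_ge0 ?invr_ge0 ?normc_ge0 //.
by rewrite lerXn2r ?nnegrE ?invr_ge0 ?normc_ge0 //; lra.
Qed.

End PolynomialsOnEllipses.

(** * Truncated Chebyshev series *)

Section ChebyshevTruncation.
Variable R : realType.
Implicit Types (f g : R[i] -> R[i]) (u v w z : R[i]).

(** Weaker than [hol] in that one of the two points is fixed: this is the regularity that a divided
    difference visibly keeps at its removed singularity. *)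
Definition lip_at f z0 := exists L e : R, 0 < e /\
  forall z, normc (z - z0) < e -> normc (f z - f z0) <= L * normc (z - z0).

Lemma lip_at_ge0 f z0 : lip_at f z0 -> exists L e : R, [/\ 0 < e, 0 <= L &
  forall z, normc (z - z0) < e -> normc (f z - f z0) <= L * normc (z - z0)].
Proof.
move=> [L [e [e0 h]]]; exists `|L|, e; split => // z hz.
by apply: le_trans (h z hz) _; rewrite ler_wpM2r ?normc_ge0 // ler_norm.
Qed.

Lemma hol_lip_at f z0 : hol f z0 -> lip_at f z0.
Proof.
move=> /hol_bounds[D [K [e [e0 K0 h]]]]; exists K, e; split => // z hz.
have z00 : normc (z0 - z0) < e by rewrite subrr normc0.
by have [] := h z0 z z00 hz.
Qed.

Lemma lip_at_mul f g z0 : lip_at f z0 -> lip_at g z0 -> lip_at (fun z => f z * g z) z0.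
Proof.
move=> /lip_at_ge0[L [e [e0 L0 h]]] /lip_at_ge0[L' [e' [e'0 L'0 h']]].
exists (L * (normc (g z0) + L' * e') + normc (f z0) * L'), (Num.min e e').
split=> [|z]; first by rewrite lt_min e0.
rewrite lt_min => /andP[z1 z2].
rewrite [X in normc X <= _](_ : _ = (f z - f z0) * g z + f z0 * (g z - g z0)); last by ring.
apply: le_trans (ler_normcD _ _) _; rewrite !normcM mulrDl; apply: lerD.
  rewrite mulrAC; apply: ler_pM; rewrite ?normc_ge0 ?h //.
  rewrite -[g z](subrK (g z0)) addrC; apply: le_trans (ler_normcD _ _) _.
  rewrite lerD2l; apply: le_trans (h' z z2) _; rewrite ler_wpM2l // ltW //.
by rewrite -mulrA; apply: ler_wpM2l; rewrite ?normc_ge0 ?h'.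
Qed.

Lemma lip_at_comp f g z0 : lip_at g z0 -> lip_at f (g z0) -> lip_at (fun z => f (g z)) z0.
Proof.
move=> /lip_at_ge0[L' [e' [e'0 L'0 h']]] /lip_at_ge0[L [e [e0 L0 h]]].
have L1 : 0 < L' + 1 by lra.
exists (L * L'), (Num.min e' (e / (L' + 1))); split => [|z].
  by rewrite lt_min e'0 divr_gt0.
rewrite lt_min ltr_pdivlMr // => /andP[z1 z2].
have hg := h' z z1.
rewrite -mulrA; apply: le_trans (ler_wpM2l L0 hg); apply: h.
by have := normc_ge0 (z - z0); nra.
Qed.

Lemma hol_near f g z0 (e : R) : 0 < e ->
  (forall z, normc (z - z0) < e -> f z = g z) -> hol f z0 -> hol g z0.
Proof.
move=> e0 fg [D [K [e' [e'0 h]]]]; exists D, K, (Num.min e e').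
split=> [|z w]; first by rewrite lt_min e0.
rewrite !lt_min => /andP[z1 z2] /andP[w1 w2].
by rewrite -!fg //; exact: h.
Qed.

Definition joukowski w : R[i] := (w + w^-1) / 2.

Lemma normc_foci_real (x : R) : -1 <= x <= 1 ->
  normc (x%:C - 1 : R[i]) + normc (x%:C + 1 : R[i]) = 2.
Proof.
move=> /andP[x1 x2].
have -> : x%:C - 1 = (x - 1)%:C :> R[i] by rewrite rmorphB rmorph1.
have -> : x%:C + 1 = (x + 1)%:C :> R[i] by rewrite rmorphD rmorph1.
rewrite !normc_real ler0_norm ?ger0_norm; lra.
Qed.

Lemma gt2_joukowski (s : R) : 1 < s -> 2 < s + s^-1.
Proof.
move=> s1; have s0 : 0 < s by lra.
rewrite -subr_gt0; have -> : s + s^-1 - 2 = (s - 1) ^+ 2 / s by field; rewrite gt_eqF.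
by rewrite divr_gt0 // exprn_gt0; lra.
Qed.

Lemma ltr_joukowski (s t : R) : 1 <= s -> s < t -> s + s^-1 < t + t^-1.
Proof.
move=> s1 st; have s0 : 0 < s by lra. have t0 : 0 < t by lra.
rewrite -subr_gt0.
have -> : t + t^-1 - (s + s^-1) = (t - s) * (1 - (s * t)^-1) by field; rewrite !gt_eqF.
have st1 : (s * t)^-1 < 1 by rewrite invf_lt1 ?mulr_gt0 //; nra.
by rewrite mulr_gt0; lra.
Qed.

Lemma real_bernstein (rho x : R) : 1 < rho -> -1 <= x <= 1 -> bernstein rho x%:C.
Proof.
by move=> rho1 hx; rewrite /bernstein /= normc_foci_real //; exact: gt2_joukowski.
Qed.

Lemma joukowski_bernstein (rho : R) w : 1 < rho -> 1 <= normc w < rho ->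
  bernstein rho (joukowski w).
Proof.
move=> rho1 /andP[w1 w2].
have w0 : w != 0 by rewrite -normc_gt0; lra.
by rewrite /bernstein /= joukowski_foci //; exact: ltr_joukowski.
Qed.

Lemma joukowski_neq_real w (x : R) : 1 < normc w -> -1 <= x <= 1 -> joukowski w != x%:C.
Proof.
move=> w1 hx; apply/eqP => h.
have w0 : w != 0 by rewrite -normc_gt0; lra.
have := joukowski_foci w0; rewrite -/(joukowski w) h normc_foci_real // => h2.
by have := gt2_joukowski w1; lra.
Qed.

(** The doubled normalization makes the value at [joukowski v] equal to [v ^+ n + v^-1 ^+ n] for
    every [n], including [n = 0]. *)
Fixpoint cheb_pair (n : nat) : {poly R[i]} * {poly R[i]} :=
  if n is n'.+1 then
    let: (a, b) := cheb_pair n' in (b, 2 *: ('X * b) - a)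
  else (2%:P, 2 *: 'X).

(* Twice the Chebyshev polynomial of degree n. *)
Definition cheb n := (cheb_pair n).1.

Lemma chebSS n : cheb n.+2 = 2 *: ('X * cheb n.+1) - cheb n.
Proof. by rewrite /cheb /=; case: (cheb_pair n). Qed.

Lemma size_cheb n : (size (cheb n) <= n.+1)%N.
Proof.
suff : (size (cheb n) <= n.+1)%N && (size (cheb n.+1) <= n.+2)%N by case/andP.
elim: n => [|n /andP[IH1 IH2]].
  rewrite /cheb /= size_polyC_leq1 /=.
  by apply: leq_trans (size_scale_leq _ _) _; rewrite size_polyX.
rewrite IH2 chebSS /=; apply: leq_trans (size_polyD _ _) _.
rewrite geq_max size_polyN; apply/andP; split; last by apply: leq_trans IH1 _; rewrite ltnW.
apply: leq_trans (size_scale_leq _ _) _.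
by rewrite mulrC; apply: leq_trans (size_polyMleq _ _) _; rewrite size_polyX addnC.
Qed.

Lemma cheb_joukowski n v : v != 0 -> (cheb n).[joukowski v] = v ^+ n + v^-1 ^+ n.
Proof.
move=> v0.
suff : (cheb n).[joukowski v] = v ^+ n + v^-1 ^+ n /\
       (cheb n.+1).[joukowski v] = v ^+ n.+1 + v^-1 ^+ n.+1 by case.
elim: n => [|n [IH1 IH2]].
  rewrite /cheb /= !hornerE /joukowski !expr0 !expr1; split; [by ring|by rewrite /=; field].
split; first exact: IH2.
rewrite chebSS !hornerE IH1 IH2 /joukowski !exprS /=.
by field.
Qed.

(** The generating function [1 + 2 * (T_1(x) / w + T_2(x) / w^2 + ...)] of the Chebyshev polynomials
    at [x = joukowski v], cut after degree [n]. The [- 1] corrects the term [k = 0], which is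
    counted twice. *)
Definition kernel_part n w v : R[i] :=
  \sum_(k < n.+1) (v / w) ^+ k + \sum_(k < n.+1) (v^-1 / w) ^+ k - 1.

Definition kernel_full w v : R[i] := (1 - v / w)^-1 + (1 - v^-1 / w)^-1 - 1.

Definition kernel_poly n w : {poly R[i]} :=
  \sum_(k < n.+1) (w^-1 ^+ k) *: cheb k - 1.

Lemma size_kernel_poly n w : (size (kernel_poly n w) <= n.+1)%N.
Proof.
rewrite /kernel_poly; apply: leq_trans (size_polyD _ _) _.
rewrite geq_max size_polyN size_poly1 andbT.
apply: leq_trans (size_sum _ _ _) _; apply/bigmax_leqP => k _.
by apply: leq_trans (size_scale_leq _ _) _; apply: leq_trans (size_cheb _) _.
Qed.

Lemma horner_kernel_poly n w v : v != 0 ->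
  (kernel_poly n w).[joukowski v] = kernel_part n w v.
Proof.
move=> v0; rewrite /kernel_poly /kernel_part hornerD hornerN hornerC horner_sum.
rewrite -big_split /=; congr (_ - _); apply: eq_bigr => k _.
by rewrite hornerZ cheb_joukowski // !exprMn; ring.
Qed.

Lemma geometric_tail n (a : R[i]) : a != 1 ->
  (1 - a)^-1 - \sum_(k < n.+1) a ^+ k = a ^+ n.+1 / (1 - a).
Proof.
move=> a1; have a10 : 1 - a != 0 by rewrite subr_eq0 eq_sym.
apply: (mulIf a10); rewrite mulrBl divfK // mulVf //.
have : (\sum_(k < n.+1) a ^+ k) * (1 - a) = 1 - a ^+ n.+1.
  by apply: oppr_inj; rewrite -mulrN !opprB mulrC -subrX1.
by move=> ->; ring.
Qed.

Lemma kernel_tail n w v (r : R) : 1 < r -> normc w = r -> normc v = 1 ->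
  normc (kernel_full w v - kernel_part n w v) <= 2 / (r ^+ n * (r - 1)).
Proof.
move=> r1 wr v1; have r0 : 0 < r by lra.
have na : normc (v / w) = r^-1 by rewrite normcf_div wr v1 mul1r.
have nb : normc (v^-1 / w) = r^-1 by rewrite normcf_div normcV wr v1 invr1 mul1r.
have ir1 : r^-1 < 1 by rewrite invf_lt1.
have neq1 (a : R[i]) : normc a = r^-1 -> a != 1.
  by move=> h; apply/eqP => h1; move: h; rewrite h1 normc1; lra.
have -> : kernel_full w v - kernel_part n w v =
  ((1 - v / w)^-1 - \sum_(k < n.+1) (v / w) ^+ k) +
  ((1 - v^-1 / w)^-1 - \sum_(k < n.+1) (v^-1 / w) ^+ k).
  by rewrite /kernel_full /kernel_part; ring.
rewrite !geometric_tail ?neq1 //.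
have bd (a : R[i]) : normc a = r^-1 -> normc (a ^+ n.+1 / (1 - a)) <= 1 / (r ^+ n * (r - 1)).
  move=> h; rewrite normcf_div normcX h.
  have h1 : 1 - r^-1 <= normc (1 - a).
    by have := ler_subc_normc 1 a; rewrite normc1 h.
  have p0 : 0 < 1 - r^-1 by lra.
  have -> : 1 / (r ^+ n * (r - 1)) = r^-1 ^+ n.+1 / (1 - r^-1).
    have rn : r ^+ n != 0 by rewrite expf_neq0 // gt_eqF.
    have rm : r - 1 != 0 by rewrite gt_eqF // subr_gt0.
    rewrite exprVn exprS; field.
    by rewrite rn rm gt_eqF.
  apply: ler_pM; rewrite ?exprn_ge0 ?invr_ge0 ?normc_ge0 ?(ltW r0) //.
  by rewrite lef_pV2 ?posrE //; lra.
apply: le_trans (ler_normcD _ _) _.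
by have := bd _ na; have := bd _ nb; lra.
Qed.

(** The right side is [w] times the derivative of [joukowski] at [w]. Thus [kernel_full] is the
    Cauchy kernel [du / (u - x)], for [u = joukowski w] and [x = joukowski v], written in the
    coordinate [log w]. *)
Lemma kernel_fullE w v : w != 0 -> v != 0 -> 1 - v / w != 0 -> 1 - v^-1 / w != 0 ->
  kernel_full w v * (joukowski w - joukowski v) = (w - w^-1) / 2.
Proof.
move=> w0 v0 h1 h2.
have wv : w - v != 0.
  by apply: contra h1; rewrite subr_eq0 => /eqP <-; rewrite mulfV // subrr.
have vw : v * w - 1 != 0.
  apply: contra h2; rewrite subr_eq0 => /eqP h.
  have -> : w = v^-1 by apply: (mulfI v0); rewrite h mulfV.
  by rewrite mulfV ?invr_eq0 // subrr.
rewrite /kernel_full /joukowski; field.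
by rewrite w0 v0 vw wv.
Qed.

(** Cutting at degree [N.-1] avoids aliasing: every power from 1 to [N.-1] averages to 0 over [N]
    roots of unity, and only the terms of degree 0 remain. *)
Lemma mean_kernel_part N (r : R) v : (0 < N)%N -> r != 0 ->
  N%:R^-1 * \sum_(j < N) kernel_part N.-1 (r%:C * root_of_unity R N ^+ j) v = 1.
Proof.
move=> N0 r0; have NC : (N%:R : R[i]) != 0 by rewrite pnatr_eq0 -lt0n.
set x := root_of_unity R N.
have xN : x ^+ N = 1 by exact: root_of_unityX.
have x0 : x != 0 by rewrite -normc_gt0 (normc_unity_root N0 xN).
have rC : r%:C != 0 :> R[i] by rewrite -normc_gt0 normc_real normr_gt0.
have mean1 (a : R[i]) : \sum_(j < N) \sum_(k < N) (a / (r%:C * x ^+ j)) ^+ k = N%:R.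
  rewrite exchange_big /=; case: N N0 @x xN x0 {NC} => // N _ x xN x0.
  rewrite big_ord_recl /= [X in _ + X]big1 ?addr0 => [|k _].
    by rewrite (eq_bigr (fun=> 1)) ?sumr_const ?card_ord // => j _; rewrite expr0.
  rewrite (eq_bigr (fun j : 'I_N.+1 => (a / r%:C) ^+ k.+1 * (x^-1 ^+ k.+1) ^+ j)).
    rewrite -mulr_sumr sum_unity_root_exp ?mulr0 //.
      by rewrite -exprM mulnC exprM exprVn xN invr1 expr1n.
    rewrite exprVn invr_eq1; apply: root_of_unityX_neq1.
    by rewrite /= ltnS ltn_ord.
  move=> j _; rewrite /bump /= add1n -[X in _ = _ * X]exprM mulnC exprM -exprMn; congr (_ ^+ _).
  by rewrite exprVn invfM mulrA.
rewrite /kernel_part; under eq_bigr do rewrite prednK //.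
rewrite sumrB big_split /= !mean1 sumr_const card_ord.
by rewrite addrK mulVf.
Qed.

(** Inversion permutes the roots of unity, so the sum is its own opposite. *)
Lemma sum_unity_root_odd (G : R[i] -> R[i]) N : (0 < N)%N ->
  (forall w, w != 0 -> G w^-1 = - G w) ->
  \sum_(j < N) G (root_of_unity R N ^+ j) = 0.
Proof.
move=> N0 oddG; set x := root_of_unity R N.
have xN : x ^+ N = 1 by exact: root_of_unityX.
have x0 : x != 0 by rewrite -normc_gt0 (normc_unity_root N0 xN).
have sym : \sum_(j < N) G (x ^+ j) = \sum_(j < N) G (x ^+ j)^-1.
  case: N N0 @x xN x0 => // N _ x xN x0.
  rewrite !big_ord_recl /= expr0 invr1; congr (_ + _).
  rewrite (reindex_inj rev_ord_inj) /=; apply: eq_bigr => j _; congr G.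
  rewrite /bump /= !add1n.
  apply: (mulIf (expf_neq0 j.+1 x0)); rewrite mulVf ?expf_neq0 // -exprD -xN.
  by congr (_ ^+ _); rewrite subnSK // addnS subnK // ltnW.
set S := \sum_(j < N) _ in sym *.
have : S + S = 0.
  rewrite {2}sym -big_split /= big1 // => j _.
  by rewrite oddG ?subrr // expf_neq0.
by move=> /eqP; rewrite -mulr2n mulrn_eq0 /= => /eqP.
Qed.

End ChebyshevTruncation.

(** * Error of the truncated series *)

Section ChebyshevApproximation.
Variable R : realType.
Implicit Types (f g : R[i] -> R[i]) (u v w z : R[i]).

(** The bridge from the unit circle, where [H] need only be Lipschitz, to slightly larger circles
    where Cauchy's theorem applies. What matters is that [e] does not depend on [N]. *)
Lemma circle_mean_near0 (H : R[i] -> R[i]) (eps : R) : 0 < eps ->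
  (forall b, 0 <= b <= 2 * pi -> lip_at H (0 +i* b)) ->
  exists2 e : R, 0 < e & forall a (N : nat), 0 <= a < e -> (0 < N)%N ->
    normc (circle_mean H N a - circle_mean H N 0) <= eps.
Proof.
move=> eps0 lipH.
pose P (e b : R) := forall a, 0 <= a < e -> normc (H (a +i* b) - H (0 +i* b)) <= eps.
have [e e0 he] : exists2 e, 0 < e & forall b : R, `[0, 2 * pi]%classic b -> P e b.
  apply: compact_uniform.
  - exact: segment_compact.
  - move=> e e' b /andP[e'0 e'e] h a /andP[a0 ae]; apply: h.
    by rewrite a0; exact: lt_le_trans e'e.
  move=> b0; rewrite /= in_itv /= => /lipH/lip_at_ge0[L [e [e0 L0 h]]].
  have L1 : 0 < L + 1 by lra.
  pose d := Num.min (e / 4) (eps / (4 * (L + 1))).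
  have d0 : 0 < d by rewrite lt_min !divr_gt0 ?mulr_gt0.
  have de : d <= e / 4 by rewrite ge_min lexx.
  have dL : L * d <= eps / 4.
    have : d <= eps / (4 * (L + 1)) by rewrite ge_min lexx orbT.
    by rewrite ler_pdivlMr ?mulr_gt0 //; nra.
  exists d => //; near=> b => _ a /andP[a0 ad].
  have bb0 : `|b - b0| < d by rewrite distrC; near: b; exact: nbhsx_ballx.
  have n1 : normc (a +i* b - 0 +i* b0) <= 2 * d.
    apply: le_trans (ler_normc_ReIm _) _; simpc.
    by rewrite /= ?oppr0 ?addr0 ?subr0 ger0_norm //; lra.
  have n2 : normc (0 +i* b - 0 +i* b0) <= d.
    by apply: le_trans (ler_normc_ReIm _) _; simpc; rewrite /= ?subrr ?oppr0 ?addr0 ?normr0 ?add0r ltW.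
  apply: le_trans (ler_normc_dist (H (0 +i* b0)) _ _) _.
  rewrite (normc_distC (H (0 +i* b0))).
  have h1 := h _ (le_lt_trans n1 _); have h2 := h _ (le_lt_trans n2 _).
  have := h1 ltac:(lra); have := h2 ltac:(lra).
  have := ler_wpM2l L0 n1; have := ler_wpM2l L0 n2; lra.
exists e => // a N ha N0.
have N0' : 0 < (N%:R : R) by rewrite ltr0n.
rewrite /circle_mean -mulrBr -sumrB normcM normcV normc_nat ler_pdivrMl //.
apply: le_trans (ler_normc_sum _ _ _) _.
apply: le_trans (_ : \sum_(j < N) eps <= _); last by rewrite sumr_const card_ord mulr_natl.
apply: ler_sum => j _; apply: he ha; rewrite /= in_itv /=.
have pi0 := pi_gt0 R.
rewrite ?divr_ge0 ?mulr_ge0 ?ler0n ?(ltW pi0) //=.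
by rewrite ler_pdivrMr // ler_pM2l ?mulr_gt0 // ler_nat ltnW.
Unshelve. all: by end_near. Qed.

(** The contour integrals for the Chebyshev coefficients are replaced by [N]-point means on the
    circle of radius [r]. This is a polynomial for every [N], so no limit of polynomials has to be
    formed. *)
Definition cheb_trunc f (r : R) (m N : nat) : {poly R[i]} :=
  N%:R^-1 *: \sum_(j < N) f (joukowski (r%:C * root_of_unity R N ^+ j)) *:
    kernel_poly m (r%:C * root_of_unity R N ^+ j).

Lemma size_cheb_trunc f r m N : (size (cheb_trunc f r m N) <= m.+1)%N.
Proof.
apply: leq_trans (size_scale_leq _ _) _.
apply: leq_trans (size_sum _ _ _) _; apply/bigmax_leqP => k _.
by apply: leq_trans (size_scale_leq _ _) _; exact: size_kernel_poly.
Qed.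

Lemma hol_cosh z : hol (fun z => joukowski (cexp z)) z.
Proof.
apply: hol_mul; last exact: hol_cst.
apply: hol_add; first exact: hol_cexp.
exact: hol_comp (hol_cexp z) (hol_inv (cexp_neq0 z)).
Qed.

Lemma hol_sinh z : hol (fun z => (cexp z - (cexp z)^-1) / 2) z.
Proof.
apply: hol_mul; last exact: hol_cst.
apply: hol_sub; first exact: hol_cexp.
exact: hol_comp (hol_cexp z) (hol_inv (cexp_neq0 z)).
Qed.

Lemma unit_joukowski (x : R) : -1 <= x <= 1 ->
  exists2 v : R[i], normc v = 1 & joukowski v = x%:C.
Proof.
move=> /andP[x1 x2]; have hx : 0 <= 1 - x ^+ 2 by nra.
exists (x +i* Num.sqrt (1 - x ^+ 2)).
  rewrite /= sqr_sqrtr //.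
  by rewrite [X in Num.sqrt X](_ : _ = 1) ?sqrtr1 //; ring.
set v := _ +i* _.
have vv : v * (x -i* Num.sqrt (1 - x ^+ 2)) = 1.
  rewrite /v; simpc; congr (_ +i* _); last by ring.
  have -> : Num.sqrt (1 - x ^+ 2) * Num.sqrt (1 - x ^+ 2) = Num.sqrt (1 - x ^+ 2) ^+ 2 by [].
  by rewrite sqr_sqrtr //; ring.
have v0 : v != 0.
  by apply/eqP => h; move: vv; rewrite h mul0r => /esym/eqP; rewrite oner_eq0.
have -> : joukowski v = (v + (x -i* Num.sqrt (1 - x ^+ 2))) / 2.
  by rewrite /joukowski; congr ((_ + _) / _); apply: (mulfI v0); rewrite mulfV.
apply: (mulIf (x := 2)); first by rewrite pnatr_eq0.
rewrite divfK ?pnatr_eq0 // mulr_natr mulr2n /v; simpc.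
by congr (_ +i* _); ring.
Qed.

(* [G] below is odd under [w -> w^-1], so its mean vanishes on the unit circle, where
   the quotient is continuous; on the circle of radius [r] it is the difference between
   the Chebyshev kernel applied to [f] and to the constant [f x]. *)
Lemma cheb_kernel_mean f (rho r x : R) v (eps : R) :
  1 < r < rho -> (forall u, bernstein rho u -> hol f u) ->
  -1 <= x <= 1 -> normc v = 1 -> joukowski v = x%:C -> 0 < eps ->
  \forall N \near \oo, normc (N%:R^-1 * \sum_(j < N)
    (f (joukowski (r%:C * root_of_unity R N ^+ j)) - f x%:C) *
      kernel_full (r%:C * root_of_unity R N ^+ j) v) <= eps.
Proof.
move=> /andP[r1 rrho] hf hx nv vx eps0.
have rho1 : 1 < rho by lra.
have r0 : 0 < r by lra.
have [D [K [e [e0 hD]]]] := hf _ (real_bernstein rho1 hx).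
pose Q u := if u == x%:C then D x%:C else (f u - f x%:C) / (u - x%:C).
have lipQ u : bernstein rho u -> lip_at Q u.
  move=> hu; have [->|ux] := eqVneq u x%:C.
    exists K, e; split => // z hz; rewrite /Q eqxx.
    have xx : normc (x%:C - x%:C : R[i]) < e by rewrite subrr normc0.
    have [_ h] := hD _ _ xx hz.
    case: eqVneq => [->|zx]; first by rewrite !subrr normc0 mulr0.
    have zx0 : z - x%:C != 0 by rewrite subr_eq0.
    have n0 : 0 < normc (z - x%:C) by rewrite normc_gt0.
    have -> : (f z - f x%:C) / (z - x%:C) - D x%:C =
      (f z - f x%:C - D x%:C * (z - x%:C)) / (z - x%:C) by field.
    by rewrite normcf_div ler_pdivrMr // -mulrA -expr2.
  have ux0 : 0 < normc (u - x%:C) by rewrite normc_gt0 subr_eq0.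
  apply: hol_lip_at; apply: (hol_near (f := fun z => (f z - f x%:C) * (z - x%:C)^-1) ux0).
    move=> z hz; rewrite /Q; case: eqVneq => // zx.
    by move: hz; rewrite zx normc_distC ltxx.
  apply: hol_mul; first by apply: hol_sub; [exact: hf|exact: hol_cst].
  apply: hol_comp; first by apply: hol_sub; [exact: hol_id|exact: hol_cst].
  by apply: hol_inv; rewrite subr_eq0.
have holQ u : bernstein rho u -> u != x%:C -> hol Q u.
  move=> hu ux; have ux0 : 0 < normc (u - x%:C) by rewrite normc_gt0 subr_eq0.
  apply: (hol_near (f := fun z => (f z - f x%:C) * (z - x%:C)^-1) ux0).
    move=> z hz; rewrite /Q; case: eqVneq => // zx.
    by move: hz; rewrite zx normc_distC ltxx.
  apply: hol_mul; first by apply: hol_sub; [exact: hf|exact: hol_cst].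
  apply: hol_comp; first by apply: hol_sub; [exact: hol_id|exact: hol_cst].
  by apply: hol_inv; rewrite subr_eq0.
pose G w := Q (joukowski w) * ((w - w^-1) / 2).
pose H z := G (cexp z).
have eps4 : 0 < eps / 2 by lra.
have lipH b : 0 <= b <= 2 * pi -> lip_at H (0 +i* b).
  move=> _; apply: lip_at_mul; last by apply: hol_lip_at; exact: hol_sinh.
  apply: lip_at_comp; first by apply: hol_lip_at; exact: hol_cosh.
  by apply: lipQ; apply: joukowski_bernstein => //; rewrite normc_cexp expR0 lexx.
have [e' e'0 he'] := circle_mean_near0 eps4 lipH.
(* [joukowski (cexp z)] can meet [x] only on the line of real part 0 or to its left. From [s0] to
   [ln r] Cauchy's theorem applies; from 0 to [s0] the estimate [he'] takes over. *)
pose s0 := Num.min (e' / 2) (ln r / 2).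
have lr0 : 0 < ln r by rewrite ln_gt0.
have s00 : 0 < s0 by rewrite lt_min !divr_gt0.
have s0e : s0 < e' by rewrite /s0 gt_min; apply/orP; left; lra.
have s0r : s0 < ln r by rewrite /s0 gt_min; apply/orP; right; lra.
have holH a b : s0 <= a <= ln r -> 0 <= b <= 2 * pi -> hol H (a +i* b).
  move=> /andP[a1 a2] _; apply: hol_mul; last exact: hol_sinh.
  apply: hol_comp; first exact: hol_cosh.
  have n1 : 1 < normc (cexp (a +i* b)) by rewrite normc_cexp -expR0 ltr_expR /=; lra.
  apply: holQ; last exact: joukowski_neq_real.
  apply: joukowski_bernstein => //; rewrite (ltW n1) normc_cexp /=.
  by apply: le_lt_trans rrho; rewrite -[leRHS]lnK ?posrE // ler_expR.
have per a : H (a +i* (2 * pi)) = H (a +i* 0) by rewrite /H cexp_2pi.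
have evDC := discrete_cauchy s0r holH per eps4.
near=> N.
have N0 : (0 < N)%N by near: N; exact: nbhs_infty_gt.
have hDC : normc (circle_mean H N (ln r) - circle_mean H N s0) <= eps / 2.
  by near: N; exact: evDC.
have mean0 : circle_mean H N 0 = 0.
  rewrite /circle_mean (eq_bigr (fun j : 'I_N => G (root_of_unity R N ^+ j))); last first.
    by move=> j _; rewrite /H cexp_node expR0 mul1r.
  rewrite sum_unity_root_odd ?mulr0 // => w w0; rewrite /G /joukowski invrK [w^-1 + w]addrC.
  by rewrite -opprB mulNr mulrN.
have := he' s0 N; rewrite mean0 subr0 (ltW s00) s0e => /(_ isT N0) hs0.
set x1 := root_of_unity R N.
have nx1 : normc x1 = 1 by apply: (normc_unity_root N0); exact: root_of_unityX.
have -> : N%:R^-1 * (\sum_(j < N) (f (joukowski (r%:C * x1 ^+ j)) - f x%:C) *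
   kernel_full (r%:C * x1 ^+ j) v) = circle_mean H N (ln r).
  rewrite /circle_mean; congr (_ * _); apply: eq_bigr => j _.
  rewrite /H cexp_node lnK ?posrE // -/x1.
  set w := r%:C * x1 ^+ j.
  have nw : normc w = r by rewrite /w normcM normcX nx1 expr1n mulr1 normc_real gtr0_norm.
  have wx : joukowski w != x%:C by apply: joukowski_neq_real => //; rewrite nw.
  have w0 : w != 0 by rewrite -normc_gt0 nw.
  have v0 : v != 0 by rewrite -normc_gt0 nv.
  have ir : r^-1 < 1 by rewrite invf_lt1.
  have ne (a : R[i]) : normc a = r^-1 -> 1 - a != 0.
    move=> ha; rewrite subr_eq0; apply/eqP => h; move: ha; rewrite -h normc1; lra.
  rewrite /G /Q (negbTE wx) -(kernel_fullE w0 v0).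
  - by rewrite vx mulrCA divfK ?subr_eq0 // mulrC.
  - by apply: ne; rewrite normcf_div nv nw mul1r.
  - by apply: ne; rewrite normcf_div normcV nv nw invr1 mul1r.
rewrite -[circle_mean H N (ln r)](subrK (circle_mean H N s0)).
by apply: le_trans (ler_normcD _ _) _; lra.
Unshelve. all: by end_near. Qed.

Theorem cheb_trunc_error f (rho M r x : R) (m : nat) (eps : R) :
  1 < r < rho -> (forall u, bernstein rho u -> hol f u /\ normc (f u) <= M) ->
  -1 <= x <= 1 -> 0 < eps ->
  \forall N \near \oo, normc (f x%:C - (cheb_trunc f r m N).[x%:C])
    <= 2 * M / (r ^+ m * (r - 1)) + eps.
Proof.
move=> rr hf hx eps0; have /andP[r1 rrho] := rr.
have rho1 : 1 < rho by lra.
have r0 : 0 < r by lra.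
have [v nv vx] := unit_joukowski hx.
have v0 : v != 0 by rewrite -normc_gt0 nv.
have fx : normc (f x%:C) <= M := (hf _ (real_bernstein rho1 hx)).2.
have M0 : 0 <= M by apply: le_trans fx; exact: normc_ge0.
have eps2 : 0 < eps / 2 by lra.
have ev := cheb_kernel_mean rr (fun u hu => (hf u hu).1) hx nv vx eps2.
have r10 : 0 < r - 1 by lra.
have rn (n : nat) : 1 + n%:R * (r - 1) <= r ^+ n.
  elim: n => [|n IH]; first by rewrite mul0r addr0 expr0.
  rewrite exprS; apply: le_trans (ler_wpM2l (ltW r0) IH).
  rewrite -natr1; have : 0 <= n%:R * (r - 1) * (r - 1) by rewrite !mulr_ge0 ?ler0n // ltW.
  nra.
near=> N.
have N0 : (0 < N)%N by near: N; exact: nbhs_infty_gt.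
have N0' : 0 < (N%:R : R) by rewrite ltr0n.
have NC : (N%:R : R[i]) != 0 by rewrite pnatr_eq0 -lt0n.
(* By the Bernoulli inequality [rn] this makes the tail of degree [N.-1], multiplied by [M], at most
   [eps / 2]. *)
have Nlarge : 1 + 2 * M / (eps / 2 * (r - 1)) / (r - 1) <= N%:R.
  by near: N; exact: nbhs_infty_ger.
have ev1 : normc (N%:R^-1 * \sum_(j < N)
    (f (joukowski (r%:C * root_of_unity R N ^+ j)) - f x%:C) *
      kernel_full (r%:C * root_of_unity R N ^+ j) v) <= eps / 2 by near: N; exact: ev.
pose w (j : nat) := r%:C * root_of_unity R N ^+ j.
have nx1 : normc (root_of_unity R N) = 1.
  by apply: (normc_unity_root N0); exact: root_of_unityX.
have nw j : normc (w j) = r.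
  by rewrite /w normcM normcX nx1 expr1n mulr1 normc_real gtr0_norm.
pose mean (F : R[i] -> R[i]) := N%:R^-1 * \sum_(j < N) F (w j).
have le_mean F B : (forall u, normc u = r -> normc (F u) <= B) -> normc (mean F) <= B.
  move=> hF; rewrite normcM normcV normc_nat ler_pdivrMl //.
  apply: le_trans (ler_normc_sum _ _ _) _.
  apply: le_trans (_ : \sum_(j < N) B <= _); last by rewrite sumr_const card_ord mulr_natl.
  by apply: ler_sum => j _; apply: hF.
have trunc : (cheb_trunc f r m N).[x%:C] = mean (fun u => f (joukowski u) * kernel_part m u v).
  rewrite /cheb_trunc hornerZ horner_sum; congr (_ * _); apply: eq_bigr => j _.
  by rewrite hornerZ -vx horner_kernel_poly.
have mean_part : mean (fun u => kernel_part N.-1 u v) = 1.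
  by apply: mean_kernel_part => //; rewrite gt_eqF.
(* Truncation error of the kernel, failure of the discrete Cauchy formula, and deviation of the mean
   of the full kernel from 1. Only the first persists as [N] grows. *)
have -> : f x%:C - (cheb_trunc f r m N).[x%:C] =
  mean (fun u => f (joukowski u) * (kernel_full u v - kernel_part m u v))
  - mean (fun u => (f (joukowski u) - f x%:C) * kernel_full u v)
  - f x%:C * mean (fun u => kernel_full u v - kernel_part N.-1 u v).
  have -> : mean (fun u => kernel_full u v - kernel_part N.-1 u v) =
     mean (fun u => kernel_full u v) - 1.
    by rewrite -mean_part /mean -mulrBr -sumrB.
  have -> : mean (fun u => f (joukowski u) * (kernel_full u v - kernel_part m u v)) =
     mean (fun u => f (joukowski u) * kernel_full u v) - (cheb_trunc f r m N).[x%:C].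
    rewrite trunc /mean -mulrBr -sumrB; congr (_ * _); apply: eq_bigr => j _; ring.
  have -> : mean (fun u => (f (joukowski u) - f x%:C) * kernel_full u v) =
     mean (fun u => f (joukowski u) * kernel_full u v) - f x%:C * mean (fun u => kernel_full u v).
    rewrite /mean [X in _ = _ - X]mulrCA -mulrBr [X in _ = _ * (_ - X)]mulr_sumr -sumrB; congr (_ * _).
    by apply: eq_bigr => j _; ring.
  ring.
have b1 : normc (mean (fun u => f (joukowski u) * (kernel_full u v - kernel_part m u v)))
    <= 2 * M / (r ^+ m * (r - 1)).
  apply: le_mean => u nu; rewrite normcM.
  have -> : 2 * M / (r ^+ m * (r - 1)) = M * (2 / (r ^+ m * (r - 1))) by rewrite mulrA [M * 2]mulrC.
  apply: ler_pM; rewrite ?normc_ge0 //; last exact: kernel_tail.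
  by apply: (hf _ _).2; apply: joukowski_bernstein => //; rewrite nu rrho ltW.
have b2 : normc (f x%:C * mean (fun u => kernel_full u v - kernel_part N.-1 u v)) <= eps / 2.
  rewrite normcM; apply: le_trans (_ : M * (2 / (r ^+ N.-1 * (r - 1))) <= _).
    apply: ler_pM; rewrite ?normc_ge0 //.
    by apply: le_mean => u nu; exact: kernel_tail.
  have rN : 0 < r ^+ N.-1 by rewrite exprn_gt0.
  rewrite mulrA ler_pdivrMr ?mulr_gt0 // mulrC.
  have h1 : 2 * M / (eps / 2 * (r - 1)) <= r ^+ N.-1.
    apply: le_trans (rn _); rewrite -(ler_pM2r (_ : 0 < (r - 1)^-1)) ?invr_gt0 //.
    have -> : (1 + N.-1%:R * (r - 1)) / (r - 1) = (r - 1)^-1 + N.-1%:R.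
      by field; rewrite gt_eqF.
    have -> : N.-1%:R = N%:R - 1 :> R by rewrite -[in RHS](prednK N0) -natr1 addrK.
    have : 0 < (r - 1)^-1 by rewrite invr_gt0.
    lra.
  rewrite ler_pdivrMr ?mulr_gt0 // in h1.
  by apply: le_trans h1 _; rewrite mulrCA.
apply: le_trans (ler_normcB _ _) _.
apply: le_trans (lerD (ler_normcB _ _) (lexx _)) _.
move: b1 b2 ev1; rewrite -/(mean (fun u => (f (joukowski u) - f x%:C) * kernel_full u v)); lra.
Unshelve. all: by end_near. Qed.

End ChebyshevApproximation.

(** * Interpolation errors *)

Section LagrangeInterpolation.
Variables (R : realType) (m : nat) (t : 'I_m.+1 -> R).
Hypothesis inj_t : injective t.

Definition ell k (x : R) : R := (lagrange_basis t k).[x].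

Lemma size_lagrange k : (size (lagrange_basis t k) <= m.+1)%N.
Proof.
rewrite /lagrange_basis; apply: leq_trans (size_poly_prod_leq _ _) _.
rewrite leq_subLR.
have cardk : #|[pred j : 'I_m.+1 | j != k]| = m by rewrite cardC1 card_ord.
apply: (@leq_trans (\sum_(j < m.+1 | j != k) 2).+1).
  rewrite ltnS; apply: leq_sum => j _.
  by apply: leq_trans (size_scale_leq _ _) _; rewrite size_XsubC.
by rewrite sum_nat_const cardk muln2 -addnn addnS.
Qed.

Lemma ell_node k j : ell k (t j) = (k == j)%:R.
Proof.
rewrite /ell /lagrange_basis horner_prod; case: eqVneq => [->|kj].
  rewrite big1 // => i ij; rewrite !hornerE mulVf // subr_eq0.
  by apply: contraNneq ij => /inj_t ->.
by rewrite (bigD1 j) 1?eq_sym //= !hornerE subrr mulr0 mul0r.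
Qed.

Lemma lagrange_reproduces (P : {poly R[i]}) (x : R) : (size P <= m.+1)%N ->
  P.[x%:C] = \sum_k P.[(t k)%:C] * (ell k x)%:C.
Proof.
move=> szP.
pose L k := map_poly (real_complex R) (lagrange_basis t k).
have LE k (s : R) : (L k).[s%:C] = (ell k s)%:C by rewrite /L horner_map.
pose Q := P - \sum_k P.[(t k)%:C] *: L k.
suff Q0 : Q = 0.
  have : Q.[x%:C] = 0 by rewrite Q0 horner0.
  rewrite /Q hornerD hornerN horner_sum => /eqP; rewrite subr_eq0 => /eqP ->.
  by apply: eq_bigr => k _; rewrite hornerZ LE.
apply: (@roots_geq_poly_eq0 _ Q [seq (t k)%:C | k <- enum 'I_m.+1]).
- apply/allP => z /mapP[k _ ->]; rewrite /root /Q hornerD hornerN horner_sum.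
  rewrite (bigD1 k) //= big1 ?addr0 => [|j jk].
    by rewrite hornerZ LE ell_node eqxx mulr1 subrr.
  by rewrite hornerZ LE ell_node (negbTE jk) mulr0.
- rewrite map_inj_uniq ?enum_uniq // => a b /complexI; exact: inj_t.
rewrite size_map size_enum_ord; apply: leq_trans (size_polyD _ _) _.
rewrite geq_max szP size_polyN; apply: leq_trans (size_sum _ _ _) _.
apply/bigmax_leqP => k _; apply: leq_trans (size_scale_leq _ _) _.
by rewrite size_map_poly size_lagrange.
Qed.

Lemma sum_ell (x : R) : \sum_k ell k x = 1.
Proof.
apply: (@complexI R); rewrite rmorph_sum rmorph1 /=.
have := @lagrange_reproduces 1 x; rewrite size_poly1 hornerC => /(_ isT) ->.
by apply: eq_bigr => k _; rewrite hornerC mul1r.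
Qed.

Lemma horner_interp (f : R -> Cx R) (x : R) :
  (interp t f).[x%:C] = \sum_k f (t k) * (ell k x)%:C.
Proof.
rewrite /interp horner_sum; apply: eq_bigr => k _.
by rewrite hornerZ horner_map.
Qed.

Hypothesis t_itv : forall k, -1 <= t k <= 1.

Lemma continuous_real_complex : continuous (real_complex R : R -> Cx R).
Proof.
move=> x; apply/cvgrPdist_lt => /= e; case: e => e e'.
rewrite ltcE /= => /andP[/eqP -> e0].
near=> y; rewrite -rmorphB normr_normc normc_real ltcR.
near: y; exact: (@nbhsx_ballx R R x e).
Unshelve. all: by end_near. Qed.

Lemma continuous_clamp : continuous (fun s : R => Num.max (-1) (Num.min 1 s)).
Proof.
move=> s; have := @continuous_max R R (cst (-1)) (cst 1 \min id) s.
by apply; [exact: cvg_cst|apply: continuous_min; [exact: cvg_cst|exact: cvg_id]].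
Qed.

(** The extremal function interpolates the signs of [ell k x]. Clamping that polynomial to [[-1, 1]]
    gives it norm at most 1 and leaves its values at the nodes unchanged. The upper bound is needed
    as well, because [fine] would send an infinite norm to 0. *)
Lemma sum_norm_ell_le_lebesgue (x : R) : -1 <= x <= 1 ->
  \sum_k `|ell k x| <= lebesgue_const t.
Proof.
move=> hx.
pose T (f : R -> Cx R) (x : R) : Cx R := (interp t f).[x%:C].
pose I : set R := `[(-1 : R), 1]%classic.
have lower : ((\sum_k `|ell k x|)%:E <= opnorm I I T)%E.
  pose h s := \sum_k Num.sg (ell k x) * ell k s.
  pose f s : Cx R := (Num.max (-1) (Num.min 1 (h s)))%:C.
  have ch : continuous h.
    have -> : h = horner (\sum_k Num.sg (ell k x) *: lagrange_basis t k).
      by apply/funext => s; rewrite horner_sum; apply: eq_bigr => k _; rewrite hornerZ.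
    exact: continuous_horner.
  have fn k : f (t k) = (Num.sg (ell k x))%:C.
    rewrite /f; congr (_%:C).
    have -> : h (t k) = Num.sg (ell k x).
      rewrite /h (bigD1 k) //= big1 ?addr0 => [|j jk]; first by rewrite ell_node eqxx mulr1.
      by rewrite ell_node (negbTE jk) mulr0.
    have : -1 <= Num.sg (ell k x) <= 1.
      by rewrite -ler_norml normr_sg; case: (_ == 0).
    by move=> /andP[s1 s2]; rewrite (min_idPr s2) (max_idPr s1).
  apply: le_trans (_ : (supnorm I (T f) <= _)%E); last first.
    apply: ereal_sup_ubound; exists f => //; split.
      apply: continuous_subspaceT => s.
      have := continuous_comp (ch s) (@continuous_clamp (h s)).
      by move/continuous_comp; apply; exact: continuous_real_complex.
    apply: ge_ereal_sup => _ [s _ <-]; rewrite lee_fin /f normc_real ler_norml.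
    by rewrite le_max lexx /= ge_max ge_min lexx andbT; lra.
  apply: ereal_sup_ubound; exists x; first by rewrite /I /= in_itv.
  congr (_%:E); rewrite /T horner_interp.
  have -> : \sum_k f (t k) * (ell k x)%:C = (\sum_k `|ell k x|)%:C.
    by rewrite rmorph_sum /=; apply: eq_bigr => k _; rewrite fn -rmorphM -normrEsg.
  by rewrite normc_real ger0_norm // sumr_ge0.
have [B upper] : exists B : R, (opnorm I I T <= B%:E)%E.
  exists (\sum_k \sum_(i < size (lagrange_basis t k)) `|(lagrange_basis t k)`_i|).
  apply: ge_ereal_sup => _ [f [_ f1] <-]; apply: ge_ereal_sup => _ [s + <-].
  rewrite /I /= in_itv /= => hs; rewrite lee_fin /T horner_interp.
  apply: le_trans (ler_normc_sum _ _ _) _; apply: ler_sum => k _.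
  rewrite normcM normc_real -[leRHS]mul1r; apply: ler_pM; rewrite ?normc_ge0 //.
    rewrite -lee_fin; apply: le_trans f1; apply: ereal_sup_ubound.
    by exists (t k) => //; rewrite /I /= in_itv /=.
  rewrite /ell horner_coef; apply: le_trans (ler_norm_sum _ _ _) _.
  apply: ler_sum => i _; rewrite normrM ler_piMr // normrX exprn_ile1 //.
  by rewrite ler_norml.
rewrite -[lebesgue_const t]/(fine (opnorm I I T)); move: lower upper.
by case: (opnorm I I T) => [r| |] //=; rewrite lee_fin.
Qed.

Lemma lebesgue_const_ge0 : 0 <= lebesgue_const t.
Proof.
apply: le_trans (@sum_norm_ell_le_lebesgue 0 _); last by lra.
by apply: sumr_ge0.
Qed.

(** Interpolation reproduces the truncated series, so the error is at most [1 + lebesgue_const t]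
    times that of the truncation. The contour has radius [r < rho], and [r] tends to [rho] at the
    end. *)
Theorem interp_error (f : R[i] -> R[i]) (rho M x : R) :
  1 < rho -> (forall u, bernstein rho u -> hol f u /\ normc (f u) <= M) ->
  -1 <= x <= 1 ->
  normc (f x%:C - \sum_k f (t k)%:C * (ell k x)%:C)
    <= (1 + lebesgue_const t) * (2 * M / (rho ^+ m * (rho - 1))).
Proof.
move=> rho1 hf hx; set err := normc _; set Lam := lebesgue_const t.
have Lam0 : 0 <= Lam := lebesgue_const_ge0.
have M0 : 0 <= M.
  by apply: le_trans (hf _ (real_bernstein rho1 hx)).2; exact: normc_ge0.
have main r : 1 < r < rho -> err <= (1 + Lam) * (2 * M / (r ^+ m * (r - 1))).
  move=> rr; apply/ler_addgt0Pr => eps eps0.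
  pose eps' := eps / (1 + Lam).
  have eps'0 : 0 < eps' by rewrite divr_gt0 //; lra.
  have ex := cheb_trunc_error m rr hf hx eps'0.
  have et : \forall N \near \oo, forall k, normc (f (t k)%:C - (cheb_trunc f r m N).[(t k)%:C])
      <= 2 * M / (r ^+ m * (r - 1)) + eps'.
    by apply: filter_forall => k; exact: cheb_trunc_error rr hf _ eps'0.
  near \oo => N.
  have ex1 : normc (f x%:C - (cheb_trunc f r m N).[x%:C])
      <= 2 * M / (r ^+ m * (r - 1)) + eps' by near: N; exact: ex.
  have et1 : forall k, normc (f (t k)%:C - (cheb_trunc f r m N).[(t k)%:C])
      <= 2 * M / (r ^+ m * (r - 1)) + eps' by near: N; exact: et.
  set p := cheb_trunc f r m N in ex1 et1.
  set b := 2 * M / _ + _ in ex1 et1.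
  have b0 : 0 <= b by apply: le_trans ex1; exact: normc_ge0.
  have -> : (1 + Lam) * (2 * M / (r ^+ m * (r - 1))) + eps = b + Lam * b.
    have e1 : (1 + Lam) * eps' = eps by rewrite /eps' mulrC divfK // gt_eqF //; lra.
    by rewrite -[in LHS]e1 /b; ring.
  rewrite /err.
  have -> : f x%:C - \sum_k f (t k)%:C * (ell k x)%:C =
     (f x%:C - p.[x%:C]) - \sum_k (f (t k)%:C - p.[(t k)%:C]) * (ell k x)%:C.
    have -> : \sum_k (f (t k)%:C - p.[(t k)%:C]) * (ell k x)%:C =
        \sum_k f (t k)%:C * (ell k x)%:C - p.[x%:C].
      rewrite (lagrange_reproduces x (size_cheb_trunc f r m N)) -sumrB.
      by apply: eq_bigr => k _; rewrite mulrBl.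
    by ring.
  apply: le_trans (ler_normcB _ _) _; apply: lerD => //.
  apply: le_trans (ler_normc_sum _ _ _) _.
  apply: le_trans (_ : \sum_k `|ell k x| * b <= _).
    by apply: ler_sum => k _; rewrite normcM normc_real mulrC ler_wpM2l.
  by rewrite -mulr_suml ler_wpM2r // sum_norm_ell_le_lebesgue.
rewrite leNgt; apply/negP => h.
have q0 : 0 < rho ^+ m * (rho - 1) by rewrite mulr_gt0 ?exprn_gt0; lra.
rewrite mulrA ltr_pdivrMr // in h.
(* A strict failure of the bound at [rho] would persist for [r] slightly smaller, against [main]. *)
have ct : {for rho, continuous (fun r : R => (err : R) * (r ^+ m * (r - 1)))}.
  apply: cvgM; first exact: cvg_cst.
  apply: cvgM; first exact: exprn_continuous.
  by apply: cvgB; [exact: cvg_id|exact: cvg_cst].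
have near_rho : \forall r \near rho, ((1 + Lam) * (2 * M) < err * (r ^+ m * (r - 1)))%R.
  by apply: (cvgr_gt _ ct); exact: h.
near rho^'- => r.
have r1 : 1 < r by near: r; exact: nbhs_left_gt.
have rr : r < rho by near: r; exact: nbhs_left_lt.
have h1 : (1 + Lam) * (2 * M) < err * (r ^+ m * (r - 1)).
  by near: r; exact: cvg_within.
have q1 : 0 < r ^+ m * (r - 1) by rewrite mulr_gt0 ?exprn_gt0; lra.
have := main r; rewrite r1 rr => /(_ isT); rewrite mulrA ler_pdivlMr //; lra.
Unshelve. all: by end_near. Qed.

End LagrangeInterpolation.

(** * Tensor product interpolation, one coordinate at a time *)

Section TensorInterpolation.
Variables (R : realType) (d m : nat) (t : 'I_m.+1 -> R).
Hypothesis inj_t : injective t.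
Hypothesis t_itv : forall k, -1 <= t k <= 1.
Implicit Types (x y : 'rV[R]_d) (f : 'rV[R]_d -> Cx R) (k : {ffun 'I_d -> 'I_m.+1}).

Local Notation ell := (ell t).
Local Notation Lam := (lebesgue_const t).
Definition cube x := forall i, -1 <= x 0 i <= 1.

Definition upd x (j : 'I_d) (s : R) : 'rV[R]_d := \row_i (if i == j then s else x 0 i).

Definition fupd k (j : 'I_d) (c : 'I_m.+1) : {ffun 'I_d -> 'I_m.+1} :=
  [ffun i => if i == j then c else k i].

Definition weight k x : R := \prod_(i < d) ell (k i) (x 0 i).

Definition mix (n : nat) k x : 'rV[R]_d := \row_i (if (i < n)%N then t (k i) else x 0 i).

(** Fubini in coordinate [j]: a multi-index with entry [j] forgotten is represented by the one
    having [ord0] there. *)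
Lemma sum_ffun_coord (V : zmodType) (F : {ffun 'I_d -> 'I_m.+1} -> V) (j : 'I_d) :
  \sum_k F k = \sum_(k : {ffun 'I_d -> 'I_m.+1} | k j == ord0) \sum_c F (fupd k j c).
Proof.
rewrite (partition_big (fun k => fupd k j ord0) (fun k : {ffun 'I_d -> 'I_m.+1} => k j == ord0)) /=; last first.
  by move=> k _; rewrite ffunE eqxx.
apply: eq_bigr => k0 /eqP k0j.
rewrite (reindex_onto (fupd k0 j) (fun k : {ffun 'I_d -> 'I_m.+1} => k j)) /=; last first.
  move=> k /eqP <-; apply/ffunP => i; rewrite !ffunE.
  by case: eqVneq => // ->.
apply: eq_bigl => c; rewrite ffunE !eqxx andbT; apply/eqP/ffunP => i; rewrite !ffunE.
by case: eqVneq => // ->.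
Qed.

Lemma sum_weight x : \sum_k weight k x = 1.
Proof.
rewrite /weight -(bigA_distr_bigA (fun i c => ell c (x 0 i))) /=.
by rewrite big1 // => i _; exact: sum_ell.
Qed.

Lemma sum_norm_weight_le x : cube x -> \sum_k `|weight k x| <= Lam ^+ d.
Proof.
move=> hx; under eq_bigr do rewrite normr_prod.
rewrite -(bigA_distr_bigA (fun i c => `|ell c (x 0 i)|)) /=.
apply: le_trans (_ : \prod_(i < d) Lam <= _); last by rewrite prodr_const card_ord.
apply: ler_prod => i _; rewrite sumr_ge0 //=.
exact: sum_norm_ell_le_lebesgue.
Qed.

Lemma tensor_interpE f x :
  tensor_interp t f x = \sum_(k : {ffun 'I_d -> 'I_m.+1}) f (\row_i t (k i)) * (weight k x)%:C.
Proof.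
by apply: eq_bigr => k _; rewrite /weight rmorph_prod.
Qed.

Lemma tensor_interp_bound f x (M : R) : cube x ->
  (forall y, cube y -> normc (f y) <= M) -> normc (tensor_interp t f x) <= Lam ^+ d * M.
Proof.
move=> hx hf; rewrite tensor_interpE; apply: le_trans (ler_normc_sum _ _ _) _.
apply: le_trans (_ : \sum_k `|weight k x| * M <= _).
  apply: ler_sum => k _; rewrite normcM normc_real mulrC ler_wpM2l // hf // => i.
  by rewrite mxE.
rewrite -mulr_suml ler_wpM2r ?sum_norm_weight_le //.
by apply: le_trans (hf x hx); exact: normc_ge0.
Qed.

(** Interpolation in the coordinates below [n]. The sum still runs over all multi-indices with their
    full weights, since the weights of an untouched coordinate sum to 1; so all stages share one
    index set. *)
Definition partial_interp n f x : R[i] := \sum_k f (mix n k x) * (weight k x)%:C.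

Lemma partial_interp0 f x : partial_interp 0 f x = f x.
Proof.
rewrite /partial_interp (eq_bigr (fun k => f x * (weight k x)%:C)); last first.
  by move=> k _; congr (f _ * _); apply/rowP => i; rewrite mxE.
by rewrite -mulr_sumr -rmorph_sum sum_weight mulr1.
Qed.

Lemma partial_interp_full f x : partial_interp d f x = tensor_interp t f x.
Proof.
rewrite tensor_interpE; apply: eq_bigr => k _; congr (f _ * _).
by apply/rowP => i; rewrite !mxE ltn_ord.
Qed.

Lemma mix_cube n k x : cube x -> cube (mix n k x).
Proof. by move=> hx i; rewrite mxE; case: ifP. Qed.

Lemma partial_interp_step f x (E : R) (j : 'I_d) : cube x ->
  (forall y, cube y -> normc (f y - \sum_c f (upd y j (t c)) * (ell c (y 0 j))%:C) <= E) ->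
  normc (partial_interp j f x - partial_interp j.+1 f x) <= Lam ^+ d.-1 * E.
Proof.
move=> hx hE; pose W k := \prod_(i < d | i != j) ell (k i) (x 0 i).
have E0 : 0 <= E by apply: le_trans (hE x hx); exact: normc_ge0.
have wE k c : weight (fupd k j c) x = ell c (x 0 j) * W k.
  rewrite /weight (bigD1 j) //= ffunE eqxx; congr (_ * _).
  by apply: eq_bigr => i ij; rewrite ffunE (negbTE ij).
have mixE k c : mix j (fupd k j c) x = mix j k x.
  apply/rowP => i; rewrite !mxE ffunE; case: eqVneq => // ->.
  by rewrite ltnn.
have mixSE k c : mix j.+1 (fupd k j c) x = upd (mix j k x) j (t c).
  apply/rowP => i; rewrite !mxE ffunE ltnS leq_eqVlt (inj_eq val_inj).
  by case: eqVneq.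
have -> : partial_interp j f x - partial_interp j.+1 f x =
  \sum_(k : {ffun 'I_d -> 'I_m.+1} | k j == ord0) (W k)%:C * (f (mix j k x) -
     \sum_c f (upd (mix j k x) j (t c)) * (ell c (mix j k x 0 j))%:C).
  rewrite /partial_interp -sumrB (sum_ffun_coord _ j); apply: eq_bigr => k _.
  have -> : mix j k x 0 j = x 0 j by rewrite mxE ltnn.
  have -> : f (mix j k x) - \sum_c f (upd (mix j k x) j (t c)) * (ell c (x 0 j))%:C =
    \sum_c (f (mix j k x) * (ell c (x 0 j))%:C - f (upd (mix j k x) j (t c)) * (ell c (x 0 j))%:C).
    by rewrite sumrB -mulr_sumr -rmorph_sum sum_ell // mulr1.
  rewrite mulr_sumr; apply: eq_bigr => c _.
  by rewrite mixE mixSE wE rmorphM /=; ring.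
apply: le_trans (ler_normc_sum _ _ _) _.
apply: le_trans (_ : \sum_(k : {ffun 'I_d -> 'I_m.+1} | k j == ord0) `|W k| * E <= _).
  apply: ler_sum => k _; rewrite normcM normc_real ler_wpM2l //.
  by apply: hE; exact: mix_cube.
rewrite -mulr_suml ler_wpM2r //.
(* Distributivity turns the sum into a product over all coordinates. Coordinate [j] contributes the
   factor 1 through its only admissible value, so [d.-1] factors [Lam] remain. *)
pose F i c := if i == j then (1:R) else `|ell c (x 0 i)|.
pose Q i (c : 'I_m.+1) := (i == j) ==> (c == ord0).
have -> : \sum_(k : {ffun 'I_d -> 'I_m.+1} | k j == ord0) `|W k| =
    \prod_(i < d) \sum_(c | Q i c) F i c.
  rewrite bigA_distr_big_dep; apply: eq_big => k.
    apply/idP/familyP => [kj i|/(_ j)]; last by rewrite /in_mem /= /Q eqxx.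
    by rewrite /in_mem /= /Q; apply/implyP => /eqP ->.
  move=> _; rewrite [RHS](bigD1 j) //= /F eqxx mul1r /W normr_prod.
  by apply: eq_bigr => i ij; rewrite (negbTE ij).
rewrite (bigD1 j) //= /Q eqxx /= big_pred1_eq /F eqxx mul1r.
apply: le_trans (_ : \prod_(i < d | i != j) Lam <= _); last first.
  by rewrite prodr_const cardC1 card_ord.
apply: ler_prod => i ij; rewrite (negbTE ij) /= sumr_ge0 //=.
exact: sum_norm_ell_le_lebesgue.
Qed.

Theorem tensor_interp_error f x (E : R) : cube x ->
  (forall (j : 'I_d) y, cube y ->
    normc (f y - \sum_c f (upd y j (t c)) * (ell c (y 0 j))%:C) <= E) ->
  normc (f x - tensor_interp t f x) <= d%:R * (Lam ^+ d.-1 * E).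
Proof.
move=> hx hE; rewrite -{1}(partial_interp0 f x) -partial_interp_full.
suff main n : (n <= d)%N ->
    normc (partial_interp 0 f x - partial_interp n f x) <= n%:R * (Lam ^+ d.-1 * E).
  exact: main.
elim: n => [|n IH] nd; first by rewrite subrr normc0 mul0r.
apply: le_trans (ler_normc_dist (partial_interp n f x) _ _) _.
rewrite -natr1 mulrDl mul1r; apply: lerD; first exact: IH (ltnW nd).
by apply: (partial_interp_step (j := Ordinal nd)) => // y hy; exact: hE.
Qed.

End TensorInterpolation.

(** * Restriction of analytic functions to complex lines *)

#[local] Existing Instance totally_filter.

Section AnalyticSlices.
Variable R : realType.

Lemma partial_sum_near (I : choiceType) (g : I -> Cx R) (l : Cx R) :
  partial_sum g @ totally --> l ->
  forall eps : R, 0 < eps -> \forall S \near totally, normc (partial_sum g S - l) < eps.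
Proof.
move=> /cvgrPdist_lt h eps eps0.
have e0 : 0 < eps%:C :> R[i] by rewrite ltcR.
apply: filterS (h _ e0) => x.
by rewrite normr_normc ltcR normc_distC.
Qed.

Lemma partial_sumE (I : choiceType) (x : I -> Cx R) (S : {fset I}) :
  partial_sum x S = \sum_(i <- S) x i.
Proof. by rewrite /partial_sum big_seq_fsetE. Qed.

(** Sums over finite sets disjoint from [S0] are at most 2 in modulus. Separating positive from
    negative terms bounds the absolute values by 4, for the real and for the imaginary parts: hence
    the 8. *)
Lemma unconditional_abs_bounded (I : choiceType) (x : I -> Cx R) (l : Cx R) :
  partial_sum x @ totally --> l ->
  exists B : R, forall S : {fset I}, \sum_(i <- S) normc (x i) <= B.
Proof.
move=> cv; have [S0 _ hS0] := partial_sum_near cv ltr01.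
have small (S : {fset I}) : [disjoint S & S0]%fset -> normc (\sum_(i <- S) x i) <= 2.
  move=> dis.
  have h1 := hS0 (S `|` S0)%fset (fsubsetUr _ _).
  have h2 := hS0 S0 (fsubset_refl _).
  move: h1 h2; rewrite /= !partial_sumE.
  have -> : \sum_(i <- (S `|` S0)%fset) x i = \sum_(i <- S) x i + \sum_(i <- S0) x i.
    rewrite (big_fsetID _ (mem S)) /=; congr (_ + _); apply: eq_fbigl => i; rewrite !inE /=.
      by case: (i \in S); rewrite ?andbF ?orbT.
    have := fdisjointP dis i; case: (i \in S) => /= [/(_ isT)/negbTE ->|_] //.
    by rewrite andbT.
  move=> h1 h2.
  have := ler_normc_dist l (\sum_(i <- S) x i + \sum_(i <- S0) x i) (\sum_(i <- S0) x i).
  rewrite addrK (normc_distC l); lra.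
have part (p : I -> R) (S : {fset I}) : [disjoint S & S0]%fset ->
    (forall S' : {fset I}, [disjoint S' & S0]%fset -> `|\sum_(i <- S') p i| <= 2) ->
    \sum_(i <- S) `|p i| <= 4.
  move=> dis hp.
  have sub (P : pred I) : [disjoint [fset i in S | P i] & S0]%fset.
    apply: fdisjointWl dis; exact: fset_sub.
  have e1 := hp _ (sub (fun i => 0 <= p i)); have e2 := hp _ (sub (fun i => ~~ (0 <= p i))).
  rewrite (bigID (fun i => 0 <= p i)) /=.
  rewrite -!big_fset_condE in e1 e2.
  have -> : \sum_(i <- S | 0 <= p i) `|p i| = \sum_(i <- S | 0 <= p i) p i.
    by apply: eq_bigr => i /ger0_norm.
  have -> : \sum_(i <- S | ~~ (0 <= p i)) `|p i| = - \sum_(i <- S | ~~ (0 <= p i)) p i.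
    by rewrite -sumrN; apply: eq_bigr => i; rewrite -ltNge => /ltr0_norm.
  move: e1 e2; rewrite !ler_norml => /andP[_ e1] /andP[e2 _]; lra.
exists (8 + \sum_(i <- S0) normc (x i)) => S.
have Re_sum (S' : {fset I}) : \sum_(i <- S') complex.Re (x i) = complex.Re (\sum_(i <- S') x i).
  by elim/big_rec2: _ => // i a b _ ->; case: (x i) a => ? ? [].
have Im_sum (S' : {fset I}) : \sum_(i <- S') complex.Im (x i) = complex.Im (\sum_(i <- S') x i).
  by elim/big_rec2: _ => // i a b _ ->; case: (x i) a => ? ? [].
rewrite (bigID (fun i => i \in S0)) /= addrC; apply: lerD.
  rewrite big_fset_condE /=.
  set S1 := [fset i in S | i \notin S0]%fset.
  have dis : [disjoint S1 & S0]%fset.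
    by apply/fdisjointP => i; rewrite !inE /= => /andP[_].
  apply: le_trans (_ : \sum_(i <- S1) (`|complex.Re (x i)| + `|complex.Im (x i)|) <= _).
    by apply: ler_sum => i _; exact: ler_normc_ReIm.
  rewrite big_split /=.
  have h1 := part (fun i => complex.Re (x i)) S1 dis _.
  have h2 := part (fun i => complex.Im (x i)) S1 dis _.
  have : \sum_(i <- S1) `|complex.Re (x i)| <= 4.
    by apply: h1 => S' dis'; rewrite Re_sum; apply: le_trans (ler_Re_normc _) (small _ dis').
  have : \sum_(i <- S1) `|complex.Im (x i)| <= 4.
    by apply: h2 => S' dis'; rewrite Im_sum; apply: le_trans (ler_Im_normc _) (small _ dis').
  lra.
rewrite big_fset_condE /=.
have sub : ([fset i in S | i \in S0] `<=` S0)%fset.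
  by apply/fsubsetP => i; rewrite !inE /= => /andP[_].
rewrite [leRHS](bigID (fun i => i \in [fset i in S | i \in S0]%fset)) /=.
have -> : \sum_(i <- S0 | i \in [fset i in S | i \in S0]%fset) normc (x i) =
    \sum_(i <- [fset i in S | i \in S0]%fset) normc (x i).
  rewrite big_fset_condE /=; apply: eq_fbigl => i; rewrite !inE /=.
  by case: (i \in S0); rewrite ?andbT ?andbF.
by rewrite lerDl; apply: sumr_ge0 => i _; exact: normc_ge0.
Qed.

(** The factor [tau] on the left avoids the exponent [n - 1], and with it the cases [n = 0] and
    [tau = 0]. The next lemma uses [tau ^+ 2] in the same way. *)
Lemma normc_exprB_le (x y : R[i]) (tau : R) n : normc x <= tau -> normc y <= tau ->
  tau * normc (x ^+ n - y ^+ n) <= n%:R * normc (x - y) * tau ^+ n.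
Proof.
move=> hx hy; have t0 : 0 <= tau by apply: le_trans hx; exact: normc_ge0.
elim: n => [|n IH]; first by rewrite subrr normc0 mulr0 !mul0r.
have -> : x ^+ n.+1 - y ^+ n.+1 = x * (x ^+ n - y ^+ n) + (x - y) * y ^+ n.
  by rewrite !exprS; ring.
have hyn : normc (y ^+ n) <= tau ^+ n by rewrite normcX lerXn2r ?nnegrE ?normc_ge0.
apply: le_trans (ler_wpM2l t0 (ler_normcD _ _)) _.
rewrite (normcM x) (normcM (x - y)) mulrDr.
have -> : n.+1%:R * normc (x - y) * tau ^+ n.+1 =
   tau * (n%:R * normc (x - y) * tau ^+ n) + tau * (normc (x - y) * tau ^+ n).
  by rewrite (exprS tau) -natr1; ring.
apply: lerD.
  rewrite mulrCA; apply: ler_pM; rewrite ?normc_ge0 ?mulr_ge0 ?normc_ge0 //.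
by apply: ler_wpM2l => //; apply: ler_wpM2l; rewrite ?normc_ge0.
Qed.

Lemma monomial_cross_increments (h a b : R[i]) (tau : R) n :
  normc h <= tau -> normc (h + a) <= tau -> normc (h + b) <= tau ->
  tau ^+ 2 * normc (b * ((h + a) ^+ n - h ^+ n) - a * ((h + b) ^+ n - h ^+ n))
    <= n%:R ^+ 2 * tau ^+ n * (normc a * normc b * (normc a + normc b)).
Proof.
move=> hh ha hb; have t0 : 0 <= tau by apply: le_trans hh; exact: normc_ge0.
set P := _ * (normc a + _); have P0 : 0 <= P by rewrite !mulr_ge0 ?addr_ge0 ?normc_ge0.
elim: n => [|n IH].
  by rewrite !expr0 !subrr !mulr0 subrr normc0 mulr0 expr2 !mul0r.
have -> : b * ((h + a) ^+ n.+1 - h ^+ n.+1) - a * ((h + b) ^+ n.+1 - h ^+ n.+1) =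
   h * (b * ((h + a) ^+ n - h ^+ n) - a * ((h + b) ^+ n - h ^+ n))
   + a * b * ((h + a) ^+ n - (h + b) ^+ n).
  by rewrite !exprS; ring.
have tn : 0 <= tau ^+ n by rewrite exprn_ge0.
have hd := normc_exprB_le n ha hb.
have hab : normc (h + a - (h + b)) <= normc a + normc b.
  by rewrite opprD addrACA subrr add0r; exact: ler_normcB.
apply: le_trans (_ : tau * (n%:R ^+ 2 * tau ^+ n * P) + tau * (n%:R * tau ^+ n * P) <= _).
  apply: le_trans (ler_wpM2l (sqr_ge0 tau) (ler_normcD _ _)) _.
  rewrite (normcM h) (normcM (a * b)) (normcM a b) mulrDr; apply: lerD.
    by rewrite mulrCA; apply: ler_pM; rewrite ?normc_ge0 ?mulr_ge0 ?sqr_ge0 ?normc_ge0.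
  have -> : tau ^+ 2 * (normc a * normc b * normc ((h + a) ^+ n - (h + b) ^+ n)) =
     tau * ((normc a * normc b) * (tau * normc ((h + a) ^+ n - (h + b) ^+ n))) by ring.
  apply: ler_wpM2l => //.
  have -> : n%:R * tau ^+ n * P = normc a * normc b * (n%:R * (normc a + normc b) * tau ^+ n).
    by rewrite /P; ring.
  apply: ler_wpM2l; first by rewrite mulr_ge0 ?normc_ge0.
  apply: le_trans hd _; rewrite ler_wpM2r // ler_wpM2l ?ler0n //.
have -> : n.+1%:R ^+ 2 * tau ^+ n.+1 * P =
  tau * (n%:R ^+ 2 * tau ^+ n * P) + tau * (n%:R * tau ^+ n * P)
   + (n%:R + 1) * (tau * (tau ^+ n * P)) by rewrite (exprS tau) -natr1; ring.
rewrite lerDl; apply: mulr_ge0; first by rewrite natr1 ler0n.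
by apply: mulr_ge0 => //; exact: mulr_ge0.
Qed.

(* The derivative is cut out as a supremum by the Cauchy property of the quotients. *)
Lemma derivative_of_cross_increments (q : R[i] -> R[i]) (K e : R) :
  0 < e -> 0 <= K ->
  (forall a b, 0 < normc a <= e -> 0 < normc b <= e ->
     normc (q a - q b) <= K * (normc a + normc b)) ->
  exists D : R[i], forall b, 0 < normc b <= e -> normc (q b - D) <= 2 * K * normc b.
Proof.
move=> e0 K0 hq.
have real_part (p : R[i] -> R) : (forall a b, 0 < normc a <= e -> 0 < normc b <= e ->
     `|p a - p b| <= K * (normc a + normc b)) ->
  exists D : R, forall b, 0 < normc b <= e -> `|p b - D| <= K * normc b.
  move=> hp; pose A := [set p a - K * normc a | a in [set a | 0 < normc a <= e]].
  have ne : e%:C != 0 :> R[i] by rewrite -normc_gt0 normc_real gtr0_norm.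
  have ub b : 0 < normc b <= e -> ubound A (p b + K * normc b).
    move=> hb _ [a /= ha <-]; have := hp a b ha hb.
    by rewrite ler_norml mulrDr => /andP[_]; lra.
  have he : 0 < normc (e%:C : R[i]) <= e by rewrite normc_real gtr0_norm // e0 lexx.
  have hA : has_sup A.
    split; first by exists (p e%:C - K * normc (e%:C : R[i])); exists e%:C.
    by exists (p e%:C + K * normc (e%:C : R[i])); exact: ub.
  exists (sup A) => b hb.
  have h1 : p b - K * normc b <= sup A.
    by apply: sup_upper_bound => //; exists b.
  have h2 : sup A <= p b + K * normc b by apply: ge_sup; [exact: hA.1|exact: ub].
  by rewrite ler_norml; lra.
have [|D1 hD1] := real_part (fun a => complex.Re (q a)).
  move=> a b ha hb; apply: le_trans (hq a b ha hb).
  by apply: le_trans (ler_Re_normc _); case: (q a) (q b) => ? ? [].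
have [|D2 hD2] := real_part (fun a => complex.Im (q a)).
  move=> a b ha hb; apply: le_trans (hq a b ha hb).
  by apply: le_trans (ler_Im_normc _); case: (q a) (q b) => ? ? [].
exists (D1 +i* D2) => b hb; apply: le_trans (ler_normc_ReIm _) _.
have := hD1 b hb; have := hD2 b hb.
by case: (q b) => x y /=; lra.
Qed.

(** No derivative series is formed. Estimates uniform over finite partial sums pass to [F], one
    finite set serving three points at once. The index set stays arbitrary, so a multivariate series
    restricted to a line need not be regrouped by degree. *)
Lemma power_sums_hol (I : choiceType) (a : I -> R[i]) (N : I -> nat) (F : R[i] -> R[i]) (delta : R) :
  0 < delta ->
  (forall h, normc h <= delta ->
     partial_sum (fun i => a i * h ^+ N i : Cx R) @ totally --> (F h : Cx R)) ->
  hol F 0.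
Proof.
move=> d0 conv.
have dd : normc (delta%:C : R[i]) <= delta by rewrite normc_real gtr0_norm.
have [B hB] := unconditional_abs_bounded (conv _ dd).
have B0 : 0 <= B by have := hB fset0; rewrite big_nil.
have {}hB (S : {fset I}) : \sum_(i <- S) normc (a i) * delta ^+ N i <= B.
  apply: le_trans (hB S); rewrite le_eqVlt; apply/orP; left; apply/eqP; apply: eq_bigr => i _.
  by rewrite normcM normcX normc_real gtr0_norm.
(* The 4 absorbs the factor [n ^+ 2] of [monomial_cross_increments], because [n ^ 2 <= 4 ^ n]. *)
pose tau := delta / 4; have tau0 : 0 < tau by rewrite divr_gt0.
have taud : tau <= delta by rewrite /tau; lra.
have FB h : normc h <= delta -> normc (F h) <= B.
  move=> hh; apply/ler_addgt0Pr => eps eps0.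
  have [S0 _ hS] := partial_sum_near (conv h hh) eps0.
  have := hS S0 (fsubset_refl _); rewrite /= partial_sumE => h1.
  have : normc (\sum_(i <- S0) a i * h ^+ N i) <= B.
    apply: le_trans (ler_normc_sum _ _ _) _; apply: le_trans (hB S0).
    apply: ler_sum => i _; rewrite normcM normcX ler_wpM2l ?normc_ge0 //.
    by rewrite lerXn2r ?nnegrE ?normc_ge0 // ltW.
  have := ler_subc_normc (F h) (\sum_(i <- S0) a i * h ^+ N i).
  rewrite normc_distC; lra.
pose K := B / tau ^+ 2.
have t2 : 0 < tau ^+ 2 by rewrite exprn_gt0.
have K0 : 0 <= K by rewrite divr_ge0 // ltW.
have cross h u v : normc h <= tau -> normc (h + u) <= tau -> normc (h + v) <= tau ->
    normc (v * (F (h + u) - F h) - u * (F (h + v) - F h)) <=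
      K * (normc u * normc v * (normc u + normc v)).
  move=> h1 h2 h3; apply/ler_addgt0Pr => eps eps0.
  set P := normc u * _ * _; have P0 : 0 <= P by rewrite !mulr_ge0 ?addr_ge0 ?normc_ge0.
  pose W := 2 * (normc u + normc v) + 1.
  have W0 : 0 < W by have := normc_ge0 u; have := normc_ge0 v; rewrite /W; lra.
  pose eps' := eps / W; have eps'0 : 0 < eps' by rewrite divr_gt0.
  have c1 := partial_sum_near (conv h (le_trans h1 taud)) eps'0.
  have c2 := partial_sum_near (conv (h + u) (le_trans h2 taud)) eps'0.
  have c3 := partial_sum_near (conv (h + v) (le_trans h3 taud)) eps'0.
  have [S [e1 e2 e3]] : exists S : {fset I},
    [/\ normc (partial_sum (fun i => a i * h ^+ N i : Cx R) S - F h) < eps',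
        normc (partial_sum (fun i => a i * (h + u) ^+ N i : Cx R) S - F (h + u)) < eps' &
        normc (partial_sum (fun i => a i * (h + v) ^+ N i : Cx R) S - F (h + v)) < eps'].
    by have [S [s1 [s2 s3]]] := filter_ex (filterI c1 (filterI c2 c3)); exists S.
  rewrite !partial_sumE in e1 e2 e3.
  set s1 := \sum_(i <- S) a i * h ^+ N i in e1.
  set s2 := \sum_(i <- S) a i * (h + u) ^+ N i in e2.
  set s3 := \sum_(i <- S) a i * (h + v) ^+ N i in e3.
  have main : normc (v * (s2 - s1) - u * (s3 - s1)) <= K * P.
    have -> : v * (s2 - s1) - u * (s3 - s1) =
      \sum_(i <- S) a i * (v * ((h + u) ^+ N i - h ^+ N i) - u * ((h + v) ^+ N i - h ^+ N i)).
      rewrite /s1 /s2 /s3 -!sumrB !mulr_sumr -sumrB; apply: eq_bigr => i _; ring.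
    apply: le_trans (ler_normc_sum _ _ _) _.
    rewrite /K mulrAC ler_pdivlMr // mulr_suml.
    apply: le_trans (_ : (\sum_(i <- S) normc (a i) * delta ^+ N i) * P <= _); last first.
      by rewrite ler_wpM2r.
    rewrite mulr_suml; apply: ler_sum => i _.
    rewrite normcM -!mulrA ler_wpM2l ?normc_ge0 // mulrC.
    apply: le_trans (monomial_cross_increments (N i) h1 h2 h3) _.
    rewrite -/P ler_wpM2r // /tau expr_div_n mulrCA -[leRHS]mulr1 ler_wpM2l ?exprn_ge0 ?(ltW d0) //.
    rewrite ler_pdivrMr ?exprn_gt0 // mul1r -!natrX ler_nat.
    rewrite (_ : 4 = 2 ^ 2)%N // -expnM mulnC expnM leq_exp2r //.
    by rewrite ltnW // ltn_expl.
  have -> : v * (F (h + u) - F h) - u * (F (h + v) - F h) =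
    (v * (s2 - s1) - u * (s3 - s1)) - (v * (s2 - F (h + u)) - v * (s1 - F h))
     + (u * (s3 - F (h + v)) - u * (s1 - F h)) by ring.
  have fin : (2 * normc v) * eps' + (2 * normc u) * eps' <= eps.
    have -> : eps = W * eps' by rewrite /eps' mulrC divfK // gt_eqF.
    by rewrite /W; lra.
  have n1 : normc (v * (s2 - F (h + u)) - v * (s1 - F h)) <= (2 * normc v) * eps'.
    apply: le_trans (ler_normcB _ _) _; rewrite !normcM.
    have := ler_wpM2l (normc_ge0 v) (ltW e2); have := ler_wpM2l (normc_ge0 v) (ltW e1); lra.
  have n2 : normc (u * (s3 - F (h + v)) - u * (s1 - F h)) <= (2 * normc u) * eps'.
    apply: le_trans (ler_normcB _ _) _; rewrite !normcM.
    have := ler_wpM2l (normc_ge0 u) (ltW e3); have := ler_wpM2l (normc_ge0 u) (ltW e1); lra.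
  apply: le_trans (ler_normcD _ _) _; apply: le_trans (lerD (ler_normcB _ _) (lexx _)) _; lra.
pose e := tau / 2; have e0 : 0 < e by rewrite divr_gt0.
have exD h : normc h <= e -> exists D : R[i], forall b, 0 < normc b <= e ->
    normc ((F (h + b) - F h) / b - D) <= 2 * K * normc b.
  move=> hh; apply: (derivative_of_cross_increments (q := fun b => (F (h + b) - F h) / b)) => //.
  move=> u v /andP[u0 ue] /andP[v0 ve].
  have un : u != 0 by rewrite -normc_gt0.
  have vn : v != 0 by rewrite -normc_gt0.
  have ht : normc h <= tau by rewrite /e in hh; lra.
  have hu : normc (h + u) <= tau by apply: le_trans (ler_normcD _ _) _; rewrite /e in hh ue; lra.
  have hv : normc (h + v) <= tau by apply: le_trans (ler_normcD _ _) _; rewrite /e in hh ve; lra.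
  have := cross h u v ht hu hv.
  have -> : (F (h + u) - F h) / u - (F (h + v) - F h) / v =
    (v * (F (h + u) - F h) - u * (F (h + v) - F h)) / (u * v) by field; rewrite un vn.
  rewrite normcf_div normcM ler_pdivrMr ?mulr_gt0 // => h1; apply: le_trans h1 _.
  by rewrite le_eqVlt; apply/orP; left; apply/eqP; ring.
have [D hD] : {D : R[i] -> R[i] & forall h, normc h <= e -> forall b, 0 < normc b <= e ->
    normc ((F (h + b) - F h) / b - D h) <= 2 * K * normc b}.
  apply: (choice (P := fun h D => normc h <= e -> forall b, 0 < normc b <= e ->
    normc ((F (h + b) - F h) / b - D) <= 2 * K * normc b)).
  move=> h; have [hh|hh] := leP (normc h) e; last by exists 0.
  by have [D hD] := exD h hh; exists D.
have ed : 2 * e <= delta by rewrite /e /tau; lra.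
(* The last two terms bound [D]: it differs by at most [2 * K * e] from the difference quotient with
   step [e], which is at most [2 * B / e]. *)
exists D, (2 * K + 2 * K * e + 2 * B / e), (e / 2); split; first by rewrite divr_gt0.
have K20 : 0 <= 2 * K * e by apply: mulr_ge0 (mulr_ge0 _ K0) (ltW e0).
have Be0 : 0 <= 2 * B / e by apply: divr_ge0 (mulr_ge0 _ B0) (ltW e0).
move=> z w; rewrite !subr0 => hz hw.
have hze : normc z <= e by lra.
have nwz : normc (w - z) <= e by apply: le_trans (ler_normcB _ _) _; lra.
split.
  have ne : normc (e%:C : R[i]) = e by rewrite normc_real gtr0_norm.
  have := hD z hze e%:C; rewrite ne e0 lexx => /(_ isT) h1.
  have h2 : normc ((F (z + e%:C) - F z) / e%:C) <= 2 * B / e.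
    rewrite normcf_div ne ler_wpM2r ?invr_ge0 ?(ltW e0) //.
    apply: le_trans (ler_normcB _ _) _.
    have := FB z (ltac:(lra)).
    have zed : normc (z + e%:C) <= delta.
      by apply: le_trans (ler_normcD _ _) _; rewrite ne; lra.
    have := FB _ zed; lra.
  have := ler_subc_normc (D z) ((F (z + e%:C) - F z) / e%:C).
  rewrite normc_distC; lra.
have [->|wz] := eqVneq w z.
  by rewrite !subrr mulr0 subr0 normc0 expr2 !mulr0.
have wz0 : w - z != 0 by rewrite subr_eq0.
have n0 : 0 < normc (w - z) by rewrite normc_gt0.
have := hD z hze (w - z); rewrite n0 nwz => /(_ isT).
have -> : z + (w - z) = w by ring.
move=> h1.
have -> : F w - F z - D z * (w - z) = ((F w - F z) / (w - z) - D z) * (w - z) by field.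
rewrite normcM; apply: le_trans (ler_wpM2r (ltW n0) h1) _.
apply: (@le_trans _ _ (2 * K * normc (w - z) ^+ 2)); first by rewrite expr2 !mulrA.
by apply: ler_wpM2r; rewrite ?sqr_ge0 //; lra.
Qed.

Definition line n (p v : 'rV[Cx R]_n) (s : R[i]) : 'rV[Cx R]_n :=
  \row_i (p 0 i + s * v 0 i).

(** On the line each monomial becomes a constant times a power of the parameter, with the total
    degree as exponent; [delta] keeps the line inside the polydisc of convergence. *)
Theorem analytic_hol_line n (Omega : set 'rV[Cx R]_n) (f : 'rV[Cx R]_n -> Cx R)
    (p v : 'rV[Cx R]_n) (s0 : R[i]) :
  analytic_on Omega f -> Omega (line p v s0) -> hol (fun s => f (line p v s)) s0.
Proof.
move=> an Os; have [c nb] := an _ Os.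
set w := line p v s0 in nb.
have [r r0 hr] : exists2 r : R, 0 < r & forall z : 'rV[Cx R]_n, (forall i, normc (z 0 i - w 0 i) < r) ->
    partial_sum (fun alpha : {ffun 'I_n -> nat} =>
      c alpha * \prod_(i < n) (z 0 i - w 0 i) ^+ alpha i) @ totally --> f z.
  (* Radii of balls over [R[i]] are themselves complex; positivity forces a zero imaginary part. *)
  move/nbhs_ballP: nb => [e /= e0 he].
  have : 0 < e by exact: e0.
  case: e e0 he => r r' e0 he epos; have := epos; rewrite ltcE /= => /andP[/eqP r'0 r0].
  exists r => // z hz; apply: he; split=> [//|i j]; rewrite ord1 /ball /= normr_normc.
  by rewrite ltcE /= -r'0 eqxx /= normc_distC hz.
pose V := \sum_(i < n) normc (v 0 i) + 1.
have V0 : 0 < V by rewrite ltr_wpDl // sumr_ge0 // => i _; exact: normc_ge0.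
have vV i : normc (v 0 i) < V.
  rewrite /V (bigD1 i) //= -addrA ltrDl ltr_wpDl // sumr_ge0 // => k _; exact: normc_ge0.
pose delta := r / (2 * V).
have delta0 : 0 < delta by rewrite divr_gt0 // mulr_gt0.
have dV : delta * V < r.
  have -> : delta * V = r / 2 by rewrite /delta; field; rewrite gt_eqF.
  lra.
pose F h := f (line p v (s0 + h)).
have : hol F 0.
  apply: (@power_sums_hol _ (fun alpha : {ffun 'I_n -> nat} => c alpha * \prod_(i < n) v 0 i ^+ alpha i)
    (fun alpha => \sum_(i < n) alpha i)%N F delta) => // h hh.
  have e i : line p v (s0 + h) 0 i - w 0 i = h * v 0 i by rewrite !mxE; ring.
  have cond i : normc (line p v (s0 + h) 0 i - w 0 i) < r.
    rewrite e normcM; apply: le_lt_trans dV.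
    by apply: ler_pM; rewrite ?normc_ge0 // ltW.
  have := hr _ cond.
  rewrite [X in partial_sum X](_ : _ = fun alpha : {ffun 'I_n -> nat} =>
     c alpha * \prod_(i < n) v 0 i ^+ alpha i * h ^+ (\sum_(i < n) alpha i)) //.
  apply/funext => alpha; rewrite -mulrA; congr (_ * _).
  rewrite expr_sum -big_split /=; apply: eq_bigr => i _.
  by rewrite e exprMn mulrC.
have sub : hol (fun s => s - s0) s0 by apply: hol_sub; [exact: hol_id|exact: hol_cst].
move=> hF; have := @hol_comp _ F _ s0 sub.
rewrite subrr => /(_ hF); apply: eq_hol => s.
by rewrite /F addrC subrK.
Qed.

End AnalyticSlices.

(** * Boxes and ellipses *)

Section Boxes.
Variables (R : realType) (d : nat).
Implicit Types (B : box R d) (x y u : 'rV[R]_d).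

Definition mid B i : R := (lo B 0 i + hi B 0 i) / 2.
Definition half B i : R := (hi B 0 i - lo B 0 i) / 2.

Lemma half_gt0 B i : 0 < half B i.
Proof. by have := lo_lt_hi B i; rewrite /half; lra. Qed.

Lemma to_boxE B u i : to_box B u 0 i = mid B i + half B i * u 0 i.
Proof. by rewrite mxE. Qed.

Lemma to_box_cube B u : cube u -> boxset B (to_box B u).
Proof.
move=> hu i; rewrite to_boxE; have := hu i; have := half_gt0 B i.
rewrite /mid /half => h /andP[h1 h2]; apply/andP; split; nra.
Qed.

Lemma of_box_cube B x : boxset B x -> cube (of_box B x).
Proof.
move=> hx i; rewrite mxE; have /andP[h1 h2] := hx i; have h := lo_lt_hi B i.
by rewrite ler_pdivlMr ?ler_pdivrMr; lra.
Qed.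

Lemma of_boxK B x : to_box B (of_box B x) = x.
Proof.
apply/rowP => i; rewrite !mxE; have := lo_lt_hi B i => h; field.
by rewrite subr_eq0 gt_eqF.
Qed.

Lemma to_box_upd B u j s : to_box B (upd u j s) = upd (to_box B u) j (mid B j + half B j * s).
Proof. by apply/rowP => i; rewrite !mxE; case: eqVneq => [->|]. Qed.

Lemma subset_box B B' : boxset B `<=` boxset B' ->
  forall i, lo B' 0 i <= lo B 0 i /\ hi B 0 i <= hi B' 0 i.
Proof.
move=> sub i.
have h1 : boxset B (lo B) by move=> k; rewrite lexx ltW // lo_lt_hi.
have h2 : boxset B (hi B) by move=> k; rewrite lexx ltW // lo_lt_hi.
by have /andP[-> _] := sub _ h1 i; have /andP[_ ->] := sub _ h2 i.
Qed.

Lemma enorm_ge_coord x i : `|x 0 i| <= enorm x.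
Proof.
rewrite -sqrtr_sqr ler_wsqrtr // (bigD1 i) //= lerDl sumr_ge0 // => k _.
exact: sqr_ge0.
Qed.

Lemma width_le_diam B j : 2 * half B j <= diam (boxset B).
Proof.
have hl : boxset B (lo B) by move=> k; rewrite lexx ltW // lo_lt_hi.
have hh : boxset B (hi B) by move=> k; rewrite lexx ltW // lo_lt_hi.
apply: le_trans (_ : enorm (hi B - lo B) <= _).
  have -> : 2 * half B j = (hi B - lo B) 0 j by rewrite !mxE /half; field.
  exact: le_trans (ler_norm _) (enorm_ge_coord (hi B - lo B) j).
apply: sup_upper_bound; last by exists (hi B) => //; exists (lo B).
split; first by exists (enorm (hi B - lo B)), (hi B) => //; exists (lo B).
(* The length of the diagonal bounds the set, without which [sup] in [diam] gives no upper bound. *)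
exists (Num.sqrt (\sum_(i < d) (2 * half B i) ^+ 2)) => _ [x hx] [y hy] <-.
rewrite /enorm ler_wsqrtr //; apply: ler_sum => i _; rewrite !mxE.
have /andP[x1 x2] := hx i; have /andP[y1 y2] := hy i.
rewrite -[X in X <= _](real_normK (num_real _)).
rewrite lerXn2r ?nnegrE //; last by rewrite ler_norml /half; lra.
by rewrite mulr_ge0 // ltW // half_gt0.
Qed.

Lemma bernstein_box_mid rho B j (z : 'rV[Cx R]_d) (u : Cx R) : 1 < rho ->
  (forall i, i != j -> exists2 s : R, lo B 0 i <= s <= hi B 0 i & z 0 i = s%:C) ->
  z 0 j = (mid B j)%:C + (half B j)%:C * u -> bernstein rho u ->
  bernstein_box rho B z.
Proof.
move=> rho1 hz zj hu i; have [->|ij] := eqVneq i j; first by exists u.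
have [s hs ->] := hz i ij.
have h0 := half_gt0 B i.
exists ((s - mid B i) / half B i)%:C.
  apply: real_bernstein => //; move: hs h0; rewrite /half /mid => /andP[s1 s2] h0.
  by rewrite ler_pdivlMr // ler_pdivrMr //; lra.
rewrite -rmorphM -rmorphD /=; congr (_%:C).
by rewrite -/(mid B i) -/(half B i) mulrC divfK ?gt_eqF // addrC subrK.
Qed.

End Boxes.

(** * Inclusions between Bernstein ellipses *)

Section EllipseInclusion.
Variable R : realType.

(** The images [s + q] and [s - q] of the foci lie in [[-1, 1]]. Moving them to [1] and [-1] costs
    [1 - s - q] and [1 + s - q], together [2 * (1 - q)]. *)
Lemma foci_contract (q s : R) (u : R[i]) : 0 < q -> -1 <= s - q -> s + q <= 1 ->
  normc (s%:C + q%:C * u - 1) + normc (s%:C + q%:C * u + 1)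
    <= q * (normc (u - 1) + normc (u + 1)) + 2 * (1 - q).
Proof.
move=> q0 s1 s2.
have -> : s%:C + q%:C * u - 1 = q%:C * (u - 1) + (s + q - 1)%:C.
  by rewrite rmorphB rmorphD rmorph1 /=; ring.
have -> : s%:C + q%:C * u + 1 = q%:C * (u + 1) + (s - q + 1)%:C.
  by rewrite rmorphD rmorphB rmorph1 /=; ring.
have t1 : normc (q%:C * (u - 1) + (s + q - 1)%:C) <= q * normc (u - 1) + (1 - s - q).
  apply: le_trans (ler_normcD _ _) _; rewrite normcM !normc_real gtr0_norm //.
  by rewrite ler0_norm; lra.
have t2 : normc (q%:C * (u + 1) + (s - q + 1)%:C) <= q * normc (u + 1) + (s - q + 1).
  apply: le_trans (ler_normcD _ _) _; rewrite normcM !normc_real gtr0_norm //.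
  by rewrite ger0_norm; lra.
lra.
Qed.

Lemma bernstein_contract (rho q s : R) (u : R[i]) : 1 < rho ->
  0 < q -> -1 <= s - q -> s + q <= 1 -> bernstein rho u -> bernstein rho (s%:C + q%:C * u).
Proof.
move=> rho1 q0 s1 s2; rewrite /bernstein /= => hu.
have q1 : q <= 1 by lra.
apply: le_lt_trans (foci_contract u q0 s1 s2) _.
have := gt2_joukowski rho1.
have := ltr_pM2l q0 (normc (u - 1) + normc (u + 1)) (rho + rho^-1).
rewrite hu; nra.
Qed.

(* The smaller parameter solves (rho' - 1)^2 = qbar (rho - 1)^2. *)
Lemma ellipse_inclusion (q s qbar rho : R) (u : R[i]) :
  0 < qbar < 1 -> 1 < rho -> 0 < q <= qbar -> -1 <= s - q -> s + q <= 1 ->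
  bernstein rho u ->
  bernstein (1 + Num.sqrt qbar * (rho - 1)) (s%:C + q%:C * u).
Proof.
move=> /andP[qb0 qb1] rho1 /andP[q0 qqb] s1 s2; rewrite /bernstein /= => hu.
apply: le_lt_trans (foci_contract u q0 s1 s2) _.
set sq := Num.sqrt qbar.
have sq2 : sq ^+ 2 = qbar by rewrite sqr_sqrtr // ltW.
have sq0 : 0 < sq by rewrite sqrtr_gt0.
have sq1 : sq < 1 by rewrite -sqrtr1 ltr_sqrt.
set rho' := 1 + sq * (rho - 1).
have rho'1 : 1 <= rho' by rewrite /rho' lerDl mulr_ge0; lra.
have rho'r : rho' <= rho by rewrite /rho'; nra.
have rp : 0 < rho by lra. have rp' : 0 < rho' by lra.
(* By [foci_contract] the excess of the focal sum over 2 is multiplied by [q]. Written as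
   [(rho - 1) ^+ 2 / rho], it can be compared with that of [rho'], the smaller denominator
   helping. *)
have e1 : rho + rho^-1 = 2 + (rho - 1) ^+ 2 / rho by field; rewrite gt_eqF.
have e2 : rho' + rho'^-1 = 2 + (rho' - 1) ^+ 2 / rho' by field; rewrite gt_eqF.
have e3 : (rho' - 1) ^+ 2 = qbar * (rho - 1) ^+ 2 by rewrite -sq2 /rho'; ring.
have ge : qbar * ((rho - 1) ^+ 2 / rho) <= (rho' - 1) ^+ 2 / rho'.
  rewrite e3 mulrA; apply: ler_wpM2l; first exact: mulr_ge0 (ltW qb0) (sqr_ge0 _).
  by rewrite lef_pV2 ?posrE.
have X0 : 0 <= (rho - 1) ^+ 2 / rho by rewrite divr_ge0 ?sqr_ge0 // ltW.
rewrite e2; rewrite e1 in hu.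
have := ltr_pM2l q0 (normc (u - 1) + normc (u + 1)) (2 + (rho - 1) ^+ 2 / rho).
rewrite hu; have := ler_wpM2r X0 qqb; lra.
Qed.

(** The ratio equals [Num.sqrt qbar + (1 - Num.sqrt qbar) / rho], decreasing in [rho]; its value at
    [rhomin] is the constant [qhat]. *)
Lemma rho_ratio_le (qbar rhomin rho : R) : 0 < qbar < 1 -> 1 < rhomin -> rhomin <= rho ->
  (1 + Num.sqrt qbar * (rho - 1)) / rho <=
    Num.sqrt qbar + (1 - Num.sqrt qbar) / rhomin.
Proof.
move=> /andP[qb0 qb1] r1 rr.
have sq1 : Num.sqrt qbar < 1 by rewrite -sqrtr1 ltr_sqrt.
have -> : (1 + Num.sqrt qbar * (rho - 1)) / rho = Num.sqrt qbar + (1 - Num.sqrt qbar) / rho.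
  by field; rewrite gt_eqF //; lra.
rewrite lerD2l ler_wpM2l //; first by lra.
by rewrite lef_pV2 ?posrE //; lra.
Qed.

Lemma rho_ratio_itv (qbar rhomin : R) : 0 < qbar < 1 -> 1 < rhomin ->
  0 < Num.sqrt qbar + (1 - Num.sqrt qbar) / rhomin < 1.
Proof.
move=> /andP[qb0 qb1] r1.
have sq1 : Num.sqrt qbar < 1 by rewrite -sqrtr1 ltr_sqrt.
have sq0 : 0 < Num.sqrt qbar by rewrite sqrtr_gt0.
have h0 : 0 < (1 - Num.sqrt qbar) / rhomin by rewrite divr_gt0; lra.
have h1 : (1 - Num.sqrt qbar) / rhomin < 1 - Num.sqrt qbar.
  by rewrite ltr_pdivrMr; [nra|lra].
by apply/andP; split; lra.
Qed.

Lemma bernstein_scale (rho t : R) (u : R[i]) : 1 < rho -> 0 <= t <= 1 ->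
  bernstein rho u -> bernstein rho (t%:C * u).
Proof.
move=> rho1 /andP[t0 t1] hu.
have [->|tn] := eqVneq t 0.
  by rewrite mul0r; apply: (@real_bernstein R rho 0) => //; lra.
have tp : 0 < t by rewrite lt_neqAle eq_sym tn.
rewrite -[X in bernstein _ X]add0r; apply: (@bernstein_contract rho t 0) => //; lra.
Qed.

Lemma bernstein_norm_le (rho : R) (u : R[i]) : bernstein rho u -> normc u <= (rho + rho^-1) / 2.
Proof.
rewrite /bernstein /= => hu.
have : normc (2 * u) <= normc (u - 1) + normc (u + 1).
  rewrite [X in normc X <= _](_ : _ = (u - 1) + (u + 1)); last by ring.
  exact: ler_normcD.
by rewrite normcM normc_nat; lra.
Qed.

End EllipseInclusion.

Section NestedBoxes.
Variables (R : realType) (d : nat).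

Lemma nested_affine (B B' : box R d) (j : 'I_d) : boxset B `<=` boxset B' ->
  let q := half B j / half B' j in
  let s := (mid B j - mid B' j) / half B' j in
  [/\ 0 < q, -1 <= s - q, s + q <= 1 &
    forall u : R[i], (mid B j)%:C + (half B j)%:C * u =
      (mid B' j)%:C + (half B' j)%:C * (s%:C + q%:C * u)].
Proof.
move=> sub q s; have [l h] := subset_box sub j.
have h0 := half_gt0 B j; have h0' := half_gt0 B' j.
split; first by rewrite divr_gt0.
- by rewrite /s /q -mulrBl ler_pdivlMr // /mid /half; lra.
- by rewrite /s /q -mulrDl ler_pdivrMr // /mid /half; lra.
move=> u; rewrite mulrDr mulrA -!rmorphM.
rewrite /s /q ![half B' j * _]mulrC !divfK ?gt_eqF // rmorphB /=; ring.
Qed.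

End NestedBoxes.

Section TensorPolynomials.
Variables (R : realType) (d m : nat).

Lemma Qpoly_slice (p : 'rV[R]_d -> Cx R) (x : 'rV[R]_d) (j : 'I_d) : Qpoly m p ->
  exists2 P : {poly R[i]}, (size P <= m.+1)%N & forall s : R, p (upd x j s) = P.[s%:C].
Proof.
move=> [c hc].
exists (\sum_(alpha : {ffun 'I_d -> 'I_m.+1})
   (c alpha * \prod_(i < d | i != j) (x 0 i)%:C ^+ alpha i) *: 'X^(alpha j)).
  apply: leq_trans (size_sum _ _ _) _; apply/bigmax_leqP => alpha _.
  by apply: leq_trans (size_scale_leq _ _) _; rewrite size_polyXn ltn_ord.
move=> s; rewrite hc horner_sum; apply: eq_bigr => alpha _.
rewrite hornerZ hornerXn (bigD1 j) //= mxE eqxx -[RHS]mulrA; congr (_ * _).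
rewrite mulrC; congr (_ * _); apply: eq_bigr => i ij.
by rewrite mxE (negbTE ij).
Qed.

(** This keeps every iterate of the form [E_{y_k} p_k] with [p_k] in [Q_m]. *)
Lemma Qpoly_box_interp (t : 'I_m.+1 -> R) (B : box R d) (f : 'rV[R]_d -> Cx R) :
  Qpoly m (box_interp t B f).
Proof.
pose aff i : {poly R} := (2 / (hi B 0 i - lo B 0 i)) *: 'X
   - ((lo B 0 i + hi B 0 i) / (hi B 0 i - lo B 0 i))%:P.
pose P i k : {poly R[i]} := map_poly (real_complex R) (lagrange_basis t k \Po aff i).
have size_aff i : (size (aff i) <= 2)%N.
  apply: leq_trans (size_polyD _ _) _; rewrite geq_max size_polyN.
  apply/andP; split; last exact: leq_trans (size_polyC_leq1 _) (leqnSn 1).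
  by apply: leq_trans (size_scale_leq _ _) _; rewrite size_polyX.
have sizeP i k : (size (P i k) <= m.+1)%N.
  rewrite size_map_poly; have := size_comp_poly_leq (lagrange_basis t k) (aff i).
  move=> h; apply: leq_trans h _; rewrite ltnS.
  have s1 : ((size (lagrange_basis t k)).-1 <= m)%N.
    by have := size_lagrange t k; case: (size _).
  have s2 : ((size (aff i)).-1 <= 1)%N by have := size_aff i; case: (size _).
  by apply: leq_trans (leq_mul s1 s2) _; rewrite muln1.
have PE i k (x : 'rV[R]_d) : ((lagrange_basis t k).[of_box B x 0 i])%:C = (P i k).[(x 0 i)%:C].
  rewrite /P horner_map horner_comp; congr ((_.[_])%:C).
  have h := lo_lt_hi B i.
  by rewrite /aff !hornerE mxE; field; rewrite subr_eq0 gt_eqF.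
exists (fun alpha : {ffun 'I_d -> 'I_m.+1} => \sum_(k : {ffun 'I_d -> 'I_m.+1})
   f (to_box B (\row_i t (k i))) * \prod_(i < d) (P i (k i))`_(alpha i)).
move=> x; rewrite /box_interp /tensor_interp.
under [RHS]eq_bigr do rewrite mulr_suml.
rewrite [RHS]exchange_big /=; apply: eq_bigr => k _.
under [RHS]eq_bigr do rewrite -mulrA -big_split /=.
rewrite -mulr_sumr; congr (_ * _).
rewrite -(bigA_distr_bigA (fun i (a : 'I_m.+1) => (P i (k i))`_a * (x 0 i)%:C ^+ a)) /=.
by apply: eq_bigr => i _; rewrite PE (horner_coef_wide _ (sizeP i (k i))).
Qed.

End TensorPolynomials.

(** * The phase *)

Section MixedDifference.
Variables (R : realType) (d : nat).
Implicit Types (x y : 'rV[R]_d) (A Y : 'rV[Cx R]_d).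

Definition cslice x (j : 'I_d) (c h : R) (u : R[i]) : 'rV[Cx R]_d :=
  \row_i (if i == j then c%:C + h%:C * u else (x 0 i)%:C).

Definition real_row x : 'rV[Cx R]_d := map_mx (real_complex R) x.

Lemma cenorm_cslice x j c h u v : 0 <= h ->
  cenorm (cslice x j c h u - cslice x j c h v) = h * normc (u - v).
Proof.
move=> h0; rewrite /cenorm (bigD1 j) //= big1 ?addr0 => [|i ij].
  rewrite !mxE eqxx sqrtr_sqr ger0_norm ?normc_ge0 //.
  have -> : c%:C + h%:C * u - (c%:C + h%:C * v) = h%:C * (u - v) by ring.
  by rewrite normcM normc_real ger0_norm.
by rewrite !mxE (negbTE ij) subrr normc0 expr0n.
Qed.

Lemma cball_center (e : R) A : 0 < e -> cball e A A.
Proof.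
move=> e0; rewrite /cball /= /cenorm big1 ?sqrtr0 // => i _.
by rewrite !mxE subrr normc0 expr0n.
Qed.

Lemma cenorm_real_scale (z : R[i]) x :
  Num.sqrt (\sum_(i < d) normc (z * (x 0 i)%:C) ^+ 2) = normc z * enorm x.
Proof.
rewrite /enorm -[X in _ = X * _](ger0_norm (normc_ge0 z)) -sqrtr_sqr -sqrtrM ?sqr_ge0 //.
congr (Num.sqrt _); rewrite mulr_sumr; apply: eq_bigr => i _.
by rewrite normcM normc_real exprMn real_normK ?num_real.
Qed.

Lemma enorm_ge0 x : 0 <= enorm x.
Proof. exact: sqrtr_ge0. Qed.

Lemma enorm_eq0 x : enorm x = 0 -> x = 0.
Proof.
move=> h; apply/rowP => i; rewrite mxE; apply/eqP.
by rewrite -normr_le0 -h; exact: enorm_ge_coord.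
Qed.

Lemma real_row_bernstein_box rho (B : box R d) y (j : 'I_d) : 1 < rho -> boxset B y ->
  bernstein_box rho B (real_row y).
Proof.
move=> rho1 hy; have h0 := half_gt0 B j.
apply: (@bernstein_box_mid _ _ rho B j _ ((y 0 j - mid B j) / half B j)%:C) => //.
- by move=> i _; exists (y 0 i); [exact: hy|rewrite mxE].
- by rewrite mxE -rmorphM -rmorphD /= mulrC divfK ?gt_eqF // addrC subrK.
apply: real_bernstein => //; have := hy j; move: h0; rewrite /half /mid => h0 /andP[s1 s2].
by rewrite ler_pdivlMr // ler_pdivrMr //; lra.
Qed.

Variables (Omega : set 'rV[Cx R]_(d + d)) (Phi : 'rV[Cx R]_(d + d) -> Cx R).
Variables (rho eps M : R) (Bx By : box R d).
Hypothesis anPhi : analytic_on Omega Phi.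
Hypothesis bdPhi : forall w, Omega w -> normc (Phi w) <= M.
Hypothesis rho1 : 1 < rho.
Hypothesis eps0 : 0 < eps.
Hypothesis epsOmega : forall a b, bernstein_box rho Bx a -> bernstein_box rho By b ->
  setprod (cball eps a) (cball eps b) `<=` Omega.

(** The point moves along the real segment between [y2] and [y1], where a parameter disc of radius
    [eps / enorm (y1 - y2)] stays in the ball of radius [eps]. [A] ranges over a whole ball because
    the estimate in [x] needs this bound on full discs. *)
Lemma second_variable_lipschitz (j : 'I_d) a A y1 y2 :
  bernstein_box rho Bx a -> cball eps a A -> boxset By y1 -> boxset By y2 ->
  normc (Phi (row_mx A (real_row y1)) - Phi (row_mx A (real_row y2)))
    <= M * enorm (y1 - y2) / eps.
Proof.
move=> ha hA h1 h2.
have inO y : boxset By y -> Omega (row_mx A (real_row y)).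
  move=> hy; have hY := real_row_bernstein_box j rho1 hy.
  apply: (epsOmega ha hY); exists A => //; exists (real_row y) => //; exact: cball_center.
have M0 : 0 <= M by apply: le_trans (bdPhi (inO _ h1)); exact: normc_ge0.
have [|n0] := eqVneq (enorm (y1 - y2)) 0.
  move=> h; have /eqP := enorm_eq0 h; rewrite subr_eq0 => /eqP ->.
  by rewrite !subrr normc0 divr_ge0 ?mulr_ge0 ?enorm_ge0 // ltW.
have n1 : 0 < enorm (y1 - y2) by rewrite lt_neqAle eq_sym n0 enorm_ge0.
pose p := row_mx A (real_row y2).
pose v : 'rV[Cx R]_(d + d) := row_mx 0 (real_row (y1 - y2)).
have lineE (s : R[i]) : line p v s = row_mx A (\row_(i < d) ((y2 0 i)%:C + s * (y1 0 i - y2 0 i)%:C) : 'rV[Cx R]_d).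
  apply/rowP => i; rewrite !mxE; case: (fintype.split i) => k; rewrite !mxE ?mulr0 ?addr0 //.
have l1 : line p v 1 = row_mx A (real_row y1).
  rewrite lineE; congr row_mx; apply/rowP => i; rewrite !mxE mul1r -rmorphD /=.
  by congr (_%:C); ring.
have l0 : line p v 0 = row_mx A (real_row y2).
  by rewrite lineE; congr row_mx; apply/rowP => i; rewrite !mxE mul0r addr0.
have r0 : 0 < eps / enorm (y1 - y2) by rewrite divr_gt0.
have := @hol_lipschitz_segment R (fun s => Phi (line p v s)) 0 1 _ M r0 _.
rewrite l1 l0 subr0 normc1 mulr1 => h.
have -> : M * enorm (y1 - y2) / eps = M / (eps / enorm (y1 - y2)).
  by rewrite invf_div mulrA.
apply: h => t t01 z; rewrite add0r mulr1 ltr_pdivlMr // => hz.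
pose yt := y2 + t *: (y1 - y2).
have hyt : boxset By yt.
  move=> i; rewrite !mxE; have /andP[a1 a2] := h1 i; have /andP[b1 b2] := h2 i.
  case/andP: t01 => t0 t1; apply/andP; split; nra.
have zO : Omega (line p v z).
  rewrite lineE; apply: (epsOmega ha (real_row_bernstein_box j rho1 hyt)).
  exists A => //; eexists; last by [].
  rewrite /cball /= /cenorm.
  rewrite (eq_bigr (fun i => normc ((z - t%:C) * ((y1 - y2) 0 i)%:C) ^+ 2)).
    by rewrite cenorm_real_scale.
  move=> i _; congr (normc _ ^+ 2); rewrite !mxE !(rmorphD, rmorphM, rmorphB, rmorphN) /=; ring.
by split; [exact: (analytic_hol_line anPhi)|exact: bdPhi].
Qed.

(** The Cauchy estimate in [x] is applied to the difference in [y], already bounded by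
    [M * enorm (y1 - y2) / eps]; this yields the second power of [eps]. The segment from 0 to [u]
    stays in the ellipse, which is star-shaped about 0. *)
Lemma mixed_difference_bound x (j : 'I_d) (c h : R) y1 y2 (u : R[i]) :
  0 < h -> (forall u, bernstein rho u -> bernstein_box rho Bx (cslice x j c h u)) ->
  boxset By y1 -> boxset By y2 -> bernstein rho u ->
  let G u := Phi (row_mx (cslice x j c h u) (real_row y1))
             - Phi (row_mx (cslice x j c h u) (real_row y2)) in
  hol G u /\ normc (G u - G 0) <= M * enorm (y1 - y2) / eps ^+ 2 * h * normc u.
Proof.
move=> h0 hZ h1 h2 hu G.
have GE y s : line (row_mx (cslice x j c h 0) (real_row y))
    (row_mx (\row_(i < d) (if i == j then h%:C else 0) : 'rV[Cx R]_d) 0) s = row_mx (cslice x j c h s) (real_row y).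
  apply/rowP => i; rewrite !mxE; case: (fintype.split i) => k; rewrite !mxE ?mulr0 ?addr0 //.
  by case: eqVneq => _; rewrite ?mulr0 ?addr0 //; ring.
have holG a s : bernstein_box rho Bx a -> cball eps a (cslice x j c h s) -> hol G s.
  move=> ha hs.
  have hy y : boxset By y -> hol (fun s => Phi (row_mx (cslice x j c h s) (real_row y))) s.
    move=> hy; have hY := real_row_bernstein_box j rho1 hy.
    have hO : Omega (line (row_mx (cslice x j c h 0) (real_row y))
      (row_mx (\row_(i < d) (if i == j then h%:C else 0) : 'rV[Cx R]_d) 0) s).
      rewrite GE; apply: (epsOmega ha hY); exists (cslice x j c h s) => //.
      exists (real_row y) => //; exact: cball_center.
    by apply: eq_hol (analytic_hol_line anPhi hO) => s'; rewrite GE.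
  by apply: hol_sub; exact: hy.
split; first by apply: (holG _ _ (hZ u hu)); exact: cball_center.
have r0 : 0 < eps / h by rewrite divr_gt0.
have := @hol_lipschitz_segment R G 0 u _ (M * enorm (y1 - y2) / eps) r0 _.
rewrite subr0 => H.
have -> : M * enorm (y1 - y2) / eps ^+ 2 * h * normc u =
   M * enorm (y1 - y2) / eps / (eps / h) * normc u.
  by field; rewrite !gt_eqF.
apply: H => t t01 z; rewrite add0r ltr_pdivlMr // => hz.
have ht := hZ _ (bernstein_scale rho1 t01 hu).
have hc : cball eps (cslice x j c h (t%:C * u)) (cslice x j c h z).
  by rewrite /cball /= cenorm_cslice ?ltW // mulrC.
split; first exact: holG ht hc.
exact: (second_variable_lipschitz j ht hc).
Qed.

End MixedDifference.

(** * The recursion *)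

Section SingleStep.
Variables (R : realType) (d m : nat) (t : 'I_m.+1 -> R).
Hypothesis d_gt0 : (0 < d)%N.
Hypothesis inj_t : injective t.
Hypothesis t_itv : forall k, -1 <= t k <= 1.
Variables (Omega : set 'rV[Cx R]_(d + d)) (Phi : 'rV[Cx R]_(d + d) -> Cx R).
Variables (rho eps M qbar kappa gamma : R) (B0 B' B By : box R d) (y1 y2 : 'rV[R]_d).
Hypothesis anPhi : analytic_on Omega Phi.
Hypothesis bdPhi : forall w, Omega w -> normc (Phi w) <= M.
Hypothesis rho1 : 1 < rho.
Hypothesis eps0 : 0 < eps.
Hypothesis epsOmega : forall a b, bernstein_box rho B0 a -> bernstein_box rho By b ->
  setprod (cball eps a) (cball eps b) `<=` Omega.
Hypothesis realPhi : forall x z, boxset B0 x -> boxset By z ->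
  complex.Im (Phi (cpair x z)) = 0.
Hypothesis qbar01 : 0 < qbar < 1.
Hypothesis subB' : boxset B' `<=` boxset B0.
Hypothesis subB : boxset B `<=` boxset B'.
Hypothesis shrink : forall i, hi B 0 i - lo B 0 i <= qbar * (hi B' 0 i - lo B' 0 i).
Hypothesis By1 : boxset By y1.
Hypothesis By2 : boxset By y2.
Hypothesis kappa0 : 0 <= kappa.
Hypothesis gamma0 : 0 < gamma.
Hypothesis small_phase :
  kappa * diam (boxset B') * enorm (y1 - y2) * M / eps ^+ 2 <= 2 * gamma.

Lemma normc_Efun x z : boxset B0 x -> boxset By z -> normc (Efun kappa Phi z x) = 1.
Proof.
move=> hx hz; rewrite /Efun normc_cexp.
have := realPhi hx hz; case: (Phi _) => a b /= ->.
by rewrite !(mul0r, mulr0, mul1r, subr0, addr0, oppr0) expR0.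
Qed.

(** Only the imaginary part of [w] affects the modulus, and it is that of [w - w0] since [w0] is
    real. *)
Lemma normc_phase_le (w w0 : R[i]) (b : R) :
  complex.Im w0 = 0 -> normc (w - w0) <= b -> kappa * b <= gamma * ((rho + rho^-1) / 2) ->
  normc (cexp ('i%C * kappa%:C * w)) <= expR (gamma * ((rho + rho^-1) / 2 + 1)).
Proof.
move=> im0 hb kb; rewrite normc_cexp ler_expR.
have -> : complex.Re ('i%C * kappa%:C * w) = - (kappa * complex.Im (w - w0)).
  by case: w w0 im0 {hb} => a1 b1 [a2 b2] /= ->; rewrite !(mul0r, mulr0, mul1r, subr0, oppr0, sub0r, addr0, add0r).
have h1 : `|complex.Im (w - w0)| <= b by apply: le_trans hb; exact: ler_Im_normc.
rewrite ler_norml in h1; case/andP: h1 => h1 _.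
have := ler_wpM2l kappa0 h1; rewrite mulrN; move: kb gamma0; lra.
Qed.

(** The width [2 * half B j] is at most the diameter in [small_phase]; this 2 compensates the 2 in
    front of [gamma] there. *)
Lemma phase_budget (j : 'I_d) (u : R[i]) : bernstein rho u ->
  kappa * (M * enorm (y1 - y2) / eps ^+ 2 * half B j * normc u)
    <= gamma * ((rho + rho^-1) / 2).
Proof.
move=> hu; have nu := bernstein_norm_le hu.
have r2 := gt2_joukowski rho1.
have M0 : 0 <= M.
  have hy : boxset By (lo By) by move=> k; rewrite lexx ltW // lo_lt_hi.
  have hx : boxset B0 (lo B0) by move=> k; rewrite lexx ltW // lo_lt_hi.
  have hw : Omega (row_mx (real_row (lo B0)) (real_row (lo By))).
    apply: (epsOmega (real_row_bernstein_box j rho1 hx) (real_row_bernstein_box j rho1 hy)).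
    exists (real_row (lo B0)); first exact: cball_center.
    by exists (real_row (lo By)) => //; exact: cball_center.
  by apply: le_trans (bdPhi hw); exact: normc_ge0.
pose k := kappa * enorm (y1 - y2) * M / eps ^+ 2.
have k0 : 0 <= k by rewrite divr_ge0 ?mulr_ge0 ?enorm_ge0 ?exprn_ge0 // ltW.
have hB : 2 * half B j <= diam (boxset B').
  apply: le_trans (width_le_diam B' j); have [l h] := subset_box subB j.
  by rewrite /half; lra.
have e1 : kappa * diam (boxset B') * enorm (y1 - y2) * M / eps ^+ 2 = k * diam (boxset B').
  by rewrite /k; ring.
have h1 : k * half B j <= gamma.
  by have := ler_wpM2l k0 hB; have := small_phase; rewrite e1; lra.
have -> : kappa * (M * enorm (y1 - y2) / eps ^+ 2 * half B j * normc u) = (k * half B j) * normc u.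
  by rewrite /k; ring.
apply: ler_pM => //; first by rewrite mulr_ge0 // ltW // half_gt0.
exact: normc_ge0.
Qed.

Lemma interp_step (p : 'rV[R]_d -> Cx R) (Mp : R) :
  Qpoly m p -> (forall x, boxset B' x -> normc (p x) <= Mp) ->
  let F x := (Efun kappa Phi y2 x)^-1 * (Efun kappa Phi y1 x * p x) in
  forall x, boxset B x ->
  normc (F x - box_interp t B F x) <=
    2 * d%:R / (rho - 1) * (1 + lebesgue_const t) ^+ d
      * expR (gamma * ((rho + rho^-1) / 2 + 1))
      * ((1 + Num.sqrt qbar * (rho - 1)) / rho) ^+ m * Mp.
Proof.
move=> Qp hp F x hx.
have Mp0 : 0 <= Mp by apply: le_trans (hp x (subB hx)); exact: normc_ge0.
set Lam := lebesgue_const t; set EE := expR _; set rho' := 1 + Num.sqrt qbar * (rho - 1).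
have Lam0 : 0 <= Lam := lebesgue_const_ge0 inj_t t_itv.
have sq0 : 0 < Num.sqrt qbar by rewrite sqrtr_gt0; case/andP: qbar01.
have r10 : 0 < rho - 1 by rewrite subr_gt0.
have rp : 0 < rho := lt_trans ltr01 rho1.
have rho'1 : 1 < rho'.
  rewrite /rho' ltrDl; apply: mulr_gt0 => //.
have rho'p : 0 < rho' := lt_trans ltr01 rho'1.
have EE0 : 0 < EE := expR_gt0 _.
have Lam1 : 0 <= 1 + Lam by apply: addr_ge0.
pose Mg := EE * (rho' ^+ m * Mp).
pose E := (1 + Lam) * (2 * Mg / (rho ^+ m * (rho - 1))).
have E0 : 0 <= E.
  apply: mulr_ge0 => //; apply: divr_ge0; last exact: mulr_ge0 (exprn_ge0 _ (ltW rp)) (ltW r10).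
  by apply: mulr_ge0 => //; apply: mulr_ge0 (ltW EE0) (mulr_ge0 (exprn_ge0 _ (ltW rho'p)) Mp0).
have rm0 : 0 < rho ^+ m by rewrite exprn_gt0.
have main : forall (j : 'I_d) y, cube y ->
   normc (F (to_box B y) - \sum_c F (to_box B (upd y j (t c))) * (ell t c (y 0 j))%:C) <= E.
  move=> j y hy; set X := to_box B y.
  have hX : boxset B X := to_box_cube B hy.
  have [P szP PE] := Qpoly_slice X j Qp.
  pose Z := cslice X j (mid B j) (half B j).
  pose G u := Phi (row_mx (Z u) (real_row y1)) - Phi (row_mx (Z u) (real_row y2)).
  (* Analyticity of the phase is inherited from the ellipse of the outermost box at the same [rho].
     The polynomial is treated separately through [B'], where it is bounded and the contraction by
     [qbar] is known. *)
  have hB0 : boxset B `<=` boxset B0 by move=> z /subB/subB'.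
  have hZ u : bernstein rho u -> bernstein_box rho B0 (Z u).
    move=> hu; have [q0 s1 s2 aff] := nested_affine j hB0.
    apply: (@bernstein_box_mid _ _ rho B0 j _
      (((mid B j - mid B0 j) / half B0 j)%:C + (half B j / half B0 j)%:C * u)) => //.
    - by move=> i ij; exists (X 0 i); [exact: hB0 hX i|rewrite mxE (negbTE ij)].
    - by rewrite -aff mxE eqxx.
    exact: bernstein_contract.
  have ZE (s : R) : Z s%:C = real_row (upd X j (mid B j + half B j * s)).
    apply/rowP => i; rewrite !mxE; case: eqVneq => // _.
    by rewrite -rmorphM -rmorphD.
  have mixed u : bernstein rho u -> hol G u /\
      normc (G u - G 0) <= M * enorm (y1 - y2) / eps ^+ 2 * half B j * normc u.
    move=> hu; exact: (mixed_difference_bound anPhi bdPhi rho1 eps0 epsOmega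
      (half_gt0 B j) hZ By1 By2 hu).
  have imG0 : complex.Im (G 0) = 0.
    have y0 : boxset B0 (upd X j (mid B j + half B j * 0)).
      rewrite -to_box_upd; apply: hB0; apply: to_box_cube => i.
      rewrite mxE; case: eqVneq => // _; lra.
    have z0 : Z 0 = real_row (upd X j (mid B j + half B j * 0)) by rewrite -ZE.
    have := realPhi y0 By1; have := realPhi y0 By2; rewrite /cpair /G z0 /real_row.
    by case: (Phi _) => a1 b1; case: (Phi _) => a2 b2 /= -> ->; rewrite subr0.
  pose g u := cexp ('i%C * kappa%:C * G u) * P.[(mid B j)%:C + (half B j)%:C * u].
  have gE (s : R) : g s%:C = F (to_box B (upd y j s)).
    rewrite to_box_upd -/X /F PE /g /G ZE /Efun /cpair /real_row.
    rewrite -cexpN mulrA -cexpD -rmorphM -rmorphD; congr (cexp _ * _); ring.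
  have polbd u : bernstein rho u ->
      normc P.[(mid B j)%:C + (half B j)%:C * u] <= rho' ^+ m * Mp.
    move=> hu; have [q0 s1 s2 aff] := nested_affine j subB.
    rewrite aff; set v := _%:C + _ * u.
    pose A : {poly R[i]} := (half B' j)%:C *: 'X + ((mid B' j)%:C)%:P.
    have szA : (size A <= 2)%N.
      apply: leq_trans (size_polyD _ _) _; rewrite geq_max.
      apply/andP; split; last exact: leq_trans (size_polyC_leq1 _) (leqnSn 1).
      by apply: leq_trans (size_scale_leq _ _) _; rewrite size_polyX.
    have AE (w : R[i]) : (P \Po A).[w] = P.[(mid B' j)%:C + (half B' j)%:C * w].
      by rewrite horner_comp /A !hornerE addrC.
    rewrite -AE; apply: bernstein_inequality => //.
    - apply: leq_trans (size_comp_poly_leq _ _) _; rewrite ltnS.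
      have e1 : ((size P).-1 <= m)%N by move: szP; case: (size P).
      have e2 : ((size A).-1 <= 1)%N by move: szA; case: (size A).
      by apply: leq_trans (leq_mul e1 e2) _; rewrite muln1.
    - move=> s hs; rewrite AE -rmorphM -rmorphD /= -PE; apply: hp => i; rewrite mxE.
      case: eqVneq => [->|_]; last exact: subB hX i.
      have := half_gt0 B' j; case/andP: hs => hs1 hs2; rewrite /mid /half => h0.
      by apply/andP; split; nra.
    apply: ellipse_inclusion => //; rewrite q0 ler_pdivrMr ?half_gt0 //.
    by have := shrink j; rewrite /half; lra.
  have hg u : bernstein rho u -> hol g u /\ normc (g u) <= Mg.
    move=> hu; have [holG bdG] := mixed u hu; split.
      apply: hol_mul.
        apply: (@hol_comp _ (@cexp R)); last exact: hol_cexp.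
        by apply: hol_mul => //; exact: hol_cst.
      apply: (@hol_comp _ (horner P)); last exact: hol_poly.
      by apply: hol_add; [exact: hol_cst|apply: hol_mul; [exact: hol_cst|exact: hol_id]].
    rewrite /g normcM; apply: ler_pM; rewrite ?normc_ge0 //; last exact: polbd.
    by apply: normc_phase_le imG0 bdG _; exact: phase_budget.
  have := interp_error inj_t t_itv rho1 hg (hy j).
  rewrite gE; have -> : upd y j (y 0 j) = y.
    by apply/rowP => i; rewrite mxE; case: eqVneq => // ->.
  by under eq_bigr do rewrite gE.
have := tensor_interp_error inj_t t_itv (f := fun u => F (to_box B u)) (of_box_cube hx) main.
rewrite of_boxK => h; apply: le_trans h _.
have -> : d%:R * (Lam ^+ d.-1 * E) =
   2 * d%:R / (rho - 1) * (Lam ^+ d.-1 * (1 + Lam)) * EE * (rho' / rho) ^+ m * Mp.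
  rewrite /E /Mg expr_div_n; by field; rewrite !gt_eqF.
have K0 : 0 <= 2 * d%:R / (rho - 1) by apply: divr_ge0 (ltW r10); apply: mulr_ge0; rewrite ?ler0n.
set W := (rho' / rho) ^+ m.
have X0 : 0 <= EE * (W * Mp).
  by apply: mulr_ge0 (ltW EE0) (mulr_ge0 (exprn_ge0 _ (divr_ge0 (ltW rho'p) (ltW rp))) Mp0).
set K := 2 * d%:R / (rho - 1) in K0 *.
have -> : K * (Lam ^+ d.-1 * (1 + Lam)) * EE * W * Mp =
  K * (Lam ^+ d.-1 * (1 + Lam) * (EE * (W * Mp))) by rewrite !mulrA.
have -> : K * (1 + Lam) ^+ d * EE * W * Mp = K * ((1 + Lam) ^+ d * (EE * (W * Mp))).
  by rewrite !mulrA.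
apply: ler_wpM2l => //; apply: ler_wpM2r => //.
(* The telescoping over coordinates gives [Lam ^+ d.-1 * (1 + Lam)], which [(1 + Lam) ^+ d]
   dominates. *)
rewrite -[in leRHS](prednK d_gt0) exprSr; apply: ler_wpM2r => //.
by rewrite lerXn2r ?nnegrE // lerDr.
Qed.

End SingleStep.

(** For a finite supremum [D], a radius above [3 / 4 * D] gives [D ^+ 2 <= 2 * eps ^+ 2], as
    [16 / 9 <= 2]. For [+oo], a radius large enough for the last inequality is taken directly. *)
Lemma radius_exists (R : realType) (d : nat) (rho : R) (Bx By : box R d)
    (Omega : set 'rV[Cx R]_(d + d)) (Phi : 'rV[Cx R]_(d + d) -> Cx R) (K gamma : R) :
  0 <= K -> 0 < gamma -> Omega !=set0 ->
  (exists M : R, forall w, Omega w -> normc (Phi w) <= M) ->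
  (0 < dOmega rho Bx By Omega)%E ->
  (K%:E * supnorm Omega Phi / dOmega rho Bx By Omega ^+ 2 <= gamma%:E)%E ->
  exists eps M : R, [/\ 0 < eps,
    forall a b, bernstein_box rho Bx a -> bernstein_box rho By b ->
      setprod (cball eps a) (cball eps b) `<=` Omega,
    forall w, Omega w -> normc (Phi w) <= M &
    K * M / eps ^+ 2 <= 2 * gamma].
Proof.
move=> K0 gamma0 [w0 Ow0] [M0 hM0] dpos hyp.
have [M MS] : exists M : R, supnorm Omega Phi = M%:E.
  have lo : ((normc (Phi w0))%:E <= supnorm Omega Phi)%E by apply: ereal_sup_ubound; exists w0.
  have up : (supnorm Omega Phi <= M0%:E)%E.
    by apply: ge_ereal_sup => _ [w Ow <-]; rewrite lee_fin; exact: hM0.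
  by move: lo up; case: (supnorm _ _) => [r| |] //= _ _; exists r.
have hM w : Omega w -> normc (Phi w) <= M.
  by move=> Ow; rewrite -lee_fin -MS; apply: ereal_sup_ubound; exists w.
have Mge0 : 0 <= M by apply: le_trans (hM _ Ow0); exact: normc_ge0.
have KM0 : 0 <= K * M by exact: mulr_ge0.
rewrite MS in hyp.
have above (r : R) : (r%:E < dOmega rho Bx By Omega)%E -> exists eps : R, [/\ r < eps, 0 < eps &
    forall a b, bernstein_box rho Bx a -> bernstein_box rho By b ->
      setprod (cball eps a) (cball eps b) `<=` Omega].
  move=> /ereal_sup_gt[_ [e [e0 he] <-]]; rewrite lte_fin => re; by exists e.
move: dpos hyp above; case: (dOmega rho Bx By Omega) => [D| |] // dpos hyp above.
  rewrite lte_fin in dpos.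
  have [|eps [Deps eps0 heps]] := above (3 / 4 * D); first by rewrite lte_fin; lra.
  exists eps, M; split => //.
  have D2 : 0 < D ^+ 2 by rewrite exprn_gt0.
  have e2 : 0 < eps ^+ 2 by rewrite exprn_gt0.
  move: hyp; rewrite -EFin_expe -EFinM inver gt_eqF // -EFinM lee_fin.
  rewrite ler_pdivrMr // => h; rewrite ler_pdivrMr //.
  have : D ^+ 2 <= 2 * eps ^+ 2 by nra.
  nra.
pose r := K * M / (2 * gamma) + 1.
have r1 : 1 <= r by rewrite /r lerDr divr_ge0 //; lra.
have [|eps [reps eps0 heps]] := above r; first exact: ltry.
exists eps, M; split => //.
rewrite ler_pdivrMr ?exprn_gt0 //.
have : K * M <= 2 * gamma * r.
  have e1 : 2 * gamma * (K * M / (2 * gamma)) = K * M.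
    by rewrite mulrC divfK // gt_eqF // mulr_gt0.
  by rewrite /r mulrDr e1; lra.
have : r <= eps ^+ 2 by nra.
nra.
Qed.

Lemma comp_opsS (T : Type) (J : nat -> T -> T) l (f : T) :
  comp_ops J 1 l.+1 f = J l.+1 (comp_ops J 1 l f).
Proof.
have iotaS : iota 1 l.+1 = iota 1 l ++ [:: l.+1] by have := iotaD 1 l 1; rewrite addn1 add1n.
by rewrite /comp_ops /index_iota !subSS !subn0 iotaS foldl_cat.
Qed.

Lemma comp_ops0 (T : Type) (J : nat -> T -> T) l (f : T) :
  comp_ops J 0 l f = comp_ops J 1 l (J 0%N f).
Proof. by rewrite /comp_ops /index_iota subn0 subn1. Qed.

Theorem theorem2p5 (R : realType) (qbar rhomin : R) :
  0 < qbar < 1 -> 1 < rhomin ->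
  exists2 qhat : R, 0 < qhat < 1 &
  forall (d L m : nat) (kappa gamma : R) (t : 'I_m.+1 -> R)
    (Bx : nat -> box R d) (By : box R d)
    (Omega : set 'rV[Cx R]_(d + d)) (Phi : 'rV[Cx R]_(d + d) -> Cx R)
    (rho : R) (y : nat -> 'rV[R]_d),
  (0 < d)%N -> (0 < L)%N -> 0 <= kappa -> 0 < gamma ->
  injective t -> (forall k, -1 <= t k <= 1) ->
  (forall l, (l < L)%N -> boxset (Bx l.+1) `<=` boxset (Bx l)) ->
  (forall l i, (l < L)%N ->
    hi (Bx l.+1) 0 i - lo (Bx l.+1) 0 i
      <= qbar * (hi (Bx l) 0 i - lo (Bx l) 0 i)) ->
  open Omega -> analytic_on Omega Phi ->
  (exists M : R, forall w, Omega w -> normc (Phi w) <= M) ->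
  rhomin <= rho ->
  setprod (bernstein_box rho (Bx 0%N)) (bernstein_box rho By) `<=` Omega ->
  (forall x z, boxset (Bx 0%N) x -> boxset By z -> complex.Im (Phi (cpair x z)) = 0) ->
  (0 < dOmega rho (Bx 0%N) By Omega)%E ->
  (forall l, (l <= L)%N -> boxset By (y l)) ->
  (forall l, (l < L)%N ->
    ((kappa * diam (boxset (Bx l)) * enorm (y l.+1 - y l))%:E
       * supnorm Omega Phi / dOmega rho (Bx 0%N) By Omega ^+ 2
     <= gamma%:E)%E) ->
  let J l := dir_interp t kappa Phi (Bx l) (y l) in
  let Lam := lebesgue_const t in
  let C1 := 2 * d%:R / (rho - 1) * (1 + Lam) ^+ d
            * expR (gamma * ((rho + rho^-1) / 2 + 1)) in
  forall l : nat, (1 <= l <= L)%N ->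
  [/\ forall p, Qpoly m p ->
        let f x : Cx R := Efun kappa Phi (y 0%N) x * p x in
        (supnorm (boxset (Bx l)) (fun x => f x - comp_ops J 1 l f x)%R
         <= ((1 + C1 * qhat ^+ m) ^+ l - 1)%:E
            * supnorm (boxset (Bx 0%N)) p)%E,
      forall p, Qpoly m p ->
        let f x : Cx R := Efun kappa Phi (y 0%N) x * p x in
        (supnorm (boxset (Bx l)) (comp_ops J 1 l f)
         <= ((1 + C1 * qhat ^+ m) ^+ l)%:E
            * supnorm (boxset (Bx 0%N)) p)%E
    & (opnorm (boxset (Bx 0%N)) (boxset (Bx l)) (comp_ops J 0 l)
       <= (Lam ^+ d * (1 + C1 * qhat ^+ m) ^+ l)%:E)%E].
Proof.
move=> qb r1; exists (Num.sqrt qbar + (1 - Num.sqrt qbar) / rhomin).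
  exact: rho_ratio_itv.
set qhat := _ + _ => d L m kappa gamma t Bx By Omega Phi rho y d0 L0 kappa0 gamma0 inj_t
  t_itv nested shrink _ anPhi bdPhi rr EOmega realPhi dpos yBy phase J Lam C1 l /andP[l1 lL].
have rho1 : 1 < rho by lra.
have q01 := rho_ratio_itv qb r1; rewrite -/qhat in q01.
have q0 : 0 < qhat by case/andP: q01.
have Lam0 : 0 <= Lam := lebesgue_const_ge0 inj_t t_itv.
have C10 : 0 < C1.
  rewrite /C1; apply: mulr_gt0; last exact: expR_gt0.
  apply: mulr_gt0; last by rewrite exprn_gt0 //; lra.
  by apply: divr_gt0; [rewrite mulr_gt0 ?ltr0n|lra].
set c := C1 * qhat ^+ m.
have c0 : 0 < c by rewrite mulr_gt0 // exprn_gt0.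
have sub0 k : (k <= L)%N -> boxset (Bx k) `<=` boxset (Bx 0%N).
  elim: k => [|k IH] kL //; exact: subset_trans (nested k kL) (IH (ltnW kL)).
pose j0 : 'I_d := Ordinal d0.
have loB (B : box R d) : boxset B (lo B) by move=> k; rewrite lexx ltW // lo_lt_hi.
have Omega_ne : Omega !=set0.
  exists (row_mx (real_row (lo (Bx 0%N))) (real_row (lo By))); apply: EOmega.
  exists (real_row (lo (Bx 0%N))); first exact: real_row_bernstein_box j0 rho1 (loB _).
  by exists (real_row (lo By)) => //; exact: real_row_bernstein_box j0 rho1 (loB _).
pose E k x : Cx R := Efun kappa Phi (y k) x.
have nE k x : (k <= L)%N -> boxset (Bx 0%N) x -> normc (E k x) = 1.
  by move=> kL hx; apply: (normc_Efun _ realPhi hx (yBy k kL)).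
have E_neq0 k x : E k x != 0 by exact: cexp_neq0.
have step k (p : 'rV[R]_d -> Cx R) (Mp : R) : (k < L)%N -> Qpoly m p ->
    (forall x, boxset (Bx k) x -> normc (p x) <= Mp) ->
    let F x := (E k.+1 x)^-1 * (E k x * p x) in
    forall x, boxset (Bx k.+1) x -> normc (F x - box_interp t (Bx k.+1) F x) <= c * Mp.
  move=> kL Qp hp F x hx.
  have Mp0 : 0 <= Mp by apply: le_trans (hp x (nested k kL x hx)); exact: normc_ge0.
  have K0 : 0 <= kappa * diam (boxset (Bx k)) * enorm (y k.+1 - y k).
    apply: mulr_ge0; last exact: enorm_ge0.
    apply: mulr_ge0 => //; apply: le_trans (width_le_diam _ j0).
    by rewrite mulr_ge0 // ltW // half_gt0.
  have [eps [M [eps0 epsO hM small]]] := radius_exists K0 gamma0 Omega_ne bdPhi dpos (phase k kL).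
  have enC : enorm (y k.+1 - y k) = enorm (y k - y k.+1).
    by congr (Num.sqrt _); apply: eq_bigr => i _; rewrite !mxE -sqrrN opprB.
  rewrite enC in small.
  have := interp_step d0 inj_t t_itv anPhi hM rho1 eps0 epsO realPhi qb (sub0 k (ltnW kL))
    (nested k kL) (fun i => shrink k i kL) (yBy k (ltnW kL)) (yBy k.+1 kL) kappa0 gamma0 small Qp hp hx.
  move=> h; apply: le_trans h _; rewrite /c -/Lam -/C1; apply: ler_wpM2r => //.
  apply: ler_wpM2l; first exact: ltW.
  have sq0 := sqrtr_ge0 qbar.
  have ratio0 : 0 <= (1 + Num.sqrt qbar * (rho - 1)) / rho.
    by apply: divr_ge0; [apply: addr_ge0 => //; apply: mulr_ge0 => //; lra|lra].
  by rewrite lerXn2r ?nnegrE ?(ltW q0) // rho_ratio_le.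
(* The error recursion closes because [(1 + c) ^+ k - 1 + c * (1 + c) ^+ k = (1 + c) ^+ k.+1 -
   1]. *)
have iter (p : 'rV[R]_d -> Cx R) (Mp : R) k : (k <= L)%N -> Qpoly m p ->
    (forall x, boxset (Bx 0%N) x -> normc (p x) <= Mp) ->
    let f x : Cx R := E 0%N x * p x in
    exists pk, [/\ Qpoly m pk, comp_ops J 1 k f = (fun x => E k x * pk x),
      forall x, boxset (Bx k) x -> normc (pk x) <= (1 + c) ^+ k * Mp &
      forall x, boxset (Bx k) x ->
        normc (f x - comp_ops J 1 k f x) <= ((1 + c) ^+ k - 1) * Mp].
  move=> kL Qp hp f; elim: k kL => [|k IH] kL.
    exists p; split => // x hx; first by rewrite expr0 mul1r; exact: hp.
    by rewrite /comp_ops /= subrr normc0 expr0 subrr mul0r.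
  have [pk [Qk fk bk ek]] := IH (ltnW kL).
  pose F x := (E k.+1 x)^-1 * (E k x * pk x).
  have fS : comp_ops J 1 k.+1 f = (fun x => E k.+1 x * box_interp t (Bx k.+1) F x).
    by rewrite comp_opsS fk.
  have st := step k pk _ kL Qk bk.
  have FE x : E k x * pk x = E k.+1 x * F x by rewrite /F mulrA divff // mul1r.
  have nF x : boxset (Bx k.+1) x -> normc (F x) <= (1 + c) ^+ k * Mp.
    move=> hx; have hx0 := sub0 _ kL x hx.
    have := congr1 (@normc R) (FE x); rewrite (normcM (E k x)) (normcM (E k.+1 x)) !nE ?mul1r // ?(ltnW kL) // => <-.
    exact: bk (nested k kL x hx).
  exists (box_interp t (Bx k.+1) F); split => //.
  - exact: Qpoly_box_interp.
  - move=> x hx; have h1 := st x hx; have h2 := nF x hx; rewrite -/(F x) in h1.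
    have := ler_subc_normc (box_interp t (Bx k.+1) F x) (F x); rewrite normc_distC.
    by rewrite exprS -mulrA mulrDl mul1r; lra.
  move=> x hx; have hx0 := sub0 _ kL x hx.
  rewrite fS; apply: le_trans (ler_normc_dist (comp_ops J 1 k f x) _ _) _.
  have h1 := ek x (nested k kL x hx).
  have h2 : normc (comp_ops J 1 k f x - E k.+1 x * box_interp t (Bx k.+1) F x)
      <= c * ((1 + c) ^+ k * Mp).
    by rewrite fk FE -mulrBr normcM nE // mul1r; exact: st.
  by rewrite exprS; lra.
(* Strictness matters in [bounded]: a positive constant times an infinite norm is [+oo], not 0, so
   finiteness of the norm of [p] need not be shown. The value [-oo] is excluded because the box is
   nonempty. *)
have pow1 : 1 < (1 + c) ^+ l by rewrite exprn_egt1 // -?lt0n //; lra.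
have bounded (p : 'rV[R]_d -> Cx R) (S : \bar R) (K : R) : 0 < K ->
    (forall Mp : R, (forall x, boxset (Bx 0%N) x -> normc (p x) <= Mp) -> (S <= (K * Mp)%:E)%E) ->
    (S <= K%:E * supnorm (boxset (Bx 0%N)) p)%E.
  move=> K0 hS.
  have ub x : boxset (Bx 0%N) x -> ((normc (p x))%:E <= supnorm (boxset (Bx 0%N)) p)%E.
    by move=> hx; apply: ereal_sup_ubound; exists x.
  move: ub; case: (supnorm _ _) => [r| |] ub.
  - by rewrite -EFinM; apply: hS => x /ub; rewrite lee_fin.
  - by rewrite gt0_muley ?lte_fin // leey.
  - by have := ub _ (loB _).
have to_norm (g : 'rV[R]_d -> Cx R) (B : set 'rV[R]_d) (b : R) :
    (forall x, B x -> normc (g x) <= b) -> (supnorm B g <= b%:E)%E.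
  by move=> hg; apply: ge_ereal_sup => _ [x hx <-]; rewrite lee_fin; exact: hg.
have iter_norm (p : 'rV[R]_d -> Cx R) (Mp : R) : Qpoly m p ->
    (forall x, boxset (Bx 0%N) x -> normc (p x) <= Mp) ->
    forall x, boxset (Bx l) x ->
      normc (comp_ops J 1 l (fun x => E 0%N x * p x) x) <= (1 + c) ^+ l * Mp.
  move=> Qp hp x hx; have [pk [_ -> bk _]] := iter p Mp l lL Qp hp.
  by rewrite normcM nE ?mul1r //; [exact: bk|exact: sub0 hx].
split.
- move=> p Qp; lazy zeta; apply: bounded => [|Mp hp]; first by rewrite subr_gt0.
  by apply: to_norm; have [pk [_ _ _ ek]] := iter p Mp l lL Qp hp.
- move=> p Qp; lazy zeta; apply: bounded => [|Mp hp]; first exact: lt_trans pow1.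
  by apply: to_norm; exact: iter_norm.
apply: ge_ereal_sup => _ [f [_ f1] <-]; apply: to_norm => x hx.
have nf u : boxset (Bx 0%N) u -> normc (f u) <= 1.
  by move=> hu; rewrite -lee_fin; apply: le_trans f1; apply: ereal_sup_ubound; exists u.
(* The initial operator produces [E 0] times an interpolant bounded by [Lam ^+ d], to which the
   estimate for polynomials applies. *)
rewrite comp_ops0 mulrC.
apply: (iter_norm (box_interp t (Bx 0%N) (fun u => (E 0%N u)^-1 * f u))) => //.
  exact: Qpoly_box_interp.
move=> u hu; rewrite -[leRHS]mulr1.
apply: tensor_interp_bound (of_box_cube hu) _ => // v hv.
have hB := to_box_cube (Bx 0%N) hv.
by rewrite normcM normcV nE // invr1 mul1r; exact: nf.
Qed.
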